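(* Let $n\ge 2$, let $W$ be a Weyl group of type $B_n$, let $u\in W$, and let $U=[e,u]_R\subseteq W$ be the interval in the right weak order. Then $(W/U,U)$ is a splitting of $W$ if and only if $u$ is separable.
   Context: Let $\Phi$ be a crystallographic root system with simple system $\Delta$, positive system $\Phi^+$, negative roots $\Phi^-=-\Phi^+$, and Weyl group $W=W(\Phi)$ generated by the simple reflections $s_\alpha$, $\alpha\in\Delta$. $\ell$ denotes the length function with respect to the simple reflections, $e$ the identity. The inversion set of $w\in W$ is $I_\Phi(w)=\{\alpha\in\Phi^+\mid w\alpha\in\Phi^-\}$. On $\Phi^+$ put the partial order $\alpha\le\beta$ iff $\beta-\alpha$ is a nonnegative integral combination of simple roots. The right weak order on $W$: $u\le_R w$ iff $\ell(w)=\ell(u)+\ell(u^{-1}w)$; $[e,u]_R=\{x\in W\mid x\le_R u\}$. Generalized quotient: for $U\subseteq W$, $W/U=\{w\in W\mid \ell(wu)=\ell(w)+\ell(u)\text{ for all }u\in U\}$. Splitting: a pair $(X,Y)$ of subsets of $W$ is a splitting of $W$ if the multiplication map $X\times Y\to W$, $(x,y)\mapsto xy$, is bijective and length-additive, i.e. $\ell(xy)=\ell(x)+\ell(y)$ for all $x\in X$, $y\in Y$. Separable elements: for a linear subspace $V$ of $\mathrm{span}(\Phi)$, $\Phi'=\Phi\cap V$ is a root system with positive system $\Phi^+\cap V$, and $w|_{\Phi'}$ denotes the unique element $w'\in W(\Phi')$ with $I_{\Phi'}(w')=I_\Phi(w)\cap V$. An element $w\in W(\Phi)$ is separable (recursive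 definition) if one of the following holds: (S1) $\Phi$ is of type $A_1$; (S2) $\Phi=\bigoplus\Phi_i$ is reducible and $w|_{\Phi_i}$ is separable for each $i$; (S3) $\Phi$ is irreducible and there exists $\alpha_i\in\Delta$ such that $w|_{\Phi_J}\in W(\Phi_J)$ is separable, where $\Phi_J$ is the subsystem generated by $J=\Delta\setminus\{\alpha_i\}$, and either $\{\beta\in\Phi^+\mid\beta\ge\alpha_i\}\subset I_\Phi(w)$ or $\{\beta\in\Phi^+\mid\beta\ge\alpha_i\}\cap I_\Phi(w)=\emptyset$. (Here $\subset$ allows equality. The identity of the trivial group is regarded as separable.) *)

(* Defs.v *)
From mathcomp Require Import all_boot all_order all_algebra finmap.
From mathcomp Require Import boolp classical_sets functions.

Set Implicit Arguments.
Unset Strict Implicit.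
Unset Printing Implicit Defensive.

Import Order.TTheory GRing.Theory Num.Theory.

Local Open Scope classical_set_scope.
Local Open Scope fset_scope.
Local Open Scope ring_scope.

(* The ambient Euclidean space is 'cV[R]_d with the standard inner product;   *)
(* it need not be spanned by the roots. Elements of Weyl groups are d x d     *)
(* matrices acting on the left on column vectors, so that w *m u is the       *)
(* composite "first u, then w" and w *m a is the root w(a).                   *)

Definition dot (R : realFieldType) (d : nat) (a b : 'cV[R]_d) : R :=
  (a^T *m b) 0 0.

(* The Cartan number <b, a^v> = 2 (b, a) / (a, a). *)
Definition cartan (R : realFieldType) (d : nat) (b a : 'cV[R]_d) : R :=
  2 * dot b a / dot a a.

(* The matrix of b |-> b - <b, a^v> a. *)
Definition refl (R : realFieldType) (d : nat) (a : 'cV[R]_d) : 'M[R]_d :=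
  1%:M - (2 / dot a a) *: (a *m a^T).

Definition root_system (R : realFieldType) (d : nat)
    (Phi : {fset 'cV[R]_d}) : Prop :=
  [/\ 0 \notin Phi,
      (forall a b, a \in Phi -> b \in Phi -> refl a *m b \in Phi),
      (forall a b, a \in Phi -> b \in Phi ->
         exists k : int, cartan b a = k%:~R) &
      (forall (a : 'cV[R]_d) (c : R), a \in Phi -> c *: a \in Phi ->
         c = 1 \/ c = -1)].

Definition nonneg_comb (R : realFieldType) (d : nat)
    (Delta : {fset 'cV[R]_d}) (v : 'cV[R]_d) : Prop :=
  exists c : 'cV[R]_d -> nat, v = \sum_(a <- Delta) a *+ c a.

Definition simple_system (R : realFieldType) (d : nat)
    (Phi Delta : {fset 'cV[R]_d}) : Prop :=
  [/\ Delta `<=` Phi,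
      free (enum_fset Delta) &
      forall b, b \in Phi -> nonneg_comb Delta b \/ nonneg_comb Delta (- b)].

Definition pos_roots (R : realFieldType) (d : nat)
    (Phi Delta : {fset 'cV[R]_d}) : {fset 'cV[R]_d} :=
  [fset b in Phi | `[< nonneg_comb Delta b >]].

Definition root_le (R : realFieldType) (d : nat)
    (Delta : {fset 'cV[R]_d}) (a b : 'cV[R]_d) : Prop :=
  nonneg_comb Delta (b - a).

Definition refl_prod (R : realFieldType) (d : nat) (s : seq 'cV[R]_d) :
    'M[R]_d :=
  \big[mulmx/1%:M]_(a <- s) refl a.

(* The group generated by the reflections in the elements of A: reflections   *)
(* are involutions, so it consists of the products of such reflections.       *)
Definition refl_group (R : realFieldType) (d : nat) (A : {fset 'cV[R]_d}) :
    set 'M[R]_d :=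
  [set w | exists2 s : seq 'cV[R]_d, {subset s <= A} & w = refl_prod s].

(* The length of w with respect to the reflections in Delta; the default      *)
(* value 0 is only taken outside refl_group Delta.                            *)
Definition len (R : realFieldType) (d : nat) (Delta : {fset 'cV[R]_d})
    (w : 'M[R]_d) : nat :=
  xget 0%N [set k : nat |
    (exists s : seq 'cV[R]_d,
       [/\ {subset s <= Delta}, w = refl_prod s & size s = k]) /\
    (forall s : seq 'cV[R]_d,
       {subset s <= Delta} -> w = refl_prod s -> (k <= size s)%N)].

(* The inversions of w in a positive system P of a root system. *)
Definition inversions (R : realFieldType) (d : nat) (P : {fset 'cV[R]_d})
    (w : 'M[R]_d) : {fset 'cV[R]_d} :=
  [fset b in P | - (w *m b) \in P].

Definition cut (R : realFieldType) (d : nat) (A : {fset 'cV[R]_d})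
    (V : {vspace 'cV[R]_d}) : {fset 'cV[R]_d} :=
  [fset b in A | b \in V].

(* The restriction of w to the subsystem of Phi in V: the (unique) element w' *)
(* of the Weyl group of that subsystem, which has the positive system         *)
(* cut (pos_roots Phi Delta) V, whose inversions are those of w lying in V.   *)
Definition restr (R : realFieldType) (d : nat) (Phi Delta : {fset 'cV[R]_d})
    (V : {vspace 'cV[R]_d}) (w : 'M[R]_d) : 'M[R]_d :=
  xget 1%:M [set w' | refl_group (cut Phi V) w' /\
    inversions (cut (pos_roots Phi Delta) V) w' =
      cut (inversions (pos_roots Phi Delta) w) V].

Definition orthogonal_sets (R : realFieldType) (d : nat)
    (A B : {fset 'cV[R]_d}) : Prop :=
  forall a b, a \in A -> b \in B -> dot a b = 0.

Definition irreducible_roots (R : realFieldType) (d : nat)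
    (Phi : {fset 'cV[R]_d}) : Prop :=
  Phi <> fset0 /\
  forall A B : {fset 'cV[R]_d}, Phi = A `|` B -> orthogonal_sets A B ->
    A = fset0 \/ B = fset0.

(* Phi is the orthogonal direct sum of the irreducible members of Cs. *)
Definition decomposition (R : realFieldType) (d : nat)
    (Phi : {fset 'cV[R]_d}) (Cs : {fset {fset 'cV[R]_d}}) : Prop :=
  [/\ (forall b, b \in Phi <-> exists2 C, C \in Cs & b \in C),
      (forall C, C \in Cs -> irreducible_roots C) &
      (forall C D, C \in Cs -> D \in Cs -> C <> D -> orthogonal_sets C D)].

Definition above (R : realFieldType) (d : nat) (Phi Delta : {fset 'cV[R]_d})
    (a : 'cV[R]_d) : {fset 'cV[R]_d} :=
  [fset b in pos_roots Phi Delta | `[< root_le Delta a b >]].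

(* In separable_red and separable_irr the subspace V is spanned by a union of *)
(* components, resp. by a subset of Delta, so that cut Delta V is a simple    *)
(* system of cut Phi V, with positive system cut (pos_roots Phi Delta) V.     *)
Inductive separable (R : realFieldType) (d : nat) :
    {fset 'cV[R]_d} -> {fset 'cV[R]_d} -> 'M[R]_d -> Prop :=
| separable_trivial :
    separable fset0 fset0 1%:M
| separable_A1 (a : 'cV[R]_d) (w : 'M[R]_d) :
    a != 0 -> refl_group [fset a] w ->
    separable [fset a; - a] [fset a] w
| separable_red (Phi Delta : {fset 'cV[R]_d}) (w : 'M[R]_d)
    (Cs : {fset {fset 'cV[R]_d}}) :
    refl_group Delta w ->
    decomposition Phi Cs -> (1 < #|` Cs|)%N ->
    (forall C, C \in Cs ->
       let V := <<enum_fset C>>%VS in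
       separable (cut Phi V) (cut Delta V) (restr Phi Delta V w)) ->
    separable Phi Delta w
| separable_irr (Phi Delta : {fset 'cV[R]_d}) (w : 'M[R]_d)
    (a : 'cV[R]_d) :
    refl_group Delta w ->
    irreducible_roots Phi -> a \in Delta ->
    (let V := <<enum_fset (Delta `\ a)>>%VS in
     separable (cut Phi V) (cut Delta V) (restr Phi Delta V w)) ->
    above Phi Delta a `<=` inversions (pos_roots Phi Delta) w \/
    above Phi Delta a `&` inversions (pos_roots Phi Delta) w = fset0 ->
    separable Phi Delta w.

(* The Cartan matrix <a_i, a_j^v> of type B_n, n >= 2, with the simple roots  *)
(* numbered from 0 and a_{n-1} the short one.                                 *)
Definition cartan_B (n i j : nat) : int :=
  if i == j then 2
  else if (j == i.+1)%N then (if (j == n.-1)%N then - 2 else - 1)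
  else if (i == j.+1)%N then - 1
  else 0.

(* Entries off the diagonal are at most 0, so alpha is injective. *)
Definition type_B (R : realFieldType) (d n : nat)
    (Delta : {fset 'cV[R]_d}) : Prop :=
  exists alpha : 'I_n -> 'cV[R]_d,
    (forall a, a \in Delta <-> exists i, a = alpha i) /\
    (forall i j, cartan (alpha i) (alpha j) = (cartan_B n i j)%:~R).

Definition right_weak_le (R : realFieldType) (d : nat)
    (Delta : {fset 'cV[R]_d}) (u w : 'M[R]_d) : Prop :=
  len Delta w = (len Delta u + len Delta (invmx u *m w))%N.

Definition lower_interval (R : realFieldType) (d : nat)
    (Delta : {fset 'cV[R]_d}) (u : 'M[R]_d) : set 'M[R]_d :=
  [set x | refl_group Delta x /\ right_weak_le Delta x u].

Definition gen_quotient (R : realFieldType) (d : nat)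
    (Delta : {fset 'cV[R]_d}) (U : set 'M[R]_d) : set 'M[R]_d :=
  [set w | refl_group Delta w /\
    forall u, U u -> len Delta (w *m u) = (len Delta w + len Delta u)%N].

Definition splitting (R : realFieldType) (d : nat)
    (Delta : {fset 'cV[R]_d}) (X Y : set 'M[R]_d) : Prop :=
  [/\ (X `<=` refl_group Delta)%classic,
      (Y `<=` refl_group Delta)%classic,
      set_bij (X `*` Y)%classic (refl_group Delta) (fun p => p.1 *m p.2) &
      forall x y, X x -> Y y ->
        len Delta (x *m y) = (len Delta x + len Delta y)%N].

(* Main.v *)
(* Let A be the inversion set of u and B the set of the other positive roots.
   Passing to chambers of vectors p and q, (W/U, U) is a splitting iff the cone
   of the pairs (p, q) with p positive on B and q positive on A is a fundamental
   domain for the diagonal action of W: its translates cover everything and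
   their interiors do not meet.  This property is invariant under exchanging A
   and B and under u -> u^-1, and it passes to every standard parabolic
   subsystem: far along the vectors orthogonal to the subsystem all other
   positive roots are positive.  Conversely it lifts from the components of a
   reducible system, and from the subsystem of J if A or B lies in the span of
   J, i.e. if u has a pivot.  Hence separable elements give splittings, and for
   the converse it is enough to show that, in an irreducible parabolic subsystem
   of type A or B, translates overlap as soon as u has no pivot.

   Put y_k = <rho, eps_k> and x_k = <u^-1 rho, eps_k>.  Without pivot, the
   sequence x contains one of the patterns 3142 and 2413 (type A), or two
   entries of opposite signs whose absolute values increase (type B).  A
   coordinate that is extreme for y or for x can be dropped, so one may take a
   minimal set of coordinates with such a configuration.  It is then almost
   unique, and an explicit signed permutation g (a 4-cycle in type A, a cycle
   with one sign change in type B) makes the translates by 1 and g overlap. *)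

Require Import Defs.
From mathcomp Require Import fingroup perm ring lra zify.
From mathcomp Require Import all_boot all_order all_algebra finmap.
From mathcomp Require Import boolp classical_sets functions.

Set Implicit Arguments.
Unset Strict Implicit.
Unset Printing Implicit Defensive.

Import Order.TTheory GRing.Theory Num.Theory.
Local Open Scope fset_scope.
Local Open Scope ring_scope.

(** * Reflections and root systems *)

(** The dictionary behind the cone: with [A] the inversion set of the inverse of u, an element y
    lies in U iff [y *m rho] is positive off [A], and x lies in W/U iff [x^T *m rho] is positive on
    [A]. Factorizations x y thus correspond to pairs (p, q) = (y rho, x^-1 rho) in the cone, and the
    diagonal action of g turns (x, y) into (x g^-1, g y), so that its orbits are the fibres of
    multiplication. Injectivity is disjointness of interiors, surjectivity is covering, and
    additivity of lengths is built into W/U. An obstacle shapes the second half: dropping a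
    coordinate that is extreme for x can leave a set of non-consecutive coordinates, which is no
    standard parabolic subsystem. Conflicts are therefore stated for arbitrary real vectors x and y
    on a finite index set, where the two play symmetric roles and u has disappeared. Both explicit
    witnesses have p = y and g q = y, which are positive on every positive root; only g p and q have
    to be compared with x. *)

Section Dot.
Variables (R : realFieldType) (d : nat).
Implicit Types (a b v : 'cV[R]_d) (g w : 'M[R]_d) (A B : {fset 'cV[R]_d}).

Lemma dotE a b : dot a b = \sum_i a i 0 * b i 0.
Proof. by rewrite /dot mxE; apply: eq_bigr => i _; rewrite mxE. Qed.

Lemma dotC a b : dot a b = dot b a.
Proof. by rewrite !dotE; apply: eq_bigr => i _; rewrite mulrC. Qed.

Lemma dotDr a b v : dot a (b + v) = dot a b + dot a v.
Proof. by rewrite /dot mulmxDr mxE. Qed.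

Lemma dotZr k a b : dot a (k *: b) = k * dot a b.
Proof. by rewrite /dot -scalemxAr mxE. Qed.

Lemma dotNr a b : dot a (- b) = - dot a b.
Proof. by rewrite -scaleN1r dotZr mulN1r. Qed.

Lemma dotBr a b v : dot a (b - v) = dot a b - dot a v.
Proof. by rewrite dotDr dotNr. Qed.

Lemma dotDl a b v : dot (a + b) v = dot a v + dot b v.
Proof. by rewrite dotC dotDr ![dot v _]dotC. Qed.

Lemma dotZl k a b : dot (k *: a) b = k * dot a b.
Proof. by rewrite dotC dotZr dotC. Qed.

Lemma dotNl a b : dot (- a) b = - dot a b.
Proof. by rewrite dotC dotNr dotC. Qed.

Lemma dot0r a : dot a 0 = 0.
Proof. by rewrite -(scale0r 0) dotZr mul0r. Qed.

Lemma dot_sumr (I : Type) (r : seq I) (Q : pred I) (F : I -> 'cV[R]_d) a :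
  dot a (\sum_(i <- r | Q i) F i) = \sum_(i <- r | Q i) dot a (F i).
Proof. exact: (big_morph (dot a) (dotDr a) (dot0r a)). Qed.

Lemma dotMnr a b n : dot a (b *+ n) = dot a b *+ n.
Proof. by rewrite -scaler_nat dotZr mulr_natl. Qed.

Lemma dot_gt0 a : a != 0 -> 0 < dot a a.
Proof.
move=> a0; have sq i : 0 <= a i 0 * a i 0 by rewrite -expr2 sqr_ge0.
rewrite lt_neqAle dotE sumr_ge0 // andbT eq_sym; apply: contra a0 => /eqP E.
apply/eqP/matrixP => i j; rewrite ord1 mxE; apply/eqP.
rewrite -sqrf_eq0 expr2; apply/eqP.
by move/psumr_eq0P: E => -> //.
Qed.

Lemma dot_eq0 a : dot a a = 0 -> a = 0.
Proof.
by move=> aa; apply/eqP; apply: contraPT aa => /dot_gt0; rewrite lt0r => /andP[/eqP].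
Qed.

Lemma dot_mulmxl g a b : dot (g *m a) b = dot a (g^T *m b).
Proof. by rewrite /dot trmx_mul mulmxA. Qed.

Lemma reflE a b : refl a *m b = b - cartan b a *: a.
Proof.
rewrite /refl /cartan mulmxBl mul1mx -scalemxAl -mulmxA.
have -> : a^T *m b = (dot a b)%:M by rewrite [LHS]mx11_scalar.
by rewrite mul_mx_scalar scalerA dotC -mulrAC.
Qed.

Lemma cartan_diag a : a != 0 -> cartan a a = 2.
Proof. by move=> /dot_gt0 aa; rewrite /cartan mulfK // gt_eqF. Qed.

Lemma refl_self a : a != 0 -> refl a *m a = - a.
Proof.
move=> a0; rewrite reflE cartan_diag // scaler_nat mulr2n opprD addrA subrr.
by rewrite sub0r.
Qed.

Lemma refl_tr a : (refl a)^T = refl a.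
Proof. by rewrite /refl linearB /= linearZ /= trmx_mul trmxK trmx1. Qed.

Lemma mulmx_cV_inj g w : (forall b : 'cV[R]_d, g *m b = w *m b) -> g = w.
Proof.
move=> H; apply/matrixP=> i j; have := H (delta_mx j 0); rewrite -!colE.
by move/matrixP/(_ i 0); rewrite !mxE.
Qed.

Lemma refl_invol a : a != 0 -> refl a *m refl a = 1%:M.
Proof.
move=> a0; apply: mulmx_cV_inj => b; rewrite -mulmxA mul1mx reflE reflE.
have -> : cartan (b - cartan b a *: a) a = - cartan b a.
  rewrite /cartan dotDl dotNl dotZl /cartan; field.
  by rewrite gt_eqF // dot_gt0.
by rewrite scaleNr opprK subrK.
Qed.

Lemma refl_opp a : refl (- a) = refl a.
Proof. by rewrite /refl dotNl dotNr opprK linearN /= mulmxN mulNmx opprK. Qed.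

Lemma refl_conj g a : g^T *m g = 1%:M -> refl (g *m a) = g *m refl a *m g^T.
Proof.
move=> gg; rewrite /refl mulmxBr mulmxBl mulmx1 (mulmx1C gg) trmx_mul.
rewrite -scalemxAr -scalemxAl !mulmxA dot_mulmxl mulmxA gg mul1mx.
by [].
Qed.

Lemma refl_fix a v : dot v a = 0 -> refl a *m v = v.
Proof. by move=> va; rewrite reflE /cartan va mulr0 mul0r scale0r subr0. Qed.

Lemma refl_prod_cat s t : refl_prod (s ++ t) = refl_prod s *m refl_prod t :> 'M[R]_d.
Proof.
rewrite /refl_prod; elim: s => [|a s IH] /=; first by rewrite big_nil mul1mx.
by rewrite !big_cons IH mulmxA.
Qed.

Lemma refl_prod_cons a s : refl_prod (a :: s) = refl a *m refl_prod s :> 'M[R]_d.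
Proof. by rewrite /refl_prod big_cons. Qed.

Lemma refl_prod1 a : refl_prod [:: a] = refl a :> 'M[R]_d.
Proof. by rewrite refl_prod_cons /refl_prod big_nil mulmx1. Qed.

Lemma refl_prod_tr s : (refl_prod s)^T = refl_prod (rev s) :> 'M[R]_d.
Proof.
elim: s => [|a s IH]; first by rewrite /refl_prod big_nil trmx1.
by rewrite rev_cons -cats1 refl_prod_cat refl_prod1 refl_prod_cons trmx_mul IH refl_tr.
Qed.

Lemma refl_group1 A : refl_group A (1%:M : 'M[R]_d).
Proof. by exists [::] => //; rewrite /refl_prod big_nil. Qed.

Lemma refl_groupM A g w : refl_group A g -> refl_group A w -> refl_group A (g *m w).
Proof.
move=> [s sA ->] [t tA ->]; exists (s ++ t); last by rewrite refl_prod_cat.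
by move=> a; rewrite mem_cat => /orP[/sA|/tA].
Qed.

Lemma refl_group_refl A a : a \in A -> refl_group A (refl a).
Proof.
by move=> aA; exists [:: a]; rewrite ?refl_prod1 // => b; rewrite inE => /eqP->.
Qed.

Lemma refl_group_tr A w : refl_group A w -> refl_group A w^T.
Proof.
move=> [s sA ->]; exists (rev s); last by rewrite refl_prod_tr.
by move=> a; rewrite mem_rev => /sA.
Qed.

Lemma refl_group_ind A (Q : 'M[R]_d -> Prop) : Q 1%:M ->
  (forall a w, a \in A -> refl_group A w -> Q w -> Q (refl a *m w)) ->
  forall w, refl_group A w -> Q w.
Proof.
move=> Q1 QM w [s sA ->]; elim: s sA => [|a s IH] sA.
  by rewrite /refl_prod big_nil.
have s'A : {subset s <= A} by move=> b bs; apply: sA; rewrite inE bs orbT.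
rewrite refl_prod_cons; apply: QM; first by rewrite sA ?mem_head.
  by exists s.
exact: IH.
Qed.

Lemma refl_group_sub A B w : (forall a, a \in A -> refl_group B (refl a)) ->
  refl_group A w -> refl_group B w.
Proof.
move=> AB; move: w; apply: refl_group_ind; first exact: refl_group1.
by move=> a w aA _; apply: refl_groupM; apply: AB.
Qed.

Lemma refl_group_fix A w v : (forall a, a \in A -> dot v a = 0) ->
  refl_group A w -> w *m v = v.
Proof.
move=> vA; move: w; apply: refl_group_ind; first by rewrite mul1mx.
by move=> a w aA _ wv; rewrite -mulmxA wv refl_fix // vA.
Qed.

Lemma refl_group_orth A w : 0 \notin A -> refl_group A w -> w^T *m w = 1%:M.
Proof.
move=> A0; move: w; apply: refl_group_ind; first by rewrite trmx1 mulmx1.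
move=> a w aA _ ww; rewrite trmx_mul refl_tr -mulmxA [X in _ *m X]mulmxA.
by rewrite refl_invol ?mul1mx //; apply: contraNneq A0 => <-.
Qed.

Lemma dot_orth g a b : g^T *m g = 1%:M -> dot (g *m a) (g *m b) = dot a b.
Proof. by move=> gg; rewrite dot_mulmxl mulmxA gg mul1mx. Qed.

Lemma invmx_orth g : g^T *m g = 1%:M -> invmx g = g^T.
Proof.
move=> gg; have gU : g \in unitmx by case/mulmx1_unit: gg.
by rewrite -[LHS]mul1mx -gg mulmxK.
Qed.

End Dot.

Section RootSystem.
Variables (R : realFieldType) (d : nat) (Phi Delta : {fset 'cV[R]_d}).
Hypotheses (rs : root_system Phi) (ss : simple_system Phi Delta).
Implicit Types (a b v p q : 'cV[R]_d) (g w u : 'M[R]_d).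
Local Notation P := (pos_roots Phi Delta).
Local Notation W := (refl_group Delta).

Lemma root_neq0 b : b \in Phi -> b != 0.
Proof. by case: rs => Phi0 _ _ _; apply: contraTneq => ->. Qed.

Lemma root_refl a b : a \in Phi -> b \in Phi -> refl a *m b \in Phi.
Proof. by case: rs => _ + _ _; apply. Qed.

Lemma root_opp b : b \in Phi -> - b \in Phi.
Proof. by move=> bP; rewrite -refl_self ?root_neq0 // root_refl. Qed.

Lemma root_oppE b : (- b \in Phi) = (b \in Phi).
Proof. by apply/idP/idP => /root_opp; rewrite ?opprK. Qed.

Lemma simple_root a : a \in Delta -> a \in Phi.
Proof. by case: ss => /fsubsetP + _ _; apply. Qed.

Lemma simple_neq0 : 0 \notin Delta.
Proof. by apply/negP=> /simple_root /root_neq0; rewrite eqxx. Qed.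

Lemma weyl_orth w : W w -> w^T *m w = 1%:M.
Proof. exact/refl_group_orth/simple_neq0. Qed.

Lemma weyl_orthV w : W w -> w *m w^T = 1%:M.
Proof. by move/weyl_orth/mulmx1C. Qed.

Lemma weyl_root w b : W w -> b \in Phi -> w *m b \in Phi.
Proof.
move=> Ww bP; move: w Ww; apply: refl_group_ind; first by rewrite mul1mx.
by move=> a w aD _ wb; rewrite -mulmxA root_refl // simple_root.
Qed.

Lemma weyl_refl w a : W w -> refl (w *m a) = w *m refl a *m w^T.
Proof. by move/weyl_orth/refl_conj. Qed.

(** Since [Delta] is free, the [coord] functions give a linear form [phi] on the whole space with
    the prescribed values; the vector collects the values of [phi] on the standard basis. This
    provides [rho] and the fundamental coweights even if the roots do not span the space. *)
Lemma dual_vector (f : 'cV[R]_d -> R) :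
  exists v, forall a, a \in Delta -> dot v a = f a.
Proof.
case: ss => _ fD _; pose X := in_tuple (enum_fset Delta).
pose phi b := \sum_i coord X i b * f X`_i.
have phiD a b : phi (a + b) = phi a + phi b.
  by rewrite -big_split; apply: eq_bigr => i _; rewrite linearD mulrDl.
have phi0 : phi 0 = 0 by apply: big1 => i _; rewrite linear0 mul0r.
have phiZ k b : phi (k *: b) = k * phi b.
  by rewrite mulr_sumr; apply: eq_bigr => i _; rewrite linearZ /= mulrA.
exists (\col_k phi (delta_mx k 0)) => a aD; rewrite dotE.
transitivity (phi a).
  rewrite [a in RHS]matrix_sum_delta (big_morph phi phiD phi0).
  apply: eq_bigr => i _; rewrite big_ord_recl big_ord0 addr0 phiZ mxE mulrC.
  by congr (_ * _); congr phi; congr delta_mx; apply: ord1.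
have [j <-] : exists j : 'I_(size (enum_fset Delta)), X`_j = a.
  have ai : (index a X < size X)%N by rewrite index_mem.
  by exists (Ordinal ai); rewrite /= nth_index.
have cE i : coord X i X`_j = (i == j)%:R by rewrite eq_sym; apply: coord_free.
rewrite /phi (bigD1 j) //= cE eqxx mul1r.
by rewrite big1 ?addr0 => // i ne; rewrite cE (negPf ne) mul0r.
Qed.

Lemma pos_rootP b : reflect (b \in Phi /\ nonneg_comb Delta b) (b \in P).
Proof.
rewrite /pos_roots !inE /=; apply: (iffP andP) => -[bP /asboolP nb]; split=> //.
Qed.

Lemma pos_root b : b \in P -> b \in Phi.
Proof. by case/pos_rootP. Qed.

Lemma dot_comb v (c : 'cV[R]_d -> nat) :
  dot v (\sum_(a <- Delta) a *+ c a) = \sum_(a <- Delta) dot v a *+ c a.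
Proof. by rewrite dot_sumr; apply: eq_bigr => a _; rewrite dotMnr. Qed.

Lemma pos_dot_ge0 v b :
  (forall a, a \in Delta -> 0 <= dot v a) -> nonneg_comb Delta b -> 0 <= dot v b.
Proof.
move=> va [c ->]; rewrite dot_comb big_seq sumr_ge0 // => a aD.
by rewrite mulrn_wge0 // va.
Qed.

Lemma pos_or_neg b : b \in Phi -> b \in P \/ - b \in P.
Proof.
move=> bP; case: ss => _ _ /(_ b bP) [] nb; [left|right].
  exact/pos_rootP.
by apply/pos_rootP; rewrite root_oppE.
Qed.

Lemma pos_dot_gt0 v b :
  (forall a, a \in Delta -> 0 < dot v a) -> b \in P -> 0 < dot v b.
Proof.
move=> va /pos_rootP[bP [c bE]]; have b0 := root_neq0 bP.
have ge0 a : a \in Delta -> 0 <= dot v a *+ c a by move=> aD; rewrite mulrn_wge0 // ltW ?va.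
rewrite bE dot_comb big_seq lt_neqAle eq_sym sumr_ge0 // andbT.
apply: contra b0; rewrite psumr_eq0 // => /allP H; rewrite bE big_seq big1 // => a aD.
have := H a aD; rewrite aD /= -mulr_natl mulf_eq0 (gt_eqF (va a aD)) orbF.
by rewrite pnatr_eq0 => /eqP ->.
Qed.

(** A stand-in for the half sum of the positive coroots: its inner product with a root is the
    height, so its sign decides positivity. *)
Lemma exists_rho : exists rho, forall a, a \in Delta -> dot rho a = 1.
Proof. exact: (dual_vector (fun=> 1)). Qed.

Lemma pos_rootE v b : (forall a, a \in Delta -> 0 < dot v a) -> b \in Phi ->
  (b \in P) = (0 < dot v b).
Proof.
move=> va bP; apply/idP/idP; first exact: pos_dot_gt0.
by case: (pos_or_neg bP) => // /(pos_dot_gt0 va); rewrite dotNr => *; lra.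
Qed.

Lemma neg_rootE b : b \in Phi -> (- b \in P) = (b \notin P).
Proof.
move=> bP; have [rho r1] := exists_rho.
have r0 a : a \in Delta -> 0 < dot rho a by move/r1->.
rewrite !(pos_rootE r0) ?root_oppE // dotNr oppr_gt0 -leNgt le_eqVlt.
case: eqVneq => //= E; have [/(pos_dot_gt0 r0)|/(pos_dot_gt0 r0)] := pos_or_neg bP.
  by rewrite E ltxx.
by rewrite dotNr E oppr0 ltxx.
Qed.

Lemma simple_pos a : a \in Delta -> a \in P.
Proof.
have [rho r1] := exists_rho; have r0 b : b \in Delta -> 0 < dot rho b by move/r1->.
by move=> aD; rewrite (pos_rootE r0) ?r0 ?simple_root.
Qed.

Lemma simple_dual a : a \in Delta -> exists v, dot v a = 1 /\
  forall b, b \in Delta -> b != a -> dot v b = 0.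
Proof.
move=> aD; have [v va] := dual_vector (fun b => (b == a)%:R).
by exists v; split=> [|b bD ba]; rewrite va // ?eqxx // (negPf ba).
Qed.

(** [refl a] changes only the coefficient of [a]. The system being reduced, a positive root other
    than [a] involves a further simple root [a'], whose positive coefficient survives. *)
Lemma refl_simple_pos a b : a \in Delta -> b \in P -> b != a -> refl a *m b \in P.
Proof.
move=> aD /[dup] bpos /pos_rootP[bP [c bE]] ba.
have sbP : refl a *m b \in Phi := root_refl (simple_root aD) bP.
have [//|] := pos_or_neg sbP => nsb.
suff [a' [a'D a'a ca']] : exists a', [/\ a' \in Delta, a' != a & c a' != 0%N].
  have [v [va' v0]] := simple_dual a'D.
  have v_ge0 x : x \in Delta -> 0 <= dot v x.
    by move=> xD; have [->|xa] := eqVneq x a'; rewrite ?va' ?v0 // ler01.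
  have /pos_rootP[_ /(pos_dot_ge0 v_ge0)] := nsb.
  rewrite dotNr reflE dotBr dotZr (v0 a) 1?eq_sym // mulr0 subr0.
  rewrite oppr_ge0 bE dot_comb (bigD1_seq a') //= ?fset_uniq //.
  rewrite va' big_seq_cond big1 ?addr0 => [|x /andP[xD xa']].
    by rewrite lern0 (negPf ca').
  by rewrite v0 // mul0rn.
apply/not_existsP => H; case/negP: ba; have [_ _ _ red] := rs.
have bca : b = (c a)%:R *: a.
  rewrite bE (bigD1_seq a) //= ?fset_uniq // big_seq_cond big1 ?addr0.
    by rewrite scaler_nat.
  move=> x /andP[xD xa]; have [->//|cx] := eqVneq (c x) 0%N.
  by case: (H x).
have aPhi := simple_root aD.
case: (red a (c a)%:R) => //; rewrite -?bca // => E.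
  by rewrite bca E scale1r.
have : 0 <= (c a)%:R :> R by [].
by rewrite E; lra.
Qed.

(** Induction on the height. A positive root [b] has positive inner product with some simple root
    [a], since otherwise [dot b b] would not be positive, and reflecting in [a] lowers the
    height. *)
Lemma pos_ind (Q : 'cV[R]_d -> Prop) :
  (forall a, a \in Delta -> Q a) ->
  (forall a b, a \in Delta -> b \in P -> refl a *m b \in P -> Q (refl a *m b) -> Q b) ->
  forall b, b \in P -> Q b.
Proof.
move=> QD QS b; have [rho r1] := exists_rho.
pose ht (c : 'cV[R]_d -> nat) := (\sum_(a <- Delta) c a)%N.
have htE c : dot rho (\sum_(a <- Delta) a *+ c a) = (ht c)%:R.
  rewrite dot_comb natr_sum big_seq [RHS]big_seq; apply: eq_bigr => a aD.
  by rewrite r1.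
suff H n b' : b' \in P -> dot rho b' < n%:R -> Q b'.
  move=> bP; have /pos_rootP[_ [c bE]] := bP.
  by apply: (H (ht c).+1) => //; rewrite bE htE ltr_nat.
elim: n b' => [|n IH] {}b bP bn.
  have r0 a : a \in Delta -> 0 < dot rho a by move/r1->.
  by have := pos_dot_gt0 r0 bP; lra.
have [bD|bD] := boolP (b \in Delta); first exact: QD.
have /pos_rootP[bPhi [c bE]] := bP.
have [a [aD ab]] : exists a, a \in Delta /\ 0 < dot b a.
  apply/not_existsP => H; have := dot_gt0 (root_neq0 bPhi).
  rewrite {2}bE dot_comb big_seq ltNge sumr_le0 // => a aD.
  by rewrite mulrn_wle0 // leNgt; apply/negP => ab; apply: (H a).
have ba : b != a by apply: contraNneq bD => ->.
have sP := refl_simple_pos aD bP ba.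
apply: (QS a b) => //; apply: IH => //.
have aa := dot_gt0 (root_neq0 (simple_root aD)).
have [_ _ int _] := rs; have [k kE] := int a b (simple_root aD) bPhi.
(* Integrality of the Cartan number makes the height drop by at least 1, so that the natural number
   [n] can bound the induction. *)
have k1 : 1 <= cartan b a.
  have : 0 < cartan b a by rewrite /cartan divr_gt0 // mulr_gt0.
  by rewrite kE ltr0z ler1z; lia.
rewrite reflE dotBr dotZr (r1 a aD) mulr1; move: bn; rewrite -natr1.
by lra.
Qed.

Lemma root_refl_weyl b : b \in Phi -> W (refl b).
Proof.
have H b' : b' \in P -> W (refl b').
  move: b'; apply: pos_ind => [a aD|a b' aD bP sP]; first exact: refl_group_refl.
  have Wa := refl_group_refl aD; rewrite (weyl_refl _ Wa) refl_tr => Wb.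
  have -> : refl b' = refl a *m (refl a *m refl b' *m refl a) *m refl a.
    rewrite !mulmxA -[_ *m refl a *m refl a]mulmxA.
    by rewrite !refl_invol ?mul1mx ?mulmx1 // root_neq0 // simple_root.
  by do ![apply: refl_groupM => //].
by move=> /pos_or_neg[/H//|/H]; rewrite refl_opp.
Qed.

(** Every root is in the orbit of a simple root. Negative roots need an induction of their own,
    started from [- a] as the image of [a] under its reflection. *)
Lemma root_invariant_ind (Q : 'cV[R]_d -> Prop) :
  (forall a, a \in Delta -> Q a) ->
  (forall a b, a \in Delta -> b \in Phi -> Q b -> Q (refl a *m b)) ->
  forall b, b \in Phi -> Q b.
Proof.
move=> QD QS; have H b : b \in P -> Q b.
  move: b; apply: pos_ind => // a b aD bP sP Qs.
  have -> : b = refl a *m (refl a *m b).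
    by rewrite mulmxA refl_invol ?mul1mx ?root_neq0 // simple_root.
  by apply: QS => //; apply: pos_root.
have H' b : b \in P -> Q (- b).
  move: b; apply: pos_ind => [a aD|a b aD bP sP Qs].
    rewrite -refl_self ?root_neq0 ?simple_root //; apply: QS => //.
      exact: simple_root.
    exact: QD.
  have -> : - b = refl a *m (- (refl a *m b)).
    by rewrite mulmxN mulmxA refl_invol ?mul1mx ?root_neq0 // simple_root.
  by apply: QS => //; rewrite root_oppE pos_root.
by move=> b /pos_or_neg[/H//|/H']; rewrite opprK.
Qed.

End RootSystem.

(** * Length and inversions *)

Lemma eq_card_fset_bij (T : choiceType) (A B : {fset T}) (f g : T -> T) :
  (forall x, x \in A -> f x \in B) -> (forall y, y \in B -> g y \in A) ->
  cancel f g -> cancel g f -> #|` A| = #|` B|.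
Proof.
move=> fAB gBA fg gf.
have -> : #|` A| = #|` [fset f x | x in A]| by rewrite card_imfset //; apply: can_inj fg.
congr #|` _|; apply/fsetP => y; apply/imfsetP/idP => /= [[x xA ->]|yB].
  exact: fAB.
by exists (g y); rewrite ?gf //; apply: gBA.
Qed.

Lemma inversionsE (R : realFieldType) (d : nat) (A : {fset 'cV[R]_d})
  (w : 'M[R]_d) b : (b \in inversions A w) = (b \in A) && (- (w *m b) \in A).
Proof. by rewrite !inE. Qed.

Section Length.
Variables (R : realFieldType) (d : nat) (Phi Delta : {fset 'cV[R]_d}).
Hypotheses (rs : root_system Phi) (ss : simple_system Phi Delta).
Implicit Types (a b v p q : 'cV[R]_d) (g w u : 'M[R]_d).
Local Notation P := (pos_roots Phi Delta).
Local Notation W := (refl_group Delta).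

Lemma inversionsNE w b : W w -> b \in P -> (b \in inversions P w) = (w *m b \notin P).
Proof.
move=> Ww bP; rewrite inversionsE bP /= (neg_rootE rs ss) //.
exact: (weyl_root rs ss Ww (pos_root bP)).
Qed.

Lemma weylK w : W w -> cancel (mulmx w : 'cV_d -> 'cV_d) (mulmx w^T).
Proof. by move=> Ww b; rewrite mulmxA (weyl_orth rs ss Ww) mul1mx. Qed.

Lemma weylKV w : W w -> cancel (mulmx w^T : 'cV_d -> 'cV_d) (mulmx w).
Proof. by move=> Ww b; rewrite mulmxA (weyl_orthV rs ss Ww) mul1mx. Qed.

Lemma card_inversions_tr w : W w -> #|` inversions P w^T| = #|` inversions P w|.
Proof.
move=> Ww; apply: (@eq_card_fset_bij _ _ _ (fun b => - (w^T *m b)) (fun b => - (w *m b))).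
- by move=> b; rewrite !inversionsE mulmxN weylKV // opprK => /andP[-> ->].
- by move=> b; rewrite !inversionsE mulmxN weylK // opprK => /andP[-> ->].
- by move=> b; rewrite mulmxN weylKV // opprK.
- by move=> b; rewrite mulmxN weylK // opprK.
Qed.

(* Split the positive roots b with x y b < 0 by the sign of y b. *)
Lemma card_inversionsM x y : W x -> W y ->
  (#|` inversions P (x *m y)| + (#|` inversions P x `&` inversions P y^T|).*2 =
   #|` inversions P x| + #|` inversions P y|)%N.
Proof.
move=> Wx Wy; have yK := weylK Wy; have yKV := weylKV Wy.
pose D := [fset b in inversions P (x *m y) | y *m b \in P].
have DE b : (b \in D) = (b \in inversions P (x *m y)) && (y *m b \in P).
  by rewrite !inE.
have subD : #|` inversions P (x *m y)| =
    (#|` D| + #|` inversions P (x *m y) `\` D|)%N.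
  rewrite -(cardfsID D); congr (#|` _| + _)%N.
  by apply/fsetIidPr/fsubsetP => b; rewrite DE => /andP[].
have D1 : #|` D| = #|` inversions P x `\` inversions P y^T|.
  apply: (@eq_card_fset_bij _ _ _ (mulmx y) (mulmx y^T)) => // b.
    rewrite DE => /andP[]; rewrite inversionsE => /andP[bP].
    rewrite -mulmxA in_fsetD !inversionsE => -> ybP; rewrite ybP /= yK.
    by rewrite andbT (neg_rootE rs ss) ?negbK // (pos_root bP).
  rewrite in_fsetD !inversionsE => /andP[+ /andP[bP xb]]; rewrite bP /= => yb.
  rewrite DE inversionsE -mulmxA yKV bP xb !andbT.
  move: yb; rewrite (neg_rootE rs ss) ?negbK //.
  by apply: (weyl_root rs ss); [exact: refl_group_tr|exact: (pos_root bP)].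
have D2 : #|` inversions P (x *m y) `\` D| = #|` inversions P y^T `\` inversions P x|.
  apply: (@eq_card_fset_bij _ _ _ (fun b => - (y *m b)) (fun b => - (y^T *m b))).
  - move=> b; rewrite in_fsetD DE => /andP[+ bI]; rewrite bI /=.
    move: bI; rewrite inversionsE => /andP[bP]; rewrite -mulmxA.
    have ybPhi : y *m b \in Phi by apply: (weyl_root rs ss Wy (pos_root bP)).
    rewrite -(neg_rootE rs ss) // => xyb nyb.
    rewrite in_fsetD !inversionsE nyb /= !mulmxN yK !opprK bP andbT.
    rewrite -(neg_rootE rs ss) ?(weyl_root rs ss Wx) //.
  - move=> b; rewrite in_fsetD !inversionsE => /andP[+ /andP[bP yb]].
    rewrite bP /= => xb; have bPhi := pos_root bP.
    rewrite in_fsetD DE !inversionsE yb /= !mulmxN -!mulmxA !yKV !opprK.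
    have xbPhi : x *m b \in Phi by apply: (weyl_root rs ss Wx).
    by move: xb; rewrite !(neg_rootE rs ss) // negbK bP => ->.
  - by move=> b; rewrite mulmxN yK opprK.
  - by move=> b; rewrite mulmxN yKV opprK.
rewrite subD D1 D2 -(card_inversions_tr Wy).
rewrite -(cardfsID (inversions P y^T) (inversions P x)).
rewrite -(cardfsID (inversions P x) (inversions P y^T)).
by rewrite [inversions P y^T `&` _]fsetIC; lia.
Qed.

Lemma inversions1 : inversions P 1%:M = fset0.
Proof.
apply/fsetP=> b; rewrite inversionsE mul1mx in_fset0; apply/negP=> /andP[bP].
by rewrite (neg_rootE rs ss) ?bP // (pos_root bP).
Qed.

Lemma inversions_simple a : a \in Delta -> inversions P (refl a) = [fset a].
Proof.
move=> aD; have a0 : a != 0 by apply/(root_neq0 rs)/(simple_root ss).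
apply/fsetP=> b; rewrite in_fset1; apply/idP/eqP => [|->].
  have [//|ba] := eqVneq b a; rewrite inversionsE => /andP[bP].
  have sb := refl_simple_pos rs ss aD bP ba.
  by rewrite (neg_rootE rs ss) ?sb // (pos_root sb).
by rewrite inversionsE refl_self // opprK (simple_pos rs ss).
Qed.

Lemma card_inversions_word s : {subset s <= Delta} ->
  (#|` inversions P (refl_prod s)| <= size s)%N.
Proof.
elim: s => [|a s IH] sD; first by rewrite /refl_prod big_nil inversions1 cardfs0.
have aD : a \in Delta by rewrite sD ?mem_head.
have s'D : {subset s <= Delta} by move=> b bs; apply: sD; rewrite inE bs orbT.
have Ws : W (refl_prod s) by exists s.
rewrite refl_prod_cons.
apply: leq_trans (leq_addr #|` inversions P (refl a) `&` inversions P (refl_prod s)^T|.*2 _) _.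
rewrite card_inversionsM ?inversions_simple ?cardfs1 ?add1n ?ltnS ?IH //.
exact: refl_group_refl.
Qed.

(** Follow [a] through the word from the right. The letter [b] at which it becomes negative must
    equal the root reached so far, by [refl_simple_pos]; then [refl b] is a conjugate of [refl a]
    and both cancel. *)
Lemma exchange t a : {subset t <= Delta} -> a \in Delta ->
  - (refl_prod t *m a) \in P ->
  exists t', [/\ {subset t' <= Delta}, size t = (size t').+1 &
    refl_prod t *m refl a = refl_prod t'].
Proof.
move=> tD aD; elim: t tD => [|b t IH] tD.
  rewrite /refl_prod big_nil mul1mx (neg_rootE rs ss) ?(simple_root ss) //.
  by rewrite (simple_pos rs ss).
have bD : b \in Delta by rewrite tD ?mem_head.
have t'D : {subset t <= Delta} by move=> c ct; apply: tD; rewrite inE ct orbT.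
have Wt : W (refl_prod t) by exists t.
have ta : refl_prod t *m a \in Phi by apply: (weyl_root rs ss Wt); apply: (simple_root ss).
rewrite refl_prod_cons -mulmxA => sta.
have [tneg|] := boolP (- (refl_prod t *m a) \in P).
  have [t' [t'D' st tE]] := IH t'D tneg; exists (b :: t'); split.
  - by move=> c; rewrite inE => /orP[/eqP->|/t'D'].
  - by rewrite /= st.
  - by rewrite refl_prod_cons -mulmxA tE.
rewrite (neg_rootE rs ss) // negbK => tpos.
have tab : refl_prod t *m a = b.
  apply/eqP; apply: contraT => ne; have pos := refl_simple_pos rs ss bD tpos ne.
  by move: sta; rewrite (neg_rootE rs ss) ?pos // (pos_root pos).
exists t; split=> //; rewrite -tab (weyl_refl rs ss) // -!mulmxA.
rewrite [_^T *m _]mulmxA (weyl_orth rs ss) // mul1mx refl_invol ?mulmx1 //.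
exact/(root_neq0 rs)/(simple_root ss).
Qed.

(** Append the letters one by one: a letter that is already inverted cancels another letter by
    [exchange], and any other letter adds exactly one inversion. *)
Lemma reduced_word w : W w ->
  exists s, [/\ {subset s <= Delta}, w = refl_prod s & size s = #|` inversions P w|].
Proof.
move=> [s sD ->]; elim/last_ind: s sD => [|s a IH] sD.
  by exists [::]; rewrite /refl_prod big_nil inversions1 cardfs0.
have aD : a \in Delta by rewrite sD // mem_rcons mem_head.
have s'D : {subset s <= Delta} by move=> b bs; apply: sD; rewrite mem_rcons inE bs orbT.
have [t [tD wE st]] := IH s'D; have Ws : W (refl_prod s) by exists s.
rewrite -cats1 refl_prod_cat refl_prod1.
have := card_inversionsM Ws (refl_group_refl aD).
have a0 : a != 0 by apply/(root_neq0 rs)/(simple_root ss).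
rewrite refl_tr inversions_simple // cardfs1.
have wa : refl_prod s *m a \in Phi by apply: (weyl_root rs ss Ws); apply: (simple_root ss).
have apos := simple_pos rs ss aD.
have [neg|pos] := boolP (a \in inversions P (refl_prod s)).
  have -> : inversions P (refl_prod s) `&` [fset a] = [fset a].
    by apply/fsetIidPr; rewrite fsub1set.
  rewrite cardfs1 => E.
  have [|t' [t'D st' tE]] := exchange tD aD.
    by move: neg; rewrite inversionsE wE => /andP[].
  by exists t'; split=> //; [rewrite wE|lia].
have -> : inversions P (refl_prod s) `&` [fset a] = fset0.
  apply/fsetP=> b; rewrite in_fsetI in_fset1 in_fset0; apply/negP=> /andP[+ /eqP E].
  by rewrite E (negPf pos).
rewrite cardfs0 => E; exists (rcons t a); split.
- by move=> b; rewrite mem_rcons inE => /orP[/eqP->|/tD].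
- by rewrite -cats1 refl_prod_cat refl_prod1 wE.
- by rewrite size_rcons; lia.
Qed.

Lemma lenE w : W w -> len Delta w = #|` inversions P w|.
Proof.
move=> Ww; have [s [sD wE sN]] := reduced_word Ww.
have min t : {subset t <= Delta} -> w = refl_prod t -> (#|` inversions P w| <= size t)%N.
  by move=> tD ->; apply: card_inversions_word.
apply: xget_unique => /=; first by split=> //; exists s.
move=> k [[t [tD tE <-]] tmin]; apply/eqP; rewrite eqn_leq -sN tmin //= sN.
exact: min.
Qed.

Lemma inversions_eq0 w : W w -> (forall b, b \in P -> w *m b \in P) -> w = 1%:M.
Proof.
move=> Ww pos; have [s [_ wE sN]] := reduced_word Ww.
rewrite wE; suff -> : s = [::] by rewrite /refl_prod big_nil.
apply/size0nil; rewrite sN; apply/eqP; rewrite cardfs_eq0; apply/eqP/fsetP=> b.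
rewrite in_fset0; have [bP|bP] := boolP (b \in P); last by rewrite inversionsE (negPf bP).
by rewrite inversionsNE // pos.
Qed.

(** By [card_inversionsM] the defect of additivity is twice the number of common inversions of [x]
    and [y^T]. *)
Lemma len_mulP x y : W x -> W y ->
  len Delta (x *m y) = (len Delta x + len Delta y)%N <->
  forall b, b \in P -> - (x *m b) \in P -> y^T *m b \in P.
Proof.
move=> Wx Wy; rewrite !lenE //; last exact: refl_groupM.
have := card_inversionsM Wx Wy => E.
have Wyt := refl_group_tr Wy; split=> [H b bP xb|H].
  have: #|` inversions P x `&` inversions P y^T| == 0%N by apply/eqP; lia.
  rewrite cardfs_eq0 => /eqP/fsetP/(_ b).
  by rewrite in_fsetI inversionsE bP xb in_fset0 /= inversionsNE // => /negbFE.
suff: #|` inversions P x `&` inversions P y^T| = 0%N by lia.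
apply/eqP; rewrite cardfs_eq0; apply/eqP/fsetP=> b; rewrite in_fsetI in_fset0.
rewrite inversionsE; apply/negP=> /andP[/andP[bP xb]].
by rewrite inversionsNE // (H b).
Qed.

(** A simple reflection in a root [a] on which [p] is negative permutes the other positive roots, so
    it lowers the number of positive roots with negative value by exactly one. *)
Lemma dominant_translate p : exists2 v, W v & forall b, b \in P -> 0 <= dot (v *m p) b.
Proof.
pose neg p := [fset b in P | dot p b < 0].
have negE q b : (b \in neg q) = (b \in P) && (dot q b < 0) by rewrite !inE.
have [n] := ubnP #|` neg p|; elim: n => // n IH in p *; rewrite ltnS => pn.
have [[a [aD pa]]|none] := pselect (exists a, a \in Delta /\ dot p a < 0).
  have aneg : a \in neg p by rewrite negE (simple_pos rs ss).
  have a0 : a != 0 by apply/(root_neq0 rs)/(simple_root ss).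
  have reflK : cancel (mulmx (refl a) : 'cV_d -> 'cV_d) (mulmx (refl a)).
    by move=> b; rewrite mulmxA refl_invol // mul1mx.
  have sub : #|` neg (refl a *m p)| = #|` neg p `\ a|.
    apply: (@eq_card_fset_bij _ _ _ (mulmx (refl a)) (mulmx (refl a))) => // b.
      rewrite in_fsetD1 !negE => /andP[bP]; rewrite dot_mulmxl refl_tr => pb; rewrite pb andbT.
      have ba : b != a.
        by apply: contraTneq pb => ->; rewrite refl_self // dotNr; lra.
      rewrite (refl_simple_pos rs ss) // andbT; apply: contraNneq (root_neq0 rs (pos_root bP)) => E.
      move: bP; rewrite -[b]reflK E refl_self // (neg_rootE rs ss) ?(simple_root ss) //.
      by rewrite (simple_pos rs ss).
    rewrite in_fsetD1 !negE => /and3P[ba bP pb]; rewrite dot_mulmxl refl_tr reflK pb andbT.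
    exact: refl_simple_pos.
  have [|v Wv vpos] := IH (refl a *m p).
    by rewrite sub; move: pn; rewrite [X in (X <= _)%N](cardfsD1 a) aneg; lia.
  exists (v *m refl a); first by apply: refl_groupM => //; apply: refl_group_refl.
  by move=> b bP; rewrite -mulmxA vpos.
exists 1%:M; first exact: refl_group1.
move=> b /pos_rootP[_ nb]; rewrite mul1mx; apply: pos_dot_ge0 nb => a aD.
by rewrite leNgt; apply/negP => pa; apply: none; exists a.
Qed.

End Length.

(** * Splittings as fundamental domains *)

(* [chosen A p q b] is the vector that has to be positive on the root b, so   *)
(* [covering] and [packing] speak of the translates of the cone of the pairs  *)
(* (p, q) with p positive off A and q positive on A.                          *)
Definition chosen (R : realFieldType) (d : nat) (A : {fset 'cV[R]_d})
    (p q b : 'cV[R]_d) : 'cV[R]_d := if b \in A then q else p.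

Definition covering (R : realFieldType) (d : nat) (Phi Delta A : {fset 'cV[R]_d}) :=
  forall p q, exists2 g, refl_group Delta g &
    forall b, b \in pos_roots Phi Delta -> 0 <= dot (g *m chosen A p q b) b.

(** Only the translates by 1 and [g] are compared, since any two translates can be moved to such a
    position. Strict inequalities describe the interior of the cone, the weak ones of [covering] the
    closed cone. *)
Definition packing (R : realFieldType) (d : nat) (Phi Delta A : {fset 'cV[R]_d}) :=
  forall g p q, refl_group Delta g ->
    (forall b, b \in pos_roots Phi Delta ->
      0 < dot (chosen A p q b) b /\ 0 < dot (g *m chosen A p q b) b) ->
    g = 1%:M.

Section Splitting.
Variables (R : realFieldType) (d : nat) (Phi Delta : {fset 'cV[R]_d}).
Hypotheses (rs : root_system Phi) (ss : simple_system Phi Delta).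
Implicit Types (a b v p q : 'cV[R]_d) (g w u x y : 'M[R]_d) (A : {fset 'cV[R]_d}).
Local Notation P := (pos_roots Phi Delta).
Local Notation W := (refl_group Delta).

Lemma packing_compl A : packing Phi Delta (P `\` A) -> packing Phi Delta A.
Proof.
move=> H g p q Wg pq; apply: (H g q p Wg) => b bP; have := pq b bP.
by rewrite /chosen in_fsetD bP andbT; case: (b \in A).
Qed.

Lemma covering_compl A : covering Phi Delta (P `\` A) -> covering Phi Delta A.
Proof.
move=> H p q; have [g Wg gP] := H q p; exists g => // b bP.
by have := gP b bP; rewrite /chosen in_fsetD bP andbT; case: (b \in A).
Qed.

Lemma weyl_pos_or_neg w b : W w -> b \in P -> w *m b \in P \/ - (w *m b) \in P.
Proof. by move=> Ww bP; apply: (pos_or_neg rs ss); apply: (weyl_root rs ss Ww (pos_root bP)). Qed.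

Lemma pos_not_neg b : b \in P -> - b \in P -> False.
Proof. by move=> bP; rewrite (neg_rootE rs ss) ?bP // (pos_root bP). Qed.

(** The right weak order is inclusion of the inversion sets of the inverses: this is [len_mulP] for
    the factors [x] and [x^T *m u], with the root transported by [x]. *)
Lemma lower_intervalP u x : W u -> lower_interval Delta u x <->
  W x /\ forall b, b \in P -> - (x^T *m b) \in P -> - (u^T *m b) \in P.
Proof.
move=> Wu; rewrite /lower_interval /= /right_weak_le; split=> -[Wx].
  rewrite (invmx_orth (weyl_orth rs ss Wx)).
  have Wxu : W (x^T *m u) by apply: refl_groupM => //; apply: refl_group_tr.
  have {1}-> : u = x *m (x^T *m u) by rewrite mulmxA (weyl_orthV rs ss) ?mul1mx.
  move/(len_mulP rs ss Wx Wxu) => H; split=> // b bP xb.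
  have := H _ xb; rewrite !mulmxN (weylKV rs ss Wx) opprK => /(_ bP).
  by rewrite trmx_mul trmxK -mulmxA (weylKV rs ss Wx).
move=> H; split=> //; rewrite (invmx_orth (weyl_orth rs ss Wx)).
have Wxu : W (x^T *m u) by apply: refl_groupM => //; apply: refl_group_tr.
have {1}-> : u = x *m (x^T *m u) by rewrite mulmxA (weyl_orthV rs ss) ?mul1mx.
apply/(len_mulP rs ss Wx Wxu) => b bP xb.
have := H _ xb; rewrite !mulmxN (weylK rs ss Wx) !opprK => /(_ bP).
by rewrite trmx_mul trmxK -mulmxA.
Qed.

(** Additivity with [u] alone implies additivity with all of U, because the inverses of elements of
    U have fewer inversions than [u^T], in the sense of inclusion. *)
Lemma gen_quotientP u w : W u ->
  gen_quotient Delta (lower_interval Delta u) w <->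
  W w /\ forall b, b \in P -> - (u^T *m b) \in P -> w *m b \in P.
Proof.
move=> Wu; split=> -[Ww H]; split=> //.
  move=> b bP ub; have [//|wb] := weyl_pos_or_neg Ww bP.
  have Uu : lower_interval Delta u u by apply/lower_intervalP.
  have /(len_mulP rs ss Ww Wu) := H u Uu => /(_ b bP wb) ub'.
  by case: (pos_not_neg ub').
move=> y /(lower_intervalP _ Wu)[Wy yP]; apply/(len_mulP rs ss Ww Wy) => b bP wb.
have [//|yb] := weyl_pos_or_neg (refl_group_tr Wy) bP.
by case: (pos_not_neg (H b bP (yP b bP yb))).
Qed.

Lemma mem_inversions_tr u b : (b \in inversions P u^T) = (b \in P) && (- (u^T *m b) \in P).
Proof. exact: inversionsE. Qed.

(** If [v] makes [p] dominant and [z] makes [q] dominant, then [v^T] is in U and [z] in W/U. Applied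
    to the translated pair, the same argument gives [g *m v^T] and [z *m g^T]. Both pairs have the
    same product, so injectivity forces [g] to be 1. *)
Lemma splitting_packing u : W u ->
  splitting Delta (gen_quotient Delta (lower_interval Delta u)) (lower_interval Delta u) ->
  packing Phi Delta (inversions P u^T).
Proof.
move=> Wu [_ _ [_ inj _] _] g p q Wg pq.
have [v Wv vP] := dominant_translate rs ss p.
have [z Wz zP] := dominant_translate rs ss q.
have pU h r : W h -> (forall b, b \in P -> 0 <= dot (h *m r) b) ->
    (forall b, b \in P -> ~~ (b \in inversions P u^T) -> 0 < dot r b) ->
    lower_interval Delta u h^T.
  move=> Wh hr rP; apply/lower_intervalP => //; split; first exact: refl_group_tr.
  move=> b bP; rewrite trmxK => hb; apply: contraT => ub.
  have := rP b bP; rewrite mem_inversions_tr bP (negPf ub) => /(_ isT).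
  have := hr _ hb; rewrite dotNr dot_mulmxl (weylK rs ss Wh); lra.
have qX h r : W h -> (forall b, b \in P -> 0 <= dot (h *m r) b) ->
    (forall b, b \in P -> b \in inversions P u^T -> 0 < dot r b) ->
    gen_quotient Delta (lower_interval Delta u) h.
  move=> Wh hr rP; apply/gen_quotientP => //; split=> // b bP ub.
  have [//|hb] := weyl_pos_or_neg Wh bP.
  have := rP b bP; rewrite mem_inversions_tr bP ub => /(_ isT).
  have := hr _ hb; rewrite dotNr dot_mulmxl (weylK rs ss Wh); lra.
have Wgt := refl_group_tr Wg.
have gE (r : 'cV[R]_d) : g^T *m (g *m r) = r by rewrite (weylK rs ss Wg).
have U1 : lower_interval Delta u v^T.
  apply: (pU v p) => // b bP bA; have [+ _] := pq b bP.
  by rewrite /chosen (negPf bA).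
have U2 : lower_interval Delta u (v *m g^T)^T.
  apply: (pU _ (g *m p)); first exact: refl_groupM.
    by move=> b bP; rewrite -mulmxA gE vP.
  by move=> b bP bA; have [_] := pq b bP; rewrite /chosen (negPf bA).
have X1 : gen_quotient Delta (lower_interval Delta u) z.
  by apply: (qX z q) => // b bP bA; have [+ _] := pq b bP; rewrite /chosen bA.
have X2 : gen_quotient Delta (lower_interval Delta u) (z *m g^T).
  apply: (qX _ (g *m q)); first exact: refl_groupM.
    by move=> b bP; rewrite -mulmxA gE zP.
  by move=> b bP bA; have [_] := pq b bP; rewrite /chosen bA.
have [] : (z, v^T) = (z *m g^T, (v *m g^T)^T).
  apply: inj; rewrite ?in_setE //= trmx_mul trmxK -!mulmxA [g^T *m _]mulmxA.
  by rewrite (weyl_orth rs ss Wg) mul1mx.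
move=> zg _; have : g^T = 1%:M.
  by rewrite -[LHS]mul1mx -(weyl_orth rs ss Wz) -mulmxA -zg.
by move/(congr1 trmx); rewrite trmxK trmx1.
Qed.

Lemma packing_splitting u : W u -> covering Phi Delta (inversions P u^T) ->
  packing Phi Delta (inversions P u^T) ->
  splitting Delta (gen_quotient Delta (lower_interval Delta u)) (lower_interval Delta u).
Proof.
move=> Wu cov pack; have [rho r1] := exists_rho ss.
have r0 a : a \in Delta -> 0 < dot rho a by move/r1->.
have rhoP b : b \in Phi -> 0 <= dot rho b -> b \in P.
  move=> bPhi rb; have [//|nb] := pos_or_neg rs ss bPhi.
  by have := pos_dot_gt0 rs r0 nb; rewrite dotNr; lra.
split.
- by move=> x [].
- by move=> x [].
- split.
  + by move=> [x y] [[/= Wx _] [Wy _]]; apply: refl_groupM.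
  + move=> [x y] [x' y']; rewrite !in_setE => -[/= X1 Y1] [X2 Y2] /= E.
    have /(gen_quotientP _ Wu)[Wx xP] := X1; have /(gen_quotientP _ Wu)[Wx' xP'] := X2.
    have /(lower_intervalP _ Wu)[Wy yP] := Y1.
    have /(lower_intervalP _ Wu)[Wy' yP'] := Y2.
    (* The element [y' *m y^T] carries the pair of vectors attached to (x, y) to the one attached to
       (x', y'), because the products agree; both pairs are interior to the cone. *)
    have yy : y' *m y^T = 1%:M.
      apply: (pack (y' *m y^T) (y *m rho) (x^T *m rho)).
        by apply: refl_groupM => //; apply: refl_group_tr.
      move=> b bP; rewrite /chosen mem_inversions_tr bP /=.
      have [ub|ub] := boolP (- (u^T *m b) \in P).
        have gE : y' *m y^T *m (x^T *m rho) = x'^T *m rho.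
          rewrite !mulmxA -[y' *m y^T *m x^T]mulmxA -trmx_mul E trmx_mul.
          by rewrite mulmxA (weyl_orthV rs ss Wy') mul1mx.
        rewrite gE !dot_mulmxl !trmxK.
        by split; apply: (pos_dot_gt0 rs r0); [apply: xP|apply: xP'].
      rewrite -mulmxA [y^T *m _]mulmxA (weyl_orth rs ss Wy) mul1mx !dot_mulmxl.
      split; apply: (pos_dot_gt0 rs r0).
        have [//|yb] := weyl_pos_or_neg (refl_group_tr Wy) bP.
        by rewrite (yP b bP yb) in ub.
      have [//|yb] := weyl_pos_or_neg (refl_group_tr Wy') bP.
      by rewrite (yP' b bP yb) in ub.
    have yE : y = y'.
      by rewrite -[LHS]mul1mx -yy -mulmxA (weyl_orth rs ss Wy) mulmx1.
    congr (_, _) => //; rewrite -[x]mulmx1 -(weyl_orthV rs ss Wy) mulmxA E -yE.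
    by rewrite -mulmxA (weyl_orthV rs ss Wy) mulmx1.
  (* The vectors (rho, w^-1 rho) belong to the factorization w = w 1. Moving them into the cone by
     [g] replaces it by w g^-1 times g. *)
  + move=> w /= Ww; have [g Wg gP] := cov rho (w^T *m rho).
    have Wgt := refl_group_tr Wg.
    exists (w *m g^T, g) => /=; last by rewrite -mulmxA (weyl_orth rs ss Wg) mulmx1.
    split=> /=.
      apply/gen_quotientP => //; split; first exact: refl_groupM.
      move=> b bP ub; apply: rhoP.
        by apply: (weyl_root rs ss) (pos_root bP); apply: refl_groupM.
      have := gP b bP; rewrite /chosen mem_inversions_tr bP ub /= mulmxA dot_mulmxl.
      by rewrite trmx_mul trmxK.
    apply/lower_intervalP => //; split=> // b bP gb; apply: contraT => ub.
    have := gP b bP; rewrite /chosen mem_inversions_tr bP (negPf ub) /= dot_mulmxl.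
    by have := pos_dot_gt0 rs r0 gb; rewrite dotNr; lra.
- by move=> x y [_ xP] yU; apply: xP.
Qed.

(** Substitute [u^T *m p] for [p], [- (u^T *m q)] for [q] and a conjugate for [g]. The minus sign is
    forced because [u] makes exactly the roots of its inversion set negative. *)
Lemma packing_tr u : W u ->
  packing Phi Delta (inversions P u) -> packing Phi Delta (inversions P u^T).
Proof.
move=> Wu pack g p q Wg pq; have Wut := refl_group_tr Wu.
have uu := weyl_orthV rs ss Wu.
suff E : u^T *m g *m u = 1%:M.
  have : u *m (u^T *m g *m u) *m u^T = u *m u^T by rewrite E mulmx1.
  by rewrite uu !mulmxA uu mul1mx -mulmxA uu mulmx1.
apply: (pack _ (u^T *m p) (- (u^T *m q))); first by do ![apply: refl_groupM => //].
have gE (r : 'cV[R]_d) : u^T *m g *m u *m (u^T *m r) = u^T *m (g *m r).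
  by rewrite -!mulmxA [u *m (_ *m r)]mulmxA uu mul1mx.
move=> b bP; rewrite /chosen; case: ifP => bI.
  move: bI; rewrite inversionsE bP /= => ub.
  have [] := pq _ ub; rewrite /chosen mem_inversions_tr ub mulmxN (weylK rs ss Wu) opprK bP /=.
  rewrite !dotNr mulmxN gE !dotNl ![dot (u^T *m _) b]dot_mulmxl trmxK.
  by [].
have ub : u *m b \in P.
  by have := inversionsNE rs ss Wu bP; rewrite bI => /esym/negbFE.
have [] := pq _ ub; rewrite /chosen mem_inversions_tr ub (weylK rs ss Wu).
rewrite (neg_rootE rs ss) ?(pos_root bP) // bP /= gE.
by rewrite ![dot (u^T *m _) b]dot_mulmxl trmxK.
Qed.

Lemma covering_tr u : W u ->
  covering Phi Delta (inversions P u) -> covering Phi Delta (inversions P u^T).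
Proof.
move=> Wu cov p q; have Wut := refl_group_tr Wu.
have [g Wg gP] := cov (u^T *m p) (- (u^T *m q)).
exists (u *m g *m u^T); first by do ![apply: refl_groupM => //].
move=> b bP; rewrite /chosen mem_inversions_tr bP /=; case: ifP => ub.
  have := gP _ ub; rewrite /chosen inversionsE ub /= mulmxN (weylKV rs ss Wu) opprK bP.
  by rewrite mulmxN dotNl dotNr opprK -!mulmxA [dot (u *m _) b]dot_mulmxl.
have ub' : u^T *m b \in P.
  by have [//|] := weyl_pos_or_neg Wut bP; rewrite ub.
have := gP _ ub'; rewrite /chosen inversionsE ub' (weylKV rs ss Wu).
rewrite (neg_rootE rs ss) ?(pos_root bP) // bP /=.
by rewrite -!mulmxA [dot (u *m _) b]dot_mulmxl.
Qed.

End Splitting.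

(** * Parabolic subsystems and components *)

Section Cut.
Variables (R : realFieldType) (d : nat).
Implicit Types (a b v p q : 'cV[R]_d) (A B : {fset 'cV[R]_d}) (V : {vspace 'cV[R]_d}).

Lemma cutE A V b : (b \in cut A V) = (b \in A) && (b \in V).
Proof. by rewrite !inE. Qed.

Lemma dot_span v A b : (forall a, a \in A -> dot v a = 0) ->
  b \in <<enum_fset A>>%VS -> dot v b = 0.
Proof.
move=> vA; rewrite -[enum_fset A]/(val (in_tuple (enum_fset A))) => /coord_span->.
rewrite dot_sumr big1 // => i _; rewrite dotZr vA ?mulr0 //.
exact: mem_nth.
Qed.

Lemma refl_span a b V : a \in V -> (refl a *m b \in V) = (b \in V).
Proof.
by move=> aV; rewrite reflE rpredBr // rpredZ.
Qed.

Lemma refl_group_span A w b V : (forall a, a \in A -> a \in V) -> refl_group A w ->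
  (w *m b \in V) = (b \in V).
Proof.
move=> AV; move: w; apply: refl_group_ind => [|a w aA _ IH]; first by rewrite mul1mx.
by rewrite -mulmxA refl_span //; apply: AV.
Qed.

Lemma mem_fset_span A a : a \in A -> a \in <<enum_fset A>>%VS.
Proof. by move=> aA; apply: memv_span. Qed.

Lemma fset_span_sub A V b : (forall a, a \in A -> a \in V) ->
  b \in <<enum_fset A>>%VS -> b \in V.
Proof. by move=> AV; apply: (subvP (introT span_subvP _)) => a /AV. Qed.

End Cut.

Section Parabolic.
Variables (R : realFieldType) (d : nat) (Phi Delta J : {fset 'cV[R]_d}).
Hypotheses (rs : root_system Phi) (ss : simple_system Phi Delta) (JD : J `<=` Delta).
Implicit Types (a b v p q : 'cV[R]_d) (g w u x y : 'M[R]_d) (A : {fset 'cV[R]_d}).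
Local Notation P := (pos_roots Phi Delta).
Local Notation W := (refl_group Delta).
Local Notation V := <<enum_fset J>>%VS.

(** The sum of the fundamental coweights outside [J]. The parabolic subgroup fixes it, so it
    separates the positive roots inside the span from the outer ones. *)
Lemma parabolic_coweight : exists om, [/\ forall a, a \in J -> dot om a = 0,
  forall b, b \in P -> 0 <= dot om b &
  forall b, b \in P -> (b \in V) = (dot om b == 0)].
Proof.
have [om omE] := dual_vector ss (fun a => (a \notin J)%:R).
have omJ a : a \in J -> dot om a = 0.
  by move=> aJ; rewrite omE ?aJ // (fsubsetP JD).
have om0 a : a \in Delta -> 0 <= dot om a by move=> aD; rewrite omE.
exists om; split=> //.
  by move=> b /pos_rootP[_]; apply: pos_dot_ge0.
move=> b /pos_rootP[_ [c ->]]; apply/idP/eqP; first exact: dot_span.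
rewrite dot_comb => /eqP; rewrite big_seq psumr_eq0 => [|a aD]; last first.
  by rewrite mulrn_wge0 ?om0.
move=> /allP H; rewrite big_seq rpred_sum // => a aD.
have := H a aD; rewrite aD /= omE //; have [aJ _|aJ] := boolP (a \in J).
  by rewrite rpredMn // mem_fset_span.
by rewrite pnatr_eq0 => /eqP ->; rewrite mulr0n rpred0.
Qed.

Lemma cut_simple : cut Delta V = J.
Proof.
apply/fsetP=> a; rewrite cutE; apply/andP/idP => [[aD aV]|aJ]; last first.
  by rewrite mem_fset_span // (fsubsetP JD).
apply: contraT => aJ; have [v [va v0]] := simple_dual ss aD.
suff: dot v a = 0 by rewrite va => /eqP; rewrite oner_eq0.
apply: dot_span aV => b bJ; apply: v0; first exact: (fsubsetP JD).
by apply: contraNneq aJ => <-.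
Qed.

Lemma cut_root_system (U : {vspace 'cV[R]_d}) : root_system (cut Phi U).
Proof.
case: rs => Phi0 st int red; split.
- by rewrite cutE (negPf Phi0).
- move=> a b; rewrite !cutE => /andP[aP aU] /andP[bP bU].
  by rewrite st // refl_span.
- by move=> a b; rewrite !cutE => /andP[aP _] /andP[bP _]; apply: int.
- by move=> a c; rewrite !cutE => /andP[aP _] /andP[cP _]; apply: red cP.
Qed.

Lemma nonneg_comb_cut b : b \in V -> nonneg_comb Delta b -> nonneg_comb J b.
Proof.
move=> bV [c bE]; have cJ a : a \in Delta -> a \notin J -> c a = 0%N.
  move=> aD aJ; have [v [va v0]] := simple_dual ss aD.
  have : dot v b = 0.
    apply: dot_span bV => a' a'J; apply: v0; first exact: (fsubsetP JD).
    by apply: contraNneq aJ => <-.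
  rewrite bE dot_comb (bigD1_seq a) ?fset_uniq //= va big_seq_cond big1 ?addr0.
    by move=> /eqP; rewrite pnatr_eq0 => /eqP.
  by move=> x /andP[xD xa]; rewrite v0 // mul0rn.
exists c; rewrite bE (bigID (mem J)) /= [X in _ + X]big_seq_cond [X in _ + X]big1 ?addr0.
  rewrite -[LHS]big_filter; apply: perm_big; apply: uniq_perm.
  - by rewrite filter_uniq // fset_uniq.
  - exact: fset_uniq.
  - move=> a; rewrite mem_filter /=; apply/andP/idP => [[]//|aJ].
    by split=> //; apply: (fsubsetP JD).
by move=> a /andP[aD aJ]; rewrite cJ.
Qed.

Lemma nonneg_comb_sub b : nonneg_comb J b -> nonneg_comb Delta b.
Proof.
move=> [c ->]; exists (fun a => if a \in J then c a else 0%N).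
rewrite [RHS](bigID (mem J)) /= [X in _ + X]big1 ?addr0; last first.
  by move=> a /negPf ->.
rewrite -[RHS]big_filter big_seq (eq_bigr (fun a => a *+ (if a \in J then c a else 0%N))).
  rewrite -big_seq; apply: perm_big; rewrite perm_sym; apply: uniq_perm.
  - by rewrite filter_uniq // fset_uniq.
  - exact: fset_uniq.
  - move=> a; rewrite mem_filter /=; apply/andP/idP => [[]//|aJ].
    by split=> //; apply: (fsubsetP JD).
by move=> a ->.
Qed.

Lemma cut_simple_system : simple_system (cut Phi V) J.
Proof.
case: ss => DP fD pm; split.
- by apply/fsubsetP=> a aJ; rewrite cutE mem_fset_span // andbT !(fsubsetP DP, fsubsetP JD).
- have mJ : {subset enum_fset J <= enum_fset Delta} := fsubsetP JD.
  have := filter_free (mem (enum_fset J)) fD; rewrite (perm_free (Y := enum_fset J)) //.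
  apply: uniq_perm; rewrite ?filter_uniq ?fset_uniq // => a; rewrite mem_filter.
  by apply/andP/idP => [[]//|aJ]; split=> //; apply: mJ.
- move=> b; rewrite cutE => /andP[bP bV].
  by case: (pm b bP) => nb; [left|right]; apply: nonneg_comb_cut => //; rewrite rpredN.
Qed.

Lemma cut_pos_roots : pos_roots (cut Phi V) J = cut P V.
Proof.
apply/fsetP=> b; rewrite cutE; apply/pos_rootP/andP => [[]|[/pos_rootP[bP nb] bV]].
  rewrite cutE => /andP[bP bV] nb; split=> //; apply/pos_rootP; split=> //.
  exact: nonneg_comb_sub.
by rewrite cutE bP bV; split=> //; apply: nonneg_comb_cut.
Qed.

Lemma refl_group_cut : refl_group (cut Phi V) = refl_group J.
Proof.
apply/predeqP => w; split; apply: refl_group_sub => a aA.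
  exact: (root_refl_weyl (cut_root_system _) cut_simple_system).
apply: refl_group_refl; rewrite cutE mem_fset_span // andbT.
exact/(simple_root ss)/(fsubsetP JD).
Qed.

Lemma parabolic_weyl w : refl_group J w -> W w.
Proof. by apply: refl_group_sub => a aJ; apply/refl_group_refl/(fsubsetP JD). Qed.

Lemma parabolic_outer w b : refl_group J w -> b \in P -> b \notin V -> w *m b \in P.
Proof.
move=> Ww bP bV; have [om [omJ om0 omV]] := parabolic_coweight.
have [//|wb] := weyl_pos_or_neg rs ss (parabolic_weyl Ww) bP.
have := om0 _ wb; rewrite dotNr dotC dot_mulmxl dotC.
rewrite (refl_group_fix omJ (refl_group_tr Ww)) => h.
have h0 := om0 b bP; case/negP: bV; rewrite omV //; apply/eqP; lra.
Qed.

(** The default of [xget] is never taken: let [h] make [w^T *m rho] dominant for the subsystem. For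
    [b] in the span, [h *m b] then has the sign of [dot rho (w *m b)]. *)
Lemma restr_spec w : W w -> let w' := restr Phi Delta V w in
  refl_group J w' /\ inversions (cut P V) w' = cut (inversions P w) V.
Proof.
move=> Ww; rewrite /restr /=.
suff : exists w', refl_group (cut Phi V) w' /\ inversions (cut P V) w' = cut (inversions P w) V.
  by move/(xgetPex 1%:M) => /=; rewrite refl_group_cut.
rewrite refl_group_cut; have [rho r1] := exists_rho ss.
have r0 a : a \in Delta -> 0 < dot rho a by move/r1->.
have [h Wh hP] := dominant_translate (cut_root_system _) cut_simple_system (w^T *m rho).
rewrite cut_pos_roots in hP; exists h; split=> //; apply/fsetP=> b.
rewrite inversionsE cutE [RHS]cutE inversionsE cutE.
have [bP|//] := boolP (b \in P); have [bV|] := boolP (b \in V); last by rewrite /= andbF.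
rewrite /= andbT.
have WwP := weyl_root rs ss Ww (pos_root bP); have Wh' := parabolic_weyl Wh.
have hbV : h *m b \in V by rewrite (refl_group_span _ (A := J)) // => a; apply: mem_fset_span.
have hbPhi := weyl_root rs ss Wh' (pos_root bP).
rewrite rpredN hbV andbT.
have E : dot (h *m (w^T *m rho)) (h *m b) = dot rho (w *m b).
  by rewrite (dot_orth _ _ (weyl_orth rs ss Wh')) dot_mulmxl trmxK.
apply/idP/idP => [hb|wb].
  have := hP (- (h *m b)); rewrite cutE hb rpredN hbV => /(_ isT); rewrite dotNr E => wb.
  have [wbP|//] := weyl_pos_or_neg rs ss Ww bP.
  by have := pos_dot_gt0 rs r0 wbP; lra.
have [hb|//] := weyl_pos_or_neg rs ss Wh' bP.
have := hP (h *m b); rewrite cutE hb hbV => /(_ isT); rewrite E => wb'.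
by have := pos_dot_gt0 rs r0 wb; rewrite dotNr; lra.
Qed.

Lemma chosen_cut A p q b : b \in V -> chosen (cut A V) p q b = chosen A p q b.
Proof. by rewrite /chosen cutE => ->; rewrite andbT. Qed.

(* Translating p and q far along the fixed space of the parabolic subgroup    *)
(* makes them positive on the remaining positive roots.                       *)
Lemma packing_cut A : packing Phi Delta A -> packing (cut Phi V) J (cut A V).
Proof.
move=> pack g p q Wg pq; have [om [omJ om0 omV]] := parabolic_coweight.
have Wg' := parabolic_weyl Wg.
pose S b := `|dot p b| + `|dot q b| + `|dot (g *m p) b| + `|dot (g *m q) b|.
have S0 b : 0 <= S b by rewrite !addr_ge0.
(* [N] times [om] has to outweigh [S] on every outer root. Roots in the span contribute 0, division
   by 0 being 0. *)
pose N := 1 + \sum_(b <- P) S b / dot om b.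
have gom : g *m om = om by apply: (refl_group_fix omJ).
apply: (pack g (p + N *: om) (q + N *: om) Wg') => b bP.
have E : chosen A (p + N *: om) (q + N *: om) b = chosen A p q b + N *: om.
  by rewrite /chosen; case: ifP.
rewrite E mulmxDr -scalemxAr gom !dotDl dotZl.
have [bV|bV] := boolP (b \in V).
  have := pq b; rewrite cut_pos_roots cutE bP bV chosen_cut // => /(_ isT).
  by move: bV; rewrite omV // => /eqP ->; rewrite mulr0 !addr0.
have omb : 0 < dot om b by rewrite lt_neqAle eq_sym -omV // bV om0.
have SN : S b < N * dot om b.
  rewrite -ltr_pdivrMr // /N (bigD1_seq b) ?fset_uniq //=.
  have : 0 <= \sum_(i <- P | i != b) S i / dot om i.
    rewrite big_seq_cond sumr_ge0 // => i /andP[iP _].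
    by rewrite divr_ge0 ?S0 ?om0.
  lra.
have := ler_norm (- dot p b); have := ler_norm (- dot q b).
have := ler_norm (- dot (g *m p) b); have := ler_norm (- dot (g *m q) b).
rewrite !normrN /chosen; move: SN; rewrite /S.
have := normr_ge0 (dot p b); have := normr_ge0 (dot q b).
have := normr_ge0 (dot (g *m p) b); have := normr_ge0 (dot (g *m q) b).
by case: (b \in A); split; lra.
Qed.

(** Strip simple inversions from the right: each lies in the span, hence in [J], and the remaining
    inversions stay in the span. Without simple inversions, [w] is 1. *)
Lemma mem_parabolic w : W w ->
  (forall b, b \in P -> - (w *m b) \in P -> b \in V) -> refl_group J w.
Proof.
have [n] := ubnP #|` inversions P w|; elim: n => // n IH in w *.
rewrite ltnS => wn Ww wV.
have [[a [aD wa]]|none] := pselect (exists a, a \in Delta /\ - (w *m a) \in P); last first.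
  suff -> : w = 1%:M by apply: refl_group1.
  apply: (inversions_eq0 rs ss Ww) => b bP.
  have [rho r1] := exists_rho ss; have r0 a : a \in Delta -> 0 < dot rho a by move/r1->.
  have [//|wb] := weyl_pos_or_neg rs ss Ww bP.
  have := pos_dot_gt0 rs r0 wb; rewrite dotNr dotC dot_mulmxl dotC oppr_gt0 => h.
  have : 0 <= dot (w^T *m rho) b.
    have /pos_rootP[_] := bP; apply: pos_dot_ge0 => a aD.
    have [wa|wa] := weyl_pos_or_neg rs ss Ww (simple_pos rs ss aD).
      by rewrite dot_mulmxl trmxK ltW // (pos_dot_gt0 rs r0).
    by case: none; exists a.
  by rewrite leNgt h.
have aP := simple_pos rs ss aD; have aV := wV a aP wa.
have a0 := root_neq0 rs (pos_root aP).
have aJ : a \in J by rewrite -cut_simple cutE aD.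
have Wa := refl_group_refl aD.
have wE : w = (w *m refl a) *m refl a by rewrite -mulmxA refl_invol // mulmx1.
rewrite wE; apply: refl_groupM; last exact: refl_group_refl.
apply: IH; last 2 first.
- exact: refl_groupM.
- move=> b bP wb; have [->//|ba] := eqVneq b a.
  rewrite -(refl_span b aV); apply: wV; first exact: refl_simple_pos.
  by rewrite mulmxA.
have := card_inversionsM rs ss Ww Wa.
rewrite refl_tr (inversions_simple rs ss aD) cardfs1.
have -> : inversions P w `&` [fset a] = [fset a].
  by apply/fsetIidPr; rewrite fsub1set inversionsE aP.
by rewrite cardfs1; lia.
Qed.

(** Make [p] dominant for the whole system first, then correct inside the span by an element of the
    parabolic group. It permutes the outer positive roots, where only [p] is tested. *)
Lemma covering_of_cut A : (forall b, b \in P -> b \in A -> b \in V) ->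
  covering (cut Phi V) J (cut A V) -> covering Phi Delta A.
Proof.
move=> AV cov p q; have [g Wg gP] := dominant_translate rs ss p.
have [h Wh hP] := cov (g *m p) (g *m q).
exists (h *m g); first by apply: refl_groupM => //; apply: parabolic_weyl.
move=> b bP; have [bV|bV] := boolP (b \in V).
  have := hP b; rewrite cut_pos_roots cutE bP bV chosen_cut // => /(_ isT).
  by rewrite -mulmxA /chosen; case: (b \in A).
rewrite /chosen; case: ifP => [bA|_]; first by rewrite (AV b bP bA) in bV.
rewrite -mulmxA dot_mulmxl; apply: gP; apply: parabolic_outer => //.
exact: refl_group_tr.
Qed.

(** Let [h] and [k] in the parabolic group make [p] and [g *m p] dominant on the span. Both results
    stay positive on the outer roots, so [k *m g *m h^T], which maps one to the other, has all its
    inversions in the span. By [mem_parabolic] it lies in the parabolic group, and so does [g]. *)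
Lemma packing_of_cut A : (forall b, b \in P -> b \in A -> b \in V) ->
  packing (cut Phi V) J (cut A V) -> packing Phi Delta A.
Proof.
move=> AV pack g p q Wg pq.
have outer b : b \in P -> b \notin V -> 0 < dot p b /\ 0 < dot (g *m p) b.
  move=> bP bV; have := pq b bP; rewrite /chosen; case: ifP => // bA.
  by rewrite (AV b bP bA) in bV.
have dom r : exists2 h, refl_group J h & forall b, b \in P -> b \in V -> 0 <= dot (h *m r) b.
  have [h Wh hP] := dominant_translate (cut_root_system _) cut_simple_system r.
  by exists h => // b bP bV; apply: hP; rewrite cut_pos_roots cutE bP.
have [h Wh hP] := dom p; have [k Wk kP] := dom (g *m p).
have [[Wh' Wk'] [Wht Wkt]] := ((parabolic_weyl Wh, parabolic_weyl Wk),
  (refl_group_tr Wh, refl_group_tr Wk)).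
have kgh : refl_group J (k *m g *m h^T).
  apply: mem_parabolic.
    by do ![apply: refl_groupM => //]; apply: refl_group_tr.
  move=> b bP neg; apply: contraT => bV.
  have hb : 0 < dot (h *m p) b.
    rewrite dot_mulmxl; apply: (outer _ _ _).1; first exact: parabolic_outer.
    rewrite (refl_group_span _ (A := J)) // => a; exact: mem_fset_span.
  suff : 0 <= dot (k *m (g *m p)) (- (k *m g *m h^T *m b)).
    rewrite dotNr -!mulmxA (dot_orth _ _ (weyl_orth rs ss Wk')).
    by rewrite (dot_orth _ _ (weyl_orth rs ss Wg)) -dot_mulmxl; lra.
  set c := - _; have [cV|cV] := boolP (c \in V); first exact: kP.
  rewrite dot_mulmxl ltW //; apply: (outer _ _ _).2; first exact: parabolic_outer.
  rewrite (refl_group_span _ (A := J)) // => a; exact: mem_fset_span.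
have Jg : refl_group J g.
  have -> : g = k^T *m (k *m g *m h^T) *m h.
    rewrite !mulmxA (weyl_orth rs ss Wk') mul1mx -mulmxA.
    by rewrite (weyl_orth rs ss Wh') mulmx1.
  by do ![apply: refl_groupM => //].
apply: (pack g p q Jg) => b; rewrite cut_pos_roots cutE => /andP[bP bV].
by rewrite chosen_cut //; apply: pq.
Qed.

End Parabolic.

Section Decomposition.
Variables (R : realFieldType) (d : nat).
Implicit Types (Phi Delta A B C D : {fset 'cV[R]_d}) (b a : 'cV[R]_d).

Lemma decomposition_exists Phi : 0 \notin Phi -> exists Cs, decomposition Phi Cs.
Proof.
have [n] := ubnP #|` Phi|; elim: n => // n IH in Phi *; rewrite ltnS => Phin Phi0.
have [irr|red] := pselect (irreducible_roots Phi).
  exists [fset Phi]; split.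
  - move=> b; split=> [bP|[C]]; last by rewrite in_fset1 => /eqP->.
    by exists Phi; rewrite ?in_fset1.
  - by move=> C; rewrite in_fset1 => /eqP->.
  - by move=> C D; rewrite !in_fset1 => /eqP-> /eqP->.
have [->|Phin0] := eqVneq Phi fset0.
  exists fset0; split=> // b; split; first by rewrite in_fset0.
  by case=> C; rewrite in_fset0.
have [A [B [PhiE AB A0 B0]]] : exists A B, [/\ Phi = A `|` B, orthogonal_sets A B,
    A != fset0 & B != fset0].
  apply: contrapT => H; apply: red; split=> [E|A B PhiE AB]; first by rewrite E eqxx in Phin0.
  have [|A0] := eqVneq A fset0; first by left.
  have [|B0] := eqVneq B fset0; first by right.
  by case: H; exists A, B.
have AP : A `<=` Phi by rewrite PhiE fsubsetUl.
have BP : B `<=` Phi by rewrite PhiE fsubsetUr.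
have disj b : b \in A -> b \in B -> False.
  move=> bA bB; have := AB b b bA bB => /dot_eq0 b0.
  by move: Phi0; rewrite -b0 (fsubsetP AP).
have cardP : #|` Phi| = (#|` A| + #|` B|)%N.
  rewrite -cardfsUI -PhiE (_ : A `&` B = fset0) ?cardfs0 ?addn0 //.
  by apply/fsetP=> b; rewrite in_fsetI in_fset0; apply/negP=> /andP[/disj].
have [A1 B1] : (0 < #|` A|)%N /\ (0 < #|` B|)%N by rewrite !cardfs_gt0.
have [||CA [CA1 CA2 CA3]] := IH A; first by lia.
  by apply: contra Phi0 => /(fsubsetP AP).
have [||CB [CB1 CB2 CB3]] := IH B; first by lia.
  by apply: contra Phi0 => /(fsubsetP BP).
exists (CA `|` CB); split.
- move=> b; rewrite PhiE in_fsetU; split=> [/orP[/CA1[C CC bC]|/CB1[C CC bC]]|[C]].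
  + by exists C; rewrite // in_fsetU CC.
  + by exists C; rewrite // in_fsetU CC orbT.
  + rewrite in_fsetU => /orP[CC|CC] bC; apply/orP; [left; apply/CA1|right; apply/CB1];
      by exists C.
- by move=> C; rewrite in_fsetU => /orP[/CA2|/CB2].
- move=> C D; rewrite !in_fsetU => /orP[CC|CC] /orP[DD|DD] CD.
  + exact: CA3.
  + by move=> a b aC bD; apply: AB; [apply/CA1; exists C|apply/CB1; exists D].
  + by move=> a b aC bD; rewrite dotC; apply: AB; [apply/CA1; exists D|apply/CB1; exists C].
  + exact: CB3.
Qed.

Section Components.
Variables (Phi Delta : {fset 'cV[R]_d}) (Cs : {fset {fset 'cV[R]_d}}).
Hypotheses (rs : root_system Phi) (ss : simple_system Phi Delta).
Hypothesis dec : decomposition Phi Cs.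
Local Notation P := (pos_roots Phi Delta).
Local Notation W := (refl_group Delta).

Lemma component_root C b : C \in Cs -> b \in C -> b \in Phi.
Proof. by case: dec => H _ _ CC bC; apply/H; exists C. Qed.

Lemma component_of b : b \in Phi -> exists2 C, C \in Cs & b \in C.
Proof. by case: dec => H _ _ /H. Qed.

Lemma component_orth C D a b : C \in Cs -> D \in Cs -> C != D ->
  a \in C -> b \in D -> dot a b = 0.
Proof. by case: dec => _ _ H CC DD /eqP CD; apply: H. Qed.

Lemma component_orth_span C a : C \in Cs -> a \in Phi -> a \notin C ->
  forall b, b \in <<enum_fset C>>%VS -> dot a b = 0.
Proof.
move=> CC aP aC b; apply: dot_span => c cC; have [D DD aD] := component_of aP.
by apply: (component_orth DD CC) => //; apply: contraNneq aC => <-.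
Qed.

Lemma mem_component C b : C \in Cs -> b \in Phi -> (b \in <<enum_fset C>>%VS) = (b \in C).
Proof.
move=> CC bP; apply/idP/idP => [bC|]; last exact: mem_fset_span.
apply: contraT => nbC; have := component_orth_span CC bP nbC bC => /dot_eq0 b0.
by have := root_neq0 rs bP; rewrite b0 eqxx.
Qed.

Lemma component_simple_sub C : cut Delta <<enum_fset C>>%VS `<=` Delta.
Proof. by apply/fsubsetP=> a; rewrite cutE => /andP[]. Qed.

(** In the expansion of a root of [C], the part [b2] over simple roots outside [C] is orthogonal to
    the span of [C] and yet contained in it, hence zero. *)
Lemma component_span C : C \in Cs ->
  <<enum_fset C>>%VS = <<enum_fset (cut Delta <<enum_fset C>>%VS)>>%VS.
Proof.
move=> CC; set J := cut Delta _; apply/eqP; rewrite eqEsubv; apply/andP; split; last first.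
  by apply/span_subvP => a; rewrite -[a \in _]/(a \in J) cutE => /andP[].
apply/span_subvP => b bC; have bP := component_root CC bC.
suff H b' : b' \in C -> nonneg_comb Delta b' -> b' \in <<enum_fset J>>%VS.
  have [/pos_rootP[_]|/pos_rootP[nbP nb]] := pos_or_neg rs ss bP; first exact: H.
  rewrite -rpredN; apply: H => //.
  by rewrite -(mem_component CC nbP) rpredN mem_fset_span.
move=> {}bC [c bE]; pose b1 := \sum_(a <- Delta | a \in J) a *+ c a.
have b1J : b1 \in <<enum_fset J>>%VS.
  by rewrite rpred_sum // => a aJ; rewrite rpredMn // mem_fset_span.
have b1C : b1 \in <<enum_fset C>>%VS.
  by apply: fset_span_sub b1J => a; rewrite cutE => /andP[].
pose b2 := \sum_(a <- Delta | a \notin J) a *+ c a.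
have b12 : b' = b1 + b2 by rewrite bE (bigID (mem J)).
have b2C : b2 \in <<enum_fset C>>%VS.
  have -> : b2 = b' - b1 by rewrite b12 addrAC subrr add0r.
  by rewrite rpredB // mem_fset_span.
suff : b2 = 0 by move=> b20; rewrite b12 b20 addr0.
apply: dot_eq0; rewrite {2}/b2 dot_sumr big_seq_cond big1 // => a /andP[aD aJ].
rewrite dotMnr dotC (component_orth_span CC) ?mul0rn //; first exact: (simple_root ss).
by apply: contra aJ => aC; rewrite cutE aD mem_fset_span.
Qed.

Lemma component_pos_roots C : C \in Cs ->
  pos_roots (cut Phi <<enum_fset C>>%VS) (cut Delta <<enum_fset C>>%VS) =
  cut P <<enum_fset C>>%VS.
Proof.
move=> CC; have := cut_pos_roots ss (component_simple_sub C).
by rewrite -component_span.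
Qed.

Lemma component_weyl C w : C \in Cs -> W w ->
  exists2 h, refl_group (cut Delta <<enum_fset C>>%VS) h & forall b, b \in C -> w *m b = h *m b.
Proof.
move=> CC; set J := cut Delta _; move: w.
have JC a : a \in J -> a \in <<enum_fset C>>%VS by rewrite cutE => /andP[].
apply: refl_group_ind => [|a w aD Ww [h Wh hE]].
  by exists 1%:M => //; apply: refl_group1.
have hC b : b \in C -> h *m b \in <<enum_fset C>>%VS.
  by move=> bC; rewrite (refl_group_span _ JC Wh) mem_fset_span.
have [aC|aC] := boolP (a \in C).
  exists (refl a *m h); last by move=> b bC; rewrite -!mulmxA hE.
  apply: refl_groupM => //; apply: refl_group_refl.
  by rewrite cutE aD mem_fset_span.
exists h => // b bC; rewrite -mulmxA hE // refl_fix // dotC.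
by apply: (component_orth_span CC) => //; [apply: (simple_root ss)|apply: hC].
Qed.

(** The components are treated one after another; the element added for [C] fixes the roots of all
    other components, so what was achieved there persists. *)
Lemma covering_components A :
  (forall C, C \in Cs -> let V := <<enum_fset C>>%VS in
    covering (cut Phi V) (cut Delta V) (cut A V)) -> covering Phi Delta A.
Proof.
move=> cov p q.
suff [g Wg gP] : exists2 g, W g & forall C b, C \in enum_fset Cs -> b \in P -> b \in C ->
    0 <= dot (g *m chosen A p q b) b.
  exists g => // b bP; have [C CC bC] := component_of (pos_root bP); exact: (gP C).
have : {subset enum_fset Cs <= Cs} by [].
elim: (enum_fset Cs) => [_|C L IH sub]; first by exists 1%:M => //; apply: refl_group1.
have CC : C \in Cs by rewrite sub ?mem_head.
have [g Wg gP] : exists2 g, W g & forall C b, C \in L -> b \in P -> b \in C ->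
    0 <= dot (g *m chosen A p q b) b.
  by apply: IH => D DL; apply: sub; rewrite inE DL orbT.
have [h Wh hP] := cov C CC (g *m p) (g *m q).
have JD := component_simple_sub C.
exists (h *m g); first by apply: refl_groupM => //; apply: (parabolic_weyl JD).
move=> D b; have [-> _ bP bC|DC] := eqVneq D C.
  have bV : b \in <<enum_fset C>>%VS by rewrite mem_fset_span.
  have := hP b; rewrite component_pos_roots // cutE bP bV => /(_ isT).
  by rewrite chosen_cut // -mulmxA /chosen; case: (b \in A).
rewrite inE (negPf DC) /= => DL bP bD; rewrite -mulmxA dot_mulmxl.
rewrite (refl_group_fix _ (refl_group_tr Wh)) ?(gP D) // => a.
rewrite cutE => /andP[aD aC]; apply: (component_orth_span CC) => //.
  exact: pos_root bP.
apply/negP => bC; have := component_orth (sub D _) CC DC bD bC.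
rewrite inE DL orbT => /(_ isT) /dot_eq0 b0.
by have := root_neq0 rs (pos_root bP); rewrite b0 eqxx.
Qed.

(** On each component [g^T] acts as an element of the group of that component, which packing there
    makes trivial. So [g^T] fixes every root. *)
Lemma packing_components A :
  (forall C, C \in Cs -> let V := <<enum_fset C>>%VS in
    packing (cut Phi V) (cut Delta V) (cut A V)) -> packing Phi Delta A.
Proof.
move=> pack g p q Wg pq; have Wgt := refl_group_tr Wg.
suff fix_g C b : C \in Cs -> b \in C -> g^T *m b = b.
  rewrite -[g]trmxK (inversions_eq0 rs ss Wgt) ?trmx1 // => b bP.
  by have [C CC bC] := component_of (pos_root bP); rewrite (fix_g C).
move=> CC bC; have [h Wh hE] := component_weyl CC Wgt.
rewrite hE //; suff -> : h = 1%:M by rewrite mul1mx.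
rewrite -[h]trmxK (pack C CC h^T p q) ?trmx1 //; first exact: refl_group_tr.
have JD := component_simple_sub C.
move=> c; rewrite component_pos_roots // cutE => /andP[cP cV].
rewrite chosen_cut //; have := pq c cP.
rewrite dot_mulmxl [dot (h^T *m _) c]dot_mulmxl trmxK hE //.
by rewrite -(mem_component CC) // (pos_root cP).
Qed.

End Components.
End Decomposition.

(** * Separable elements *)

Section Separable.
Variables (R : realFieldType) (d : nat).
Implicit Types (Phi Delta A B C J : {fset 'cV[R]_d}) (b a : 'cV[R]_d) (w u : 'M[R]_d).

Lemma inversions_sub A w : inversions A w `<=` A.
Proof. by apply/fsubsetP=> b; rewrite inversionsE => /andP[]. Qed.

(** A positive root outside the span has a nonzero coefficient at [a]. Hence condition (S3) says
    that the inversion set or its complement lies in the span of the other simple roots. *)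
Lemma outside_above Phi Delta a b : simple_system Phi Delta -> a \in Delta ->
  b \in pos_roots Phi Delta -> b \notin <<enum_fset (Delta `\ a)>>%VS ->
  b \in above Phi Delta a.
Proof.
move=> ss aD bP bV; rewrite /above !inE /=.
have /pos_rootP[bPhi [c bE]] := bP.
suff ab : root_le Delta a b.
  by apply/andP; split; [rewrite bPhi /=; apply/asboolP; exists c|apply/asboolP].
have ca : c a != 0%N.
  apply: contra bV => /eqP ca; rewrite bE big_seq rpred_sum // => x xD.
  have [->|xa] := eqVneq x a; first by rewrite ca mulr0n rpred0.
  by rewrite rpredMn // mem_fset_span // in_fsetD1 xa.
exists (fun x => if x == a then (c a).-1 else c x).
rewrite bE !(bigD1_seq a) ?fset_uniq //= eqxx -{1}(prednK (n := c a)) ?lt0n //.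
rewrite mulrS -[a + _ + _]addrA [a + (_ + _)]addrC addrK; congr (_ + _).
by apply: eq_bigr => x /negPf ->.
Qed.

Lemma above_not_fsetD1 Phi Delta a b : simple_system Phi Delta -> a \in Delta ->
  b \in above Phi Delta a -> b \in pos_roots Phi Delta /\
  forall v, dot v a = 1 -> (forall x, x \in Delta -> x != a -> dot v x = 0) -> 0 < dot v b.
Proof.
move=> ss aD bA.
have /andP[bP /asboolP ab] : (b \in pos_roots Phi Delta) && `[< root_le Delta a b >].
  by move: bA; rewrite !inE.
split=> // v va v0; have : 0 <= dot v (b - a).
  apply: pos_dot_ge0 ab => x xD; have [->|xa] := eqVneq x a; first by rewrite va ler01.
  by rewrite v0.
by rewrite dotBr va; lra.
Qed.

Lemma refl_group_fset0 w : refl_group (fset0 : {fset 'cV[R]_d}) w -> w = 1%:M.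
Proof.
move=> [[|a s] sD ->]; first by rewrite /refl_prod big_nil.
by have := sD a; rewrite mem_head in_fset0 => /(_ isT).
Qed.

Lemma pos_roots_fset0 Phi : root_system Phi -> pos_roots Phi fset0 = fset0.
Proof.
move=> rs; apply/fsetP=> b; rewrite in_fset0; apply/negP=> /pos_rootP[bP [c bE]].
by have := root_neq0 rs bP; rewrite bE big_seq_fset0 eqxx.
Qed.

Lemma covering_packing_fset0 Phi A : root_system Phi ->
  covering Phi fset0 A /\ packing Phi fset0 A.
Proof.
move=> rs; split=> [p q|g p q /refl_group_fset0 //].
exists 1%:M; first exact: refl_group1.
by move=> b; rewrite pos_roots_fset0 // in_fset0.
Qed.

Lemma covering_packing_pivot Phi Delta J A :
  root_system Phi -> simple_system Phi Delta -> J `<=` Delta ->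
  A `<=` pos_roots Phi Delta ->
  let V := <<enum_fset J>>%VS in
  (forall b, b \in pos_roots Phi Delta -> b \in A -> b \in V) \/
  (forall b, b \in pos_roots Phi Delta -> b \notin A -> b \in V) ->
  covering (cut Phi V) J (cut A V) /\ packing (cut Phi V) J (cut A V) ->
  covering Phi Delta A /\ packing Phi Delta A.
Proof.
move=> rs ss JD AP V [] H [cov pack].
  by split; [apply: covering_of_cut cov|apply: packing_of_cut pack].
have E : pos_roots (cut Phi V) J `\` cut (pos_roots Phi Delta `\` A) V = cut A V.
  apply/fsetP=> b; rewrite in_fsetD (cut_pos_roots ss JD) !cutE in_fsetD.
  have : b \in A -> b \in pos_roots Phi Delta := fsubsetP AP b.
  by case: (b \in A); case: (b \in pos_roots Phi Delta); case: (b \in V) => //= /(_ isT).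
have H' b : b \in pos_roots Phi Delta -> b \in pos_roots Phi Delta `\` A -> b \in V.
  by move=> bP; rewrite in_fsetD => /andP[bA _]; apply: H.
split.
  apply/covering_compl/(covering_of_cut rs ss JD H')/covering_compl.
  by rewrite E.
apply/packing_compl/(packing_of_cut rs ss JD H')/packing_compl.
by rewrite E.
Qed.

Lemma separable_covering_packing Phi Delta w : separable Phi Delta w ->
  root_system Phi -> simple_system Phi Delta ->
  covering Phi Delta (inversions (pos_roots Phi Delta) w) /\
  packing Phi Delta (inversions (pos_roots Phi Delta) w).
Proof.
elim=> {Phi Delta w}.
- by move=> rs _; apply: covering_packing_fset0.
- move=> a w a0 Ww rs ss; set P := pos_roots _ _.
  have Pa b : b \in P -> b = a.
    move=> bP; have := pos_root bP; rewrite !inE => /orP[/eqP//|/eqP E].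
    have aP : a \in P by apply: (simple_pos rs ss); rewrite in_fset1.
    by move: bP; rewrite E => nbP; case: (pos_not_neg rs ss aP nbP).
  (* Type A_1 is the pivot case with [J] empty: the inversion set is empty or everything. *)
  apply: (@covering_packing_pivot _ _ fset0) => //; first exact: inversions_sub.
    have [aI|aI] := boolP (a \in inversions P w); [right|left]; move=> b /Pa ->.
      by rewrite aI.
    by rewrite (negPf aI).
  exact/covering_packing_fset0/cut_root_system.
- move=> Phi Delta w Cs Ww dec _ _ IH rs ss; set P := pos_roots _ _.
  have HC C : C \in Cs -> let V := <<enum_fset C>>%VS in
      covering (cut Phi V) (cut Delta V) (cut (inversions P w) V) /\
      packing (cut Phi V) (cut Delta V) (cut (inversions P w) V).
    move=> CC V; have JD := component_simple_sub Delta C.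
    have [_ E] := restr_spec rs ss JD Ww.
    have VE : V = <<enum_fset (cut Delta V)>>%VS := component_span rs ss dec CC.
    have := IH C CC; cbv zeta; rewrite (component_pos_roots rs ss dec CC) -/V.
    rewrite -/P -VE in E; rewrite E; apply; first exact: cut_root_system.
    by have := cut_simple_system ss JD; rewrite -/V -VE.
  split; first by apply: (covering_components rs ss dec) => C /HC[].
  by apply: (packing_components rs ss dec) => C /HC[].
- move=> Phi Delta w a Ww _ aD _ IH piv rs ss; set P := pos_roots _ _.
  have JD : Delta `\ a `<=` Delta by apply: fsubD1set.
  move: IH; cbv zeta; rewrite (cut_simple ss JD) => IH.
  have [_ E] := restr_spec rs ss JD Ww.
  have [||cov pack] := IH; first exact: cut_root_system.
    exact: (cut_simple_system ss JD).
  rewrite (cut_pos_roots ss JD) -/P E in cov pack.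
  apply: (covering_packing_pivot rs ss JD) => //; first exact: inversions_sub.
  case: piv => piv; [right|left] => b bP bI; apply: contraT => bV.
    have := outside_above ss aD bP bV; move/(fsubsetP piv).
    by rewrite (negPf bI).
  have := outside_above ss aD bP bV => bA.
  by have /fsetP/(_ b) := piv; rewrite in_fsetI bA bI in_fset0.
Qed.

Lemma cut_full Phi Delta : root_system Phi -> simple_system Phi Delta ->
  cut Phi <<enum_fset Delta>>%VS = Phi.
Proof.
move=> rs ss; apply/fsetP=> b; rewrite cutE; apply: andb_idr => bP.
have H b' : nonneg_comb Delta b' -> b' \in <<enum_fset Delta>>%VS.
  by move=> [c ->]; rewrite big_seq rpred_sum // => a aD; rewrite rpredMn // mem_fset_span.
by case: ss => _ _ /(_ b bP)[/H//|/H]; rewrite rpredN.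
Qed.

(** The type enters only through the hypothesis on pivots. It ranges over subsets of the original
    [Delta], so the induction never leaves [Phi]: a parabolic subsystem of a parabolic subsystem is
    again a [cut] of [Phi]. *)
Lemma separable_of_packing Phi Delta :
  root_system Phi -> simple_system Phi Delta ->
  (forall J u, J `<=` Delta -> irreducible_roots (cut Phi <<enum_fset J>>%VS) ->
    refl_group J u ->
    let Phi' := cut Phi <<enum_fset J>>%VS in
    let A := inversions (pos_roots Phi' J) u in
    packing Phi' J A ->
    exists2 a, a \in J & above Phi' J a `<=` A \/ above Phi' J a `&` A = fset0) ->
  forall u, refl_group Delta u ->
    packing Phi Delta (inversions (pos_roots Phi Delta) u) -> separable Phi Delta u.
Proof.
move=> rs0 ss0 pivot u0 Wu0 pack0.
suff H n J u : (#|` J| < n)%N -> J `<=` Delta -> refl_group J u ->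
    let Phi' := cut Phi <<enum_fset J>>%VS in
    packing Phi' J (inversions (pos_roots Phi' J) u) -> separable Phi' J u.
  rewrite -[X in separable X](cut_full rs0 ss0); apply: (H #|` Delta|.+1) => //.
  by rewrite cut_full.
elim: n J u => // n IH J u; rewrite ltnS => Jn JD Wu Phi' pack.
have rs : root_system Phi' := cut_root_system rs0 <<enum_fset J>>%VS.
have ss : simple_system Phi' J := cut_simple_system ss0 JD.
have step J' : J' `<=` J -> (#|` J'| < #|` J|)%N ->
    let V := <<enum_fset J'>>%VS in separable (cut Phi' V) (cut J V) (restr Phi' J V u).
  move=> J'J J'card V; have J'D := fsubset_trans J'J JD.
  rewrite (cut_simple ss J'J).
  have [Wr E] := restr_spec rs ss J'J Wu.
  have PhiE : cut Phi' V = cut Phi V.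
    apply/fsetP=> b; rewrite !cutE -andbA; congr (_ && _); apply: andb_idl.
    by apply: fset_span_sub => a aJ'; apply/mem_fset_span/(fsubsetP J'J).
  have := packing_cut ss J'J pack; rewrite -E -(cut_pos_roots ss J'J) PhiE.
  by apply: IH => //; apply: leq_trans J'card Jn.
have [irr|red] := pselect (irreducible_roots Phi').
  have [a aJ piv] := pivot J u JD irr Wu pack.
  apply: (@separable_irr _ _ _ _ _ a) => //.
  apply: step; first exact: fsubD1set.
  by rewrite [X in (_ < X)%N](cardfsD1 a) aJ.
have Phi0 : 0 \notin Phi' by case: rs.
have [J0|J0] := eqVneq J fset0.
  have Phi'0 : Phi' = fset0.
    apply/fsetP=> b; rewrite in_fset0; apply/negP=> bP.
    have [|] := pos_or_neg rs ss bP; rewrite J0 pos_roots_fset0 // in_fset0.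
  rewrite Phi'0 J0; rewrite J0 in Wu; rewrite (refl_group_fset0 Wu).
  exact: separable_trivial.
have [Cs dec] := decomposition_exists Phi0.
have [a0 a0J] := fset0Pn _ J0.
have [C0 C0C a0C0] := component_of dec (simple_root ss a0J).
have Cs1 : (1 < #|` Cs|)%N.
  rewrite ltnNge; apply/negP => Cs1.
  have CsE : Cs = [fset C0].
    by apply/esym/eqP; rewrite eqEfcard fsub1set C0C cardfs1.
  apply: red; case: dec => H irr _; have -> : Phi' = C0; last exact: irr.
  apply/fsetP=> b; apply/idP/idP => [/H[C]|bC]; last by apply/H; exists C0.
  by rewrite CsE in_fset1 => /eqP->.
apply: (@separable_red _ _ _ _ _ Cs) => // C CC V.
have VE : V = <<enum_fset (cut J V)>>%VS by apply: (component_span rs ss dec).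
have JJ : cut J V `<=` J by apply: component_simple_sub.
(* Another component [D] exists and its roots are not in the span of [C], so [C] has fewer simple
   roots than [J]. *)
have lt : (#|` cut J V| < #|` J|)%N.
  rewrite ltnNge; apply/negP => le.
  have JE : cut J V = J by apply/eqP; rewrite eqEfcard JJ.
  have [D DD DC] : exists2 D, D \in Cs & D != C.
    apply: contrapT => H; move: Cs1; rewrite ltnNge => /negP[].
    rewrite -[X in (_ <= X)%N](cardfs1 C); apply: fsubset_leq_card; apply/fsubsetP => D DD.
    by rewrite in_fset1; apply: contraT => DC; case: H; exists D.
  have [Dn0 _] : irreducible_roots D by case: dec => _ irr _; apply: irr.
  have /fset0Pn[b bD] : D != fset0 by apply/eqP.
  have bP := component_root dec DD bD.
  have bV : b \in V.
    by rewrite VE JE; have := bP; rewrite -(cut_full rs ss) cutE => /andP[].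
  have bC : b \in C by rewrite -(mem_component rs dec CC).
  have /dot_eq0 b0 := component_orth dec DD CC DC bD bC.
  by have := root_neq0 rs bP; rewrite b0 eqxx.
have := step _ JJ lt; rewrite /= -VE.
by [].
Qed.

(** Splittings are governed by the inversions of [u^T], separability by those of [u]; [packing_tr]
    and [covering_tr] bridge the two. *)
Lemma splitting_separable_iff Phi Delta :
  root_system Phi -> simple_system Phi Delta ->
  (forall J u, J `<=` Delta -> irreducible_roots (cut Phi <<enum_fset J>>%VS) ->
    refl_group J u ->
    let Phi' := cut Phi <<enum_fset J>>%VS in
    let A := inversions (pos_roots Phi' J) u in
    packing Phi' J A ->
    exists2 a, a \in J & above Phi' J a `<=` A \/ above Phi' J a `&` A = fset0) ->
  forall u, refl_group Delta u -> let U := lower_interval Delta u in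
    splitting Delta (gen_quotient Delta U) U <-> separable Phi Delta u.
Proof.
move=> rs ss pivot u Wu U; split=> [spl|sep].
  apply: (separable_of_packing rs ss pivot Wu); rewrite -[u]trmxK.
  apply: (packing_tr rs ss (refl_group_tr Wu)).
  exact: (splitting_packing rs ss Wu spl).
have [cov pack] := separable_covering_packing sep rs ss.
apply: (packing_splitting rs ss Wu).
  exact: (covering_tr rs ss Wu cov).
exact: (packing_tr rs ss Wu pack).
Qed.

End Separable.

(** * Conflicts of a pair of vectors, in coordinates *)

(* The arguments are the values at a root of y, x, p, q, g p and g q.  The    *)
(* root is positive iff 0 < y, and a positive root lies in A iff x < 0; the   *)
(* condition is invariant under negation of the root.                         *)
Definition split_sign (R : realFieldType) (y x p q p' q' : R) : Prop :=
  (0 < y * x -> 0 < y * p /\ 0 < y * p') /\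
  (y * x < 0 -> 0 < y * q /\ 0 < y * q').

(* Roots as linear forms in the coordinates: type A on the index set S when   *)
(* b is false, type B when b is true.                                         *)
Inductive coord_root (R : realFieldType) (I : finType) (b : bool)
    (S : {set I}) : ((I -> R) -> R) -> Prop :=
| coord_root_sub k l : k \in S -> l \in S -> k != l ->
    coord_root b S (fun f => f k - f l)
| coord_root_short k : b -> k \in S -> coord_root b S (fun f => f k)
| coord_root_add k l : b -> k \in S -> l \in S -> k != l ->
    coord_root b S (fun f => f k + f l).

(** The coordinates of [M^T *m v], if [f] holds those of [v] and [M] maps the basis vector at [k] to
    [e k] times the one at [s k]. *)
Definition sperm_act (R : realFieldType) (I : finType) (s : {perm I})
    (e : I -> R) (f : I -> R) : I -> R := fun k => e k * f (s k).

Record sperm (R : realFieldType) (I : finType) (b : bool) (S : {set I})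
    (s : {perm I}) (e : I -> R) : Prop := SPerm {
  sperm_sign : forall k, e k = 1 \/ b /\ e k = -1;
  sperm_supp : forall k, k \notin S -> s k = k /\ e k = 1;
  sperm_neq1 : exists k, s k <> k \/ e k <> 1 }.

(* Translates overlap: in the notation of [split_sign], p, q and a signed     *)
(* permutation g <> 1 for which (p, q) and (g p, g q) lie in the cone.        *)
Definition conflict (R : realFieldType) (I : finType) (b : bool)
    (S : {set I}) (y x : I -> R) : Prop :=
  exists s e p q, sperm b S s e /\
    forall g, coord_root b S g ->
      split_sign (g y) (g x) (g p) (g q)
        (g (sperm_act s e p)) (g (sperm_act s e q)).

Section Conflict.
Variables (R : realFieldType) (I : finType).
Implicit Types (b : bool) (S : {set I}) (x y p q e : I -> R) (s : {perm I}).

Lemma coord_rootN b S g : coord_root b S g ->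
  forall f : I -> R, g (\- f) = - g f.
Proof. by case=> *; rewrite /=; ring. Qed.

Lemma coord_root_ext b S g : coord_root b S g ->
  forall f f' : I -> R, f =1 f' -> g f = g f'.
Proof.
by case=> [k l _ _ _|k _ _|k l _ _ _ _] f f' ff'; rewrite !ff'.
Qed.

Lemma sperm_actN s e f : sperm_act s e (\- f) =1 \- sperm_act s e f.
Proof. by move=> k; rewrite /sperm_act /= mulrN. Qed.

Lemma same_sign_trans (a c d : R) : 0 < a * c -> 0 < a * d -> 0 < c * d.
Proof.
move=> ac ad; have: 0 < (a * c) * (a * d) by rewrite mulr_gt0.
rewrite mulrACA pmulr_rgt0 // -expr2 lt_neqAle sqr_ge0 eq_sym sqrf_eq0 andbT.
by apply: contraTneq ac => ->; rewrite mul0r ltxx.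
Qed.

(** The coordinate form of passing from u to its inverse. Where x and y have equal signs nothing
    changes; where they differ, the sign of [q] has to change. This makes coordinates that are
    extreme for x removable like those extreme for y. *)
Lemma conflict_swap b S x y : conflict b S x y -> conflict b S y x.
Proof.
move=> [s [e [p [q [se H]]]]]; exists s, e, p, (\- q); split=> // g rg.
case: (H g rg) => H1 H2.
rewrite /split_sign (coord_root_ext rg (sperm_actN s e q)) !(coord_rootN rg).
rewrite mulrC.
split.
  by move=> /[dup] xy /H1[h1 h2]; split; apply: same_sign_trans xy _.
move=> /[dup] xy /H2[h1 h2].
have xy' : 0 < g x * - g y by rewrite mulrN oppr_gt0.
by split; rewrite mulrN -mulNr; apply: same_sign_trans xy' _.
Qed.

(** Negating x exchanges the inversion set with its complement, hence p with q. *)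
Lemma conflict_compl b S y x : conflict b S y (\- x) -> conflict b S y x.
Proof.
move=> [s [e [p [q [se H]]]]]; exists s, e, q, p; split=> // g rg.
case: (H g rg); rewrite (coord_rootN rg) mulrN oppr_gt0 oppr_lt0 => H1 H2.
by split.
Qed.

Lemma coord_root_act b S s e g :
  (forall k, e k = 1 \/ b /\ e k = -1) -> {in S, forall k, s k \in S} ->
  coord_root b S g -> exists2 g', coord_root b S g' &
    exists2 a, a = 1 \/ a = -1 & forall f : I -> R, g (sperm_act s e f) = a * g' f.
Proof.
move=> e1 sS.
have e_or k : e k = 1 \/ e k = -1 by case: (e1 k) => [|[]]; auto.
have eeE k l : e l = e k \/ b /\ e l = - e k.
  by case: (e1 k) => [->|[? ->]]; case: (e1 l) => [->|[? ->]]; rewrite ?opprK; auto.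
case=> [k l kS lS kl|k bT kS|k l bT kS lS kl].
- have skl : s k != s l by apply: contra kl => /eqP/perm_inj->.
  case: (eeE k l) => [E|[bT E]].
    exists (fun f => f (s k) - f (s l)); first by apply: coord_root_sub; rewrite ?sS.
    by exists (e k) => // f; rewrite /sperm_act E -mulrBr.
  exists (fun f => f (s k) + f (s l)); first by apply: coord_root_add; rewrite ?sS.
  by exists (e k) => // f; rewrite /sperm_act E mulNr opprK -mulrDr.
- exists (fun f => f (s k)); first by apply: coord_root_short; rewrite ?sS.
  by exists (e k).
- have skl : s k != s l by apply: contra kl => /eqP/perm_inj->.
  case: (eeE k l) => [E|[_ E]].
    exists (fun f => f (s k) + f (s l)); first by apply: coord_root_add; rewrite ?sS.
    by exists (e k) => // f; rewrite /sperm_act E -mulrDr.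
  exists (fun f => f (s k) - f (s l)); first by apply: coord_root_sub; rewrite ?sS.
  by exists (e k) => // f; rewrite /sperm_act E mulNr -mulrBr.
Qed.

(* Coordinate sign changes are Weyl group elements in type B. *)
Lemma conflict_flip S (c : I -> R) y x :
  (forall k, c k = 1 \/ c k = -1) ->
  conflict true S (fun k => c k * y k) (fun k => c k * x k) ->
  conflict true S y x.
Proof.
move=> c1 [s [e [p [q [[e1 se sn] H]]]]].
have cc k : c k * c k = 1 by case: (c1 k) => ->; ring.
(* The signs of the conjugate of (s, e) by the diagonal sign change [c]. *)
pose e' k := c k * c (s k) * e k.
have actE f : sperm_act s e' (fun k => c k * f k) =1
              (fun k => c k * sperm_act s e f k).
  move=> k; rewrite /sperm_act /e'.
  by transitivity (c (s k) * c (s k) * (c k * (e k * f (s k)))); [ring|rewrite cc mul1r].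
exists s, e', (fun k => c k * p k), (fun k => c k * q k); split.
  split.
  - move=> k; rewrite /e'.
    by case: (c1 k) => ->; case: (c1 (s k)) => ->; case: (e1 k) => [->|[_ ->]];
      (left; ring) || (right; split=> //; ring).
  - by move=> k /se [sk ek]; rewrite /e' sk ek cc mulr1.
  - case: sn => k sn; exists k; have [sk|/eqP] := eqVneq (s k) k; last by left.
    by right; rewrite /e' sk cc mul1r; case: sn.
have tr g : coord_root true S g -> exists2 g', coord_root true S g' &
    exists2 a, a * a = 1 & forall f : I -> R, g f = a * g' (fun k => c k * f k).
  move=> rg; have ce k : c k = 1 \/ true /\ c k = -1 by case: (c1 k); auto.
  have [|g' rg' [a aa gE]] := coord_root_act (s := 1%g) ce _ rg; first by move=> k; rewrite perm1.
  exists g' => //; exists a => [|f]; first by case: aa => ->; ring.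
  by rewrite -gE; apply: (coord_root_ext rg) => k; rewrite /sperm_act perm1 mulrA cc mul1r.
move=> g rg; have [g' rg' [a aa gE]] := tr g rg.
have := H g' rg'; rewrite /split_sign !gE.
have mE u v : a * u * (a * v) = u * v by rewrite mulrACA aa mul1r.
rewrite !mE.
have simp f : g' (fun k => c k * (c k * f k)) = g' f.
  by apply: (coord_root_ext rg') => k; rewrite mulrA cc mul1r.
have simp2 f : g' (fun k => c k * sperm_act s e' (fun k => c k * f k) k) =
    g' (sperm_act s e f).
  by apply: (coord_root_ext rg') => k; rewrite actE mulrA cc mul1r.
by rewrite !simp !simp2.
Qed.

Lemma sperm_subset b S S' s e : S \subset S' -> sperm b S s e -> sperm b S' s e.
Proof.
move=> sub [h1 h2 h3]; split=> // k kS; apply: h2.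
by apply: contra kS; apply: (fintype.subsetP sub).
Qed.

(* A coordinate dominating all others in y takes a huge value in p and q. *)
Lemma conflict_extend b S y x k (c : R) :
  k \in S -> c = 1 \/ c = -1 ->
  (forall m, m \in S -> m != k -> 0 < c * (y k - y m)) ->
  (b -> 0 < c * y k /\
    forall m, m \in S -> m != k -> 0 < c * (y k + y m)) ->
  conflict b (S :\ k) y x -> conflict b S y x.
Proof.
move=> kS c1 ym yb [s [e [p [q [se H]]]]].
have cc : c * c = 1 by case: c1 => ->; ring.
(* [N] exceeds the absolute values of all entries of p and q, and so those of their translates. As
   (s, e) fixes [k], the entry [c * N] decides the sign of every form involving [k], before and
   after the translation. *)
pose N : R := 1 + \sum_m `|p m| + \sum_m `|q m|.
have leN f m : f = p \/ f = q -> `|f m| < N.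
  have h (f' : I -> R) : `|f' m| <= \sum_m `|f' m|.
    by rewrite (bigD1 m) //= lerDl sumr_ge0.
  have h0 (f' : I -> R) : 0 <= \sum_m `|f' m| by rewrite sumr_ge0.
  have [[hp hq] [p0 q0]] := ((h p, h q), (h0 p, h0 q)).
  by rewrite /N => -[] ->; lra.
have se' := sperm_subset (subsetDl S [set k]) se.
have [sk ek] : s k = k /\ e k = 1.
  by apply: (sperm_supp se); rewrite !inE eqxx.
pose big f m := if m == k then c * N else f m : R.
have bigk f : big f k = c * N by rewrite /big eqxx.
have bigm f m : m != k -> big f m = f m by rewrite /big => /negPf ->.
have actk f : sperm_act s e (big f) k = c * N.
  by rewrite /sperm_act sk ek bigk mul1r.
have actm f m : m != k -> sperm_act s e (big f) m = sperm_act s e f m.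
  move=> mk; rewrite /sperm_act bigm //.
  by apply: contra mk => /eqP smk; apply/eqP/(@perm_inj _ s); rewrite smk.
have e1 m : `|e m| = 1.
  by case: (sperm_sign se m) => [->|[_ ->]]; rewrite ?normrN normr1.
have actle f m : f = p \/ f = q -> `|sperm_act s e f m| < N.
  by move=> fpq; rewrite /sperm_act normrM e1 mul1r leN.
exists s, e, (big p), (big q); split=> // g rg.
have key u (v w : R) : 0 < c * u -> v = c * N + w \/ v = c * N - w ->
    `|w| < N -> 0 < u * v.
  move=> cu vE wN; have cv : 0 < c * v.
    have : c * v = N + c * w \/ c * v = N - c * w.
      by case: vE => ->; [left; rewrite mulrDr|right; rewrite mulrBr]; rewrite mulrA cc mul1r.
    have : `|c * w| < N.
      by rewrite normrM; case: c1 => ->; rewrite ?normrN normr1 mul1r.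
    by rewrite ltr_norml => /andP[? ?] [] ->; lra.
  exact: same_sign_trans cu cv.
have key' (u v w : R) : 0 < c * u -> v = c * N + w \/ v = c * N - w ->
    `|w| < N -> 0 < - u * - v.
  by rewrite mulrNN; apply: key.
case: rg => [m l mS lS ml|m bT mS|m l bT mS lS ml].
- have [mk|mk] := eqVneq m k.
    have lk : l != k by rewrite -mk eq_sym.
    rewrite mk; have yl := ym l lS lk.
    by split=> _; split; apply: (key _ _ _ yl);
      rewrite ?actk ?bigk ?(actm _ _ lk) ?(bigm _ _ lk); eauto.
  have [lk|lk] := eqVneq l k.
    rewrite lk; have yl := ym m mS mk.
    by split=> _; split; rewrite -[y m - y k]opprB -[X in _ * X]opprB;
      apply: (key' _ _ _ yl);
      rewrite ?actk ?bigk ?(actm _ _ mk) ?(bigm _ _ mk); eauto.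
  rewrite !actm // !bigm //.
  by apply: (H (fun f => f m - f l)); apply: coord_root_sub; rewrite ?inE ?mk ?lk.
- have [y0 _] := yb bT; have [mk|mk] := eqVneq m k.
    have N0 : `|0 : R| < N by apply: le_lt_trans (leN p m _); rewrite ?normr0; auto.
    by rewrite mk; split=> _; split; apply: (key _ _ 0 y0);
      rewrite ?actk ?bigk ?addr0; auto.
  rewrite !actm // !bigm //.
  by apply: (H (fun f => f m)); apply: coord_root_short; rewrite ?inE ?mk.
- have [_ yp] := yb bT; have [mk|mk] := eqVneq m k.
    have lk : l != k by rewrite -mk eq_sym.
    rewrite mk; have yl := yp l lS lk.
    by split=> _; split; apply: (key _ _ _ yl);
      rewrite ?actk ?bigk ?(actm _ _ lk) ?(bigm _ _ lk); eauto.
  have [lk|lk] := eqVneq l k.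
    rewrite lk; have yl := yp m mS mk.
    by split=> _; split; rewrite [y m + y k]addrC; apply: (key _ _ _ yl);
      rewrite ?actk ?bigk ?(actm _ _ mk) ?(bigm _ _ mk) ?[_ + c * N]addrC; eauto.
  rewrite !actm // !bigm //.
  by apply: (H (fun f => f m + f l)); apply: coord_root_add; rewrite ?inE ?mk ?lk.
Qed.

End Conflict.

Section Shift.
Variables (R : realFieldType) (I : finType).
Implicit Types (b : bool) (S : {set I}) (x y p q e : I -> R) (s : {perm I}).

(* The witness moves, in the order of decreasing y, the entry at j to the     *)
(* front and changes its sign, for the last j with x j > - x i.               *)
Lemma conflict_shift S y x i j0 :
  {in S, forall k, 0 < y k} -> {in S &, injective y} ->
  i \in S -> {in S, forall k, k != i -> y k < y i} ->
  x i < 0 -> {in S, forall k, k != i -> x i < x k} ->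
  j0 \in S -> - x i < x j0 -> conflict true S y x.
Proof.
move=> y0 yinj iS yi xi0 xi j0S xj0.
have [j /andP[jS xj] jmin] : exists2 j, (j \in S) && (- x i < x j) &
    forall l, l \in S -> - x i < x l -> y j <= y l.
  have P0 : (j0 \in S) && (- x i < x j0) by rewrite j0S.
  case: (@arg_minP _ _ _ j0 (fun j => (j \in S) && (- x i < x j)) y P0).
  by move=> j Pj jmin; exists j => // l lS xl; apply: jmin; rewrite lS.
have ji : j != i by apply: contraTneq xj => ->; rewrite -leNgt; lra.
(* [pred k] immediately precedes [k] in the order of decreasing y, and [T] below consists of the
   indices after [i] up to [j]. So [t] is the cycle sending [i] to [j] and every index of [T] one
   step forward. *)
pose pred k := [arg min_(l < i | (l \in S) && (y k < y l)) y l]%O.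
have predP k : k \in S -> k != i -> [/\ pred k \in S, y k < y (pred k) &
    forall l, l \in S -> y k < y l -> y (pred k) <= y l].
  move=> kS ki; rewrite /pred; case: arg_minP; first by rewrite iS yi.
  by move=> m /andP[mS km] H; split=> // l lS kl; apply: H; rewrite lS.
pose T k := [&& k \in S, y j <= y k & k != i].
pose t k := if k == i then j else if T k then pred k else k.
have ti : t i = j by rewrite /t eqxx.
have tT k : T k -> t k = pred k by rewrite /t => /[dup]/and3P[_ _ /negPf->] ->.
have tN k : k != i -> ~~ T k -> t k = k by rewrite /t => /negPf-> /negPf->.
have Tj : T j by rewrite /T jS lexx.
have Tpred k : T k -> pred k \in S /\ y j < y (pred k).
  by case/and3P=> kS jk ki; have [? ? _] := predP k kS ki; split=> //; lra.
have t_inj : injective t.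
  have tiN k : k != i -> t k != j.
    move=> ki; have [Tk|Tk] := boolP (T k).
      rewrite tT //; apply: contraTneq (Tpred k Tk).2 => ->.
      by rewrite ltxx.
    by rewrite tN //; apply: contraNneq Tk => ->.
  have tTN k l : T k -> l != i -> ~~ T l -> t k != t l.
    move=> Tk li Tl; rewrite tT // (tN l) //; have [pS jp] := Tpred k Tk.
    apply: contra Tl => /eqP pl; rewrite pl in pS jp.
    by rewrite /T pS (ltW jp).
  have mono k l : T k -> T l -> y k < y l -> t k != t l.
    move=> Tk Tl kl; rewrite !tT //.
    have /and3P[kS _ ki] := Tk; have /and3P[lS _ li] := Tl.
    have [_ _ kmin] := predP k kS ki; have [_ lp _] := predP l lS li.
    by apply: contraTneq (kmin l lS kl) => ->; rewrite -ltNge.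
  move=> k l; have [->|ki] := eqVneq k i.
    have [->//|li /eqP] := eqVneq l i.
    by rewrite ti eq_sym (negPf (tiN l li)).
  have [->|li] := eqVneq l i; first by rewrite ti => /eqP; rewrite (negPf (tiN k ki)).
  have [Tk|Tk] := boolP (T k); have [Tl|Tl] := boolP (T l).
  - case: (ltgtP (y k) (y l)) => [kl|lk|kl _].
    + by move/eqP; rewrite (negPf (mono k l _ _ _)).
    + by move/eqP; rewrite eq_sym (negPf (mono l k _ _ _)).
    + have /and3P[kS _ _] := Tk; have /and3P[lS _ _] := Tl.
      exact: yinj.
  - by move/eqP; rewrite (negPf (tTN k l _ _ _)).
  - by move/eqP; rewrite eq_sym (negPf (tTN l k _ _ _)).
  - by rewrite !tN.
pose s := perm t_inj.
have sE k : s k = t k by rewrite permE.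
pose e k : R := if k == i then -1 else 1.
have ei : e i = -1 by rewrite /e eqxx.
have eN k : k != i -> e k = 1 by rewrite /e => /negPf->.
have monos k l : k \in S -> l \in S -> k != i -> l != i -> y k < y l ->
    y (s k) < y (s l).
  move=> kS lS ki li kl; rewrite !sE.
  have [Tk|Tk] := boolP (T k); have [Tl|Tl] := boolP (T l).
  - rewrite !tT //; have [_ _ kmin] := predP k kS ki.
    have [_ lp _] := predP l lS li; exact: le_lt_trans (kmin l lS kl) lp.
  - by case/negP: Tl; rewrite /T lS li (le_trans _ (ltW kl)) //; case/and3P: Tk.
  - rewrite (tN k) // tT //; have [_ lp _] := predP l lS li.
    exact: lt_trans kl lp.
  - by rewrite !tN.
have sS k : k \in S -> s k \in S.
  move=> kS; rewrite sE; have [->|ki] := eqVneq k i; first by rewrite ti.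
  have [Tk|Tk] := boolP (T k); last by rewrite tN.
  by rewrite tT //; case: (Tpred k Tk).
have si : s i = j by rewrite sE.
(* Chosen so that the translate of [q] is y. *)
pose q m := e ((s^-1)%g m) * y ((s^-1)%g m).
have actq k : sperm_act s e q k = y k.
  rewrite /sperm_act /q permK mulrA.
  by have [->|ki] := eqVneq k i; rewrite ?ei ?(eN k ki); ring.
have actp k : k != i -> sperm_act s e y k = y (s k).
  by move=> ki; rewrite /sperm_act eN // mul1r.
have actpi : sperm_act s e y i = - y j by rewrite /sperm_act ei si mulN1r.
have qj : q j = - y i by rewrite /q -si permK ei mulN1r.
have s_surj m : m \in S -> m != j -> exists k, [/\ k \in S, k != i & m = s k].
  move=> mS mj; exists ((s^-1)%g m); rewrite permKV; split=> //.
    have [//|kS] := boolP ((s^-1)%g m \in S).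
    have ki : (s^-1)%g m != i by apply: contraNneq kS => ->.
    have := permKV s m; rewrite sE tN //; last by rewrite /T (negPf kS).
    by move=> E; rewrite E in kS; rewrite mS in kS.
  by apply: contraNneq mj => E; rewrite -si -E permKV.
have qs k : k != i -> q (s k) = y k by move=> ki; rewrite /q permK eN // mul1r.
have q0 m : m \in S -> m != j -> 0 < q m.
  by move=> mS mj; have [k [kS ki ->]] := s_surj m mS mj; rewrite qs ?y0.
have qmono m l : m \in S -> l \in S -> m != j -> l != j -> y m < y l -> q m < q l.
  move=> mS lS mj lj; have [k [kS ki ->]] := s_surj m mS mj.
  have [k' [k'S k'i ->]] := s_surj l lS lj; rewrite !qs // => skk'.
  rewrite ltNge; apply: contraL skk' => k'k; rewrite -leNgt.
  have [->//|kk'] := eqVneq k k'.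
  apply/ltW/monos => //; rewrite lt_neqAle k'k andbT.
  by apply: contra kk' => /eqP /yinj -> //.
have pj k : k \in S -> k != i -> 0 < sperm_act s e y k.
  by move=> kS ki; rewrite actp // y0 // sS.
(* The translate of p = y is negative only at [i]. There a positive sum with [x l] requires [x l] to
   exceed [- x i], so [l] is in [T] and has been moved forward past [j]. Likewise [q] is negative
   only at [j], where the bounds on x settle both signs. *)
have main k l (t' : R) : k \in S -> l \in S -> y l < y k -> t' = 1 \/ t' = -1 ->
  (0 < x k + t' * x l -> 0 < sperm_act s e y k + t' * sperm_act s e y l) /\
  (x k + t' * x l < 0 -> 0 < q k + t' * q l).
  move=> kS lS lk t1.
  have li : l != i.
    apply: contraTneq lk => ->; rewrite -leNgt; have [->//|ki] := eqVneq k i.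
    exact/ltW/yi.
  split=> xkl.
    have [ki|ki] := eqVneq k i.
      rewrite ki actpi actp // in xkl *; have xil := xi l lS li.
      case: t1 => tE; rewrite tE in xkl *; last by lra.
      have jl : y j <= y l by apply: jmin => //; lra.
      have Tl : T l by rewrite /T lS jl li.
      by have := (Tpred l Tl).2; rewrite sE tT //; lra.
    have := monos l k lS kS li ki lk; have := pj l lS li; have := pj k kS ki.
    by rewrite !actp //; case: t1 => ->; lra.
  have [kj|kj] := eqVneq k j.
    rewrite kj in xkl lk *.
    have : x l <= - x i.
      by rewrite leNgt; apply: contraTN lk => /(jmin l lS); rewrite leNgt.
    by have := xi l lS li; case: t1 => tE; rewrite tE in xkl *; lra.
  have qk := q0 k kS kj; have [lj|lj] := eqVneq l j.
    rewrite lj qj in xkl *; have yi0 := y0 i iS.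
    have xik : x i <= x k by have [->|ki] := eqVneq k i; rewrite ?lexx // ltW ?xi.
    by case: t1 => tE; rewrite tE in xkl *; lra.
  have := q0 l lS lj; have := qmono l k lS kS lj kj lk.
  by case: t1 => ->; lra.
have ypos k l (t' : R) : k \in S -> l \in S -> y l < y k -> t' = 1 \/ t' = -1 ->
    0 < y k + t' * y l.
  by move=> kS lS lk; have := y0 k kS; have := y0 l lS => ? ? [] ->; lra.
have pair k l (t' : R) : k \in S -> l \in S -> y l < y k -> t' = 1 \/ t' = -1 ->
  split_sign (y k + t' * y l) (x k + t' * x l) (y k + t' * y l) (q k + t' * q l)
    (sperm_act s e y k + t' * sperm_act s e y l)
    (sperm_act s e q k + t' * sperm_act s e q l).
  move=> kS lS lk t1; have [h1 h2] := main k l t' kS lS lk t1.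
  have yy := ypos k l t' kS lS lk t1.
  by rewrite !actq; split; rewrite ?(pmulr_rlt0 _ yy) !(pmulr_rgt0 _ yy); auto.
have opp (a c d f g h : R) : split_sign a c d f g h ->
    split_sign (- a) (- c) (- d) (- f) (- g) (- h).
  by rewrite /split_sign !mulrNN.
exists s, e, y, q; split.
  split.
  - by move=> k; rewrite /e; case: ifP; auto.
  - move=> k kS; have ki : k != i by apply: contraNneq kS => ->.
    by rewrite sE tN ?eN //; rewrite /T (negPf kS).
  - by exists i; left; rewrite si; apply/eqP.
move=> g [k l kS lS kl|k _ kS|k l _ kS lS kl].
- case: (ltgtP (y k) (y l)) => [lk|lk|E].
  + have := opp _ _ _ _ _ _ (pair l k (-1) lS kS lk (or_intror erefl)).
    by rewrite !mulN1r !opprB.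
  + by have := pair k l (-1) kS lS lk (or_intror erefl); rewrite !mulN1r.
  + by rewrite (yinj _ _ kS lS E) eqxx in kl.
- rewrite actq; have yk := y0 k kS; split; rewrite ?(pmulr_rlt0 _ yk) !(pmulr_rgt0 _ yk).
    move=> xk; split=> //; apply: pj => //; apply: contraTneq xk => ->.
    by rewrite -leNgt ltW.
  move=> xk; split=> //; apply: q0 => //; apply: contraTneq xk => ->.
  by rewrite -leNgt; lra.
- case: (ltgtP (y k) (y l)) => [lk|lk|E].
  + have := pair l k 1 lS kS lk (or_introl erefl).
    by rewrite !mul1r (addrC (y l)) (addrC (x l)) (addrC (q l))
      (addrC (sperm_act s e y l)) (addrC (sperm_act s e q l)).
  + by have := pair k l 1 kS lS lk (or_introl erefl); rewrite !mul1r.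
  + by rewrite (yinj _ _ kS lS E) eqxx in kl.
Qed.

End Shift.

(** * Bad pairs and pivots in type B *)

Section TypeB.
Variables (R : realFieldType) (I : finType).
Implicit Types (S : {set I}) (x y : I -> R).

(** Two entries of x of opposite signs with increasing absolute values, once y is made positive. The
    products keep the notion invariant under common sign changes of x and y and under exchanging (y,
    i) with (x, j). *)
Definition bad_pair y x (i j : I) : bool :=
  [&& `|y j| < `|y i|, `|x i| < `|x j| & (y i * x i) * (y j * x j) < 0].

Lemma set_argmax S y k0 : {in S &, injective y} -> k0 \in S ->
  exists2 f, f \in S & {in S, forall k, k != f -> y k < y f}.
Proof.
move=> yinj k0S; case: (@arg_maxP _ _ _ k0 [in S] y k0S) => f fS fmax.
exists f => // k kS kf; rewrite lt_neqAle; have := fmax k kS; rewrite andbC.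
by move=> /= ->; apply: contra kf => /eqP/yinj->.
Qed.

(** If [x f] is the least entry of x, [conflict_shift] applies directly. Otherwise it applies after
    x and y have exchanged roles, and uniqueness of the bad pair provides its extremality
    hypothesis. *)
Lemma conflict_lone_bad_pair S y x f m :
  {in S, forall k, 0 < y k} -> {in S &, injective y} ->
  {in S, forall k, x k != 0} -> {in S &, injective (fun k => `|x k|)} ->
  f \in S -> m \in S -> f != m ->
  {in S, forall k, k != f -> y k < y f} ->
  {in S, forall k, k != m -> `|x k| < `|x m|} ->
  x f < 0 -> 0 < x m ->
  {in S &, forall i j, y j < y i -> `|x i| < `|x j| -> x i * x j < 0 ->
    i = f /\ j = m} ->
  conflict true S y x.
Proof.
move=> y0 yinj x0 xinj fS mS fm yf xm xf0 xm0 lone.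
have xinj' : {in S &, injective x} by move=> k l kS lS E; apply: xinj; rewrite //= E.
have [/forallP fmin|] := boolP [forall k, (k \in S) && (k != f) ==> (x f < x k)].
  apply: (@conflict_shift _ _ _ _ _ f m) => //.
    by move=> k kS kf; have := fmin k; rewrite kS kf.
  by have := xm f fS fm; rewrite ltr0_norm // gtr0_norm.
rewrite negb_forall => /existsP[k]; rewrite negb_imply -leNgt => /andP[/andP[kS kf]].
rewrite le_eqVlt; case/orP=> [/eqP/xinj'-/(_ kS fS) E|xkf].
  by rewrite E eqxx in kf.
have km : k != m by apply: contraTneq xkf => ->; rewrite -leNgt; lra.
have xk0 : x k < 0 by lra.
have ykm : y k < y m.
  case: (ltgtP (y k) (y m)) => // [mk|/yinj-/(_ kS mS) E]; last by rewrite E eqxx in km.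
  have [||E _] := lone k m kS mS mk; last by rewrite E eqxx in kf.
    exact: xm.
  by rewrite nmulr_rlt0.
(* The signs [c] make x positive. After [conflict_compl], [m] takes the part of [i] and [f] that of
   [j0] in [conflict_shift]. *)
pose c l : R := if x l < 0 then -1 else 1.
apply/conflict_swap/(@conflict_flip _ _ _ c).
  by move=> l; rewrite /c; case: ifP; auto.
have cx l : c l * x l = `|x l|.
  rewrite /c; case: (ltP (x l) 0) => xl /=; first by rewrite mulN1r ltr0_norm.
  by rewrite mul1r ger0_norm.
apply: conflict_compl; apply: (@conflict_shift _ _ _ _ _ m f) => //=.
- by move=> l lS; rewrite cx normr_gt0 x0.
- by move=> l l' lS l'S; rewrite !cx; apply: xinj.
- by move=> l lS lm; rewrite !cx xm.
- by rewrite /c [x m < 0]ltNge ltW //= mul1r oppr_lt0 y0.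
- move=> l lS lm; rewrite /c [x m < 0]ltNge ltW //= mul1r.
  have [xl|xl] := ltP (x l) 0.
    by rewrite mulN1r opprK; have := y0 l lS; have := y0 m mS; lra.
  rewrite mul1r ltrN2.
  case: (ltgtP (y l) (y m)) => // [ml|/yinj-/(_ lS mS) E]; last by rewrite E eqxx in lm.
  have xl0 : 0 < x l by rewrite lt_neqAle eq_sym x0.
  have lf : l != f by apply: contraTneq xl0 => ->; rewrite -leNgt ltW.
  (* A positive entry [x l] with [l] before [m] would create a second bad pair: (l, k) if |x l| < |x
     k|, and (f, l) otherwise. *)
  have [lx|xl'] := ltP `|x l| `|x k|.
    have [|E _] := lone l k lS kS (lt_trans ykm ml) lx; last by rewrite E eqxx in lf.
    by rewrite pmulr_rlt0.
  have [||_ E] := lone f l fS lS (yf l lS lf); last by rewrite E eqxx in lm.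
    by rewrite (lt_le_trans _ xl') // !ltr0_norm // ltrN2.
  by rewrite nmulr_rlt0.
- have := yf m mS _; rewrite eq_sym fm => /(_ isT) ymf.
  by rewrite /c [x m < 0]ltNge (ltW xm0) xf0 /= !mul1r !mulN1r !opprK.
Qed.

(** A coordinate of largest |y| or largest |x| is removable by [conflict_extend] as long as some bad
    pair avoids it. In a minimal set every bad pair therefore contains both coordinates, which
    leaves [conflict_lone_bad_pair]. *)
Lemma conflict_bad_pair S y x i j :
  {in S, forall k, y k != 0} -> {in S &, injective (fun k => `|y k|)} ->
  {in S, forall k, x k != 0} -> {in S &, injective (fun k => `|x k|)} ->
  i \in S -> j \in S -> bad_pair y x i j -> conflict true S y x.
Proof.
have [n] := ubnP #|S|; elim: n => // n IH in S y x i j *.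
move=> cardS y0 yinj x0 xinj iS jS bad_ij.
have [f fS yf] := set_argmax yinj iS; have [m mS xm] := set_argmax xinj iS.
have sub k l : l \in S :\ k -> l \in S by case/setD1P.
have smaller k : k \in S -> (#|S :\ k| < n)%N.
  by move=> kS; move: cardS; rewrite (cardsD1 k) kS add1n ltnS.
have sgn_dom (z : I -> R) k : k \in S -> z k != 0 ->
    {in S, forall l, l != k -> `|z l| < `|z k|} ->
    exists2 c : R, c = 1 \/ c = -1 & 0 < c * z k /\
      forall l, l \in S -> l != k -> 0 < c * (z k - z l) /\ 0 < c * (z k + z l).
  move=> kS zk0 dom; case: (ltgtP (z k) 0) zk0 => // zk _.
    exists (-1); first by right.
    split=> [|l lS lk]; first by lra.
    by have := dom l lS lk; rewrite (ltr0_norm zk) ltr_norml => /andP[] *; lra.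
  exists 1; first by left.
  split=> [|l lS lk]; first by lra.
  by have := dom l lS lk; rewrite (gtr0_norm zk) ltr_norml => /andP[] *; lra.
have ext (z z' : I -> R) k : k \in S -> z k != 0 ->
    {in S, forall l, l != k -> `|z l| < `|z k|} ->
    conflict true (S :\ k) z z' -> conflict true S z z'.
  move=> kS zk0 dom; have [c c1 [ck cl]] := sgn_dom z k kS zk0 dom.
  apply: (conflict_extend kS c1); first by move=> l lS lk; case: (cl l lS lk).
  by move=> _; split=> // l lS lk; case: (cl l lS lk).
have IHk k i' j' : k \in S -> i' \in S :\ k -> j' \in S :\ k ->
    bad_pair y x i' j' -> conflict true (S :\ k) y x.
  move=> kS i'S j'S; apply: IH => //; first exact: smaller.
  - by move=> l /sub; apply: y0.
  - by move=> l l' /sub lS /sub; apply: yinj.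
  - by move=> l /sub; apply: x0.
  - by move=> l l' /sub lS /sub; apply: xinj.
have [/existsP[i1 /existsP[j1 /and3P[i1S j1S bad1]]]|/existsPn nof] :=
    boolP [exists i1, exists j1, [&& i1 \in S :\ f, j1 \in S :\ f & bad_pair y x i1 j1]].
  by apply: (ext _ _ f) => //; [apply: y0|apply: IHk bad1].
have [/existsP[i1 /existsP[j1 /and3P[i1S j1S bad1]]]|/existsPn nom] :=
    boolP [exists i1, exists j1, [&& i1 \in S :\ m, j1 \in S :\ m & bad_pair y x i1 j1]].
  apply: conflict_swap; apply: (ext _ _ m) => //; first exact: x0.
  by apply: conflict_swap; apply: IHk bad1.
(* Being extreme, [f] cannot be second and [m] cannot be first in a bad pair, so a pair containing
   both is (f, m). *)
have lone i1 j1 : i1 \in S -> j1 \in S -> bad_pair y x i1 j1 -> i1 = f /\ j1 = m.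
  move=> i1S j1S bad1; have /and3P[y1 x1 _] := bad1.
  have j1f : j1 != f.
    apply: contraTneq y1 => ->; rewrite -leNgt; have [->//|h] := eqVneq i1 f.
    exact/ltW/yf.
  have i1m : i1 != m.
    apply: contraTneq x1 => ->; rewrite -leNgt; have [->//|h] := eqVneq j1 m.
    exact/ltW/xm.
  split; apply/eqP.
    move: (nof i1) => /existsPn/(_ j1); rewrite !inE j1f i1S j1S bad1 !andbT.
    by rewrite negbK.
  move: (nom i1) => /existsPn/(_ j1); rewrite !inE i1m i1S j1S bad1 !andbT.
  by rewrite negbK.
have [fE mE] := lone i j iS jS bad_ij; rewrite fE mE in bad_ij.
(* Normal form: the signs [c] make y positive, and [conflict_compl] makes the entry of x at [f]
   negative. *)
pose c k : R := if y k < 0 then -1 else 1.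
have c1 k : c k = 1 \/ c k = -1 by rewrite /c; case: ifP; auto.
apply: (@conflict_flip _ _ _ c) => //.
have cy k : c k * y k = `|y k|.
  rewrite /c; case: (ltP (y k) 0) => yk /=; first by rewrite mulN1r ltr0_norm.
  by rewrite mul1r ger0_norm.
have nc k : `|c k| = 1 by case: (c1 k) => ->; rewrite ?normrN normr1.
have cc k : c k * c k = 1 by case: (c1 k) => ->; ring.
have cxx k l : (c k * x k) * (c l * x l) < 0 -> k \in S -> l \in S ->
    (y k * x k) * (y l * x l) < 0.
  move=> h kS lS; have -> : y k * x k * (y l * x l) =
      `|y k| * `|y l| * (c k * x k * (c l * x l)).
    by rewrite -!cy -[LHS]mul1r -[1 in LHS](cc k) -[LHS]mul1r -[1 in LHS](cc l); ring.
  by rewrite pmulr_rlt0 // mulr_gt0 // normr_gt0 y0.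
have fm : f != m by apply: contraTneq bad_ij => ->; rewrite /bad_pair ltxx.
have nx k : `|c k * x k| = `|x k| by rewrite normrM nc mul1r.
have xf0 : c f * x f != 0 by rewrite -normr_eq0 nx normr_eq0 x0.
have opp_signs : (c f * x f) * (c m * x m) < 0.
  have /and3P[_ _] := bad_ij.
  have -> : y f * x f * (y m * x m) = `|y f| * `|y m| * (c f * x f * (c m * x m)).
    by rewrite -!cy -[LHS]mul1r -[1 in LHS](cc f) -[LHS]mul1r -[1 in LHS](cc m); ring.
  by rewrite pmulr_rlt0 // mulr_gt0 // normr_gt0 y0.
have lone' k l : k \in S -> l \in S -> c l * y l < c k * y k ->
    `|x k| < `|x l| -> (c k * x k) * (c l * x l) < 0 -> k = f /\ l = m.
  move=> kS lS; rewrite !cy => ykl xkl h; apply: lone => //.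
  by apply/and3P; split=> //; apply: cxx.
have yN0 : {in S, forall k, 0 < c k * y k} by move=> k kS; rewrite cy normr_gt0 y0.
have yinj' : {in S &, injective (fun k => c k * y k)}.
  by move=> k l kS lS; rewrite /= !cy; apply: yinj.
have yf' : {in S, forall k, k != f -> c k * y k < c f * y f}.
  by move=> k kS kf; rewrite !cy yf.
case: (ltgtP (c f * x f) 0) xf0 => // xf _.
  apply: (@conflict_lone_bad_pair _ _ _ f m) => //.
  - by move=> k kS; rewrite -normr_eq0 nx normr_eq0 x0.
  - by move=> k l kS lS; rewrite !nx; apply: xinj.
  - by move=> k kS km; rewrite !nx xm.
  - by rewrite nmulr_rlt0 in opp_signs.
  - by move=> k l kS lS; rewrite !nx; apply: lone'.
apply: conflict_compl; apply: (@conflict_lone_bad_pair _ _ _ f m) => //=.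
- by move=> k kS; rewrite oppr_eq0 -normr_eq0 nx normr_eq0 x0.
- by move=> k l kS lS; rewrite !normrN !nx; apply: xinj.
- by move=> k kS km; rewrite !normrN !nx xm.
- by rewrite oppr_lt0.
- by rewrite oppr_gt0; rewrite pmulr_rlt0 in opp_signs.
- by move=> k l kS lS; rewrite !normrN !nx mulrNN; apply: lone'.
Qed.

(* If no pair is bad, the longest prefix of constant sign dominates the rest. *)
Lemma pivot_typeB S y x i0 :
  {in S, forall k, 0 < y k} -> {in S &, injective y} ->
  {in S, forall k, x k != 0} -> {in S &, injective (fun k => `|x k|)} ->
  i0 \in S ->
  (forall i j, i \in S -> j \in S -> ~~ bad_pair y x i j) ->
  exists T : {set I}, [/\ T \subset S, T != finset.set0,
    forall a b, a \in T -> b \in S :\: T -> y b < y a &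
    exists2 c : R, c = 1 \/ c = -1 & forall a, a \in T ->
      0 < c * x a /\ forall b, b \in S :\: T -> `|x b| < `|x a| ].
Proof.
move=> y0 yinj x0 xinj i0S nobad.
have [f fS yf] := set_argmax yinj i0S.
pose T := [set a in S | [forall b, (b \in S) && (y a <= y b) ==> (0 < x f * x b)]].
have TP a : reflect (a \in S /\ forall b, b \in S -> y a <= y b -> 0 < x f * x b)
                    (a \in T).
  rewrite inE; apply: (iffP andP) => -[aS H]; split=> //.
    by move=> b bS ab; move/forallP/(_ b): H; rewrite bS ab.
  by apply/forallP=> b; apply/implyP=> /andP[]; apply: H.
have xx0 a : a \in S -> 0 < x a * x a.
  by move=> aS; rewrite -expr2 lt_neqAle sqr_ge0 eq_sym sqrf_eq0 x0.
have Tf : f \in T.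
  apply/TP; split=> // b bS fb; have [->|bf] := eqVneq b f; first exact: xx0.
  by have := yf b bS bf; rewrite ltNge fb.
have TS : T \subset S by apply/fintype.subsetP=> a /TP[].
have up a b : a \in T -> b \in S :\: T -> y b < y a.
  move=> /TP[aS Ta] /setDP[bS]; rewrite ltNge; apply: contra => ab.
  by apply/TP; split=> // c cS bc; apply: Ta => //; apply: le_trans bc.
exists T; split=> //; first by apply/finset.set0Pn; exists f.
exists (if x f < 0 then -1 else 1) => [|a aT]; first by case: ifP; auto.
have [aS Ta] := TP a aT; split.
  have := Ta a aS (lexx _); have := x0 f fS; case: (ltgtP (x f) 0) => // xf _.
    by rewrite nmulr_rgt0 // mulN1r oppr_gt0.
  by rewrite pmulr_rgt0 // mul1r.
have opp b : b \in S -> y b < y a -> x f * x b < 0 -> `|x b| < `|x a|.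
  move=> bS ba xfb; rewrite ltNge; apply/negP; rewrite le_eqVlt => /orP[/eqP|lt_ab].
    by move/xinj => /(_ aS bS) E; rewrite E ltxx in ba.
  have := nobad a b aS bS; rewrite /bad_pair lt_ab !gtr0_norm ?y0 // ba /=.
  have -> : y a * x a * (y b * x b) = y a * y b * (x a * x b) by ring.
  rewrite pmulr_rlt0 ?mulr_gt0 ?y0 // -leNgt => xab.
  have xa := Ta a aS (lexx _).
  have : 0 < x f * x a * (x f * x a) by rewrite mulr_gt0.
  have : (x f * x a) * (x f * x b) < 0 by rewrite pmulr_rlt0.
  have -> : (x f * x a) * (x f * x b) = x f * x f * (x a * x b) by ring.
  by rewrite pmulr_rlt0 ?xx0 // ltNge xab.
move=> b bST; have ba := up a b aT bST; have /setDP[bS bT] := bST.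
have [xfb|] := ltP (x f * x b) 0; first exact: opp.
rewrite le0r mulf_eq0 !(negPf (x0 _ _)) //= => xfb.
(* An entry [b] with the sign of [x f] lies behind some [c] of the opposite sign. As (c, b) is not
   bad, |x b| <= |x c|, and the previous case bounds |x c|. *)
have [c [cS bc xfc]] : exists c, [/\ c \in S, y b <= y c & x f * x c < 0].
  move: bT; rewrite inE bS /= => /forallPn[c].
  rewrite negb_imply -leNgt => /andP[/andP[cS bc] xfc]; exists c; split=> //.
  by rewrite lt_neqAle xfc mulf_neq0 ?x0.
have cST : c \in S :\: T.
  by rewrite inE cS andbT; apply/negP=> /TP[_ /(_ c cS (lexx _))]; lra.
have ca := up a c aT cST; apply: le_lt_trans (opp c cS ca xfc).
have cb : c != b by apply: contraTneq xfc => ->; rewrite -leNgt ltW.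
have bc' : y b < y c.
  by rewrite lt_neqAle bc andbT; apply: contra cb => /eqP/yinj->.
have := nobad c b cS bS.
rewrite /bad_pair (gtr0_norm (y0 b bS)) (gtr0_norm (y0 c cS)) bc' /=.
rewrite negb_and -!leNgt => /orP[//|].
have -> : y c * x c * (y b * x b) = y c * y b * (x c * x b) by ring.
rewrite pmulr_rge0 ?mulr_gt0 ?y0 // => xcb.
have : (x f * x b) * (x f * x c) < 0 by rewrite pmulr_rlt0.
have -> : (x f * x b) * (x f * x c) = x f * x f * (x c * x b) by ring.
by rewrite pmulr_rlt0 ?xx0 // ltNge xcb.
Qed.

End TypeB.

(** * Patterns 3142 and 2413 and pivots in type A *)

Section TypeA.
Variables (R : realFieldType) (I : finType).
Implicit Types (S : {set I}) (x y : I -> R).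

(* Read in the order of decreasing y, the values of x form the pattern 3142. *)
Definition pattern3142 y x (i j k l : I) : bool :=
  [&& y l < y k, y k < y j, y j < y i, x j < x l, x l < x i & x i < x k].

Lemma perm_4cycle (i j l k : I) : uniq [:: i; j; l; k] ->
  exists s : {perm I}, [/\ s i = j, s j = l, s l = k, s k = i &
    forall m, m \notin [:: i; j; l; k] -> s m = m].
Proof.
rewrite /= !inE !negb_or => /and4P[/and3P[ij il ik] /andP[jl jk] lk _].
have [[[ji ki] [li kj]] [lj kl]] : ((j != i) * (k != i) * ((l != i) * (k != j)) *
    ((l != j) * (k != l)))%type.
  by rewrite ![_ == i]eq_sym [k == j]eq_sym [l == j]eq_sym [k == l]eq_sym.
exists (tperm i j * tperm i l * tperm i k)%g; split.
- by rewrite !permM tpermL (tpermD ij lj) (tpermD ij kj).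
- by rewrite !permM tpermR tpermL (tpermD il kl).
- by rewrite !permM (tpermD il jl) tpermR tpermL.
- by rewrite !permM (tpermD ik jk) (tpermD ik lk) tpermR.
move=> m; rewrite !inE !negb_or ![m == _]eq_sym => /and4P[im jm lm km].
by rewrite !permM (tpermD im jm) (tpermD im lm) (tpermD im km).
Qed.

(** On the four indices, y composed with the cycle [s] has the relative order 3142 of x, and y
    composed with the inverse of [s] has the order 2413 of - x. These are the translate of p = y and
    the vector q. The other entries, fixed by [s], do no harm because they sit in the middle of the
    pattern for both y and x. *)
Lemma conflict_central_pattern S y x i j k l :
  i \in S -> j \in S -> k \in S -> l \in S -> pattern3142 y x i j k l ->
  (forall m, m \in S -> m \notin [:: i; j; k; l] ->
    [&& y k < y m, y m < y j, x l < x m & x m < x i]) ->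
  conflict false S y x.
Proof.
move=> iS jS kS lS /and5P[ykl yjk yij xjl /andP[xli xik]] central.
have [s [si sj sl sk sm']] : exists s : {perm I}, [/\ s i = j, s j = l, s l = k,
    s k = i & forall m, m \notin [:: i; j; l; k] -> s m = m].
  apply: perm_4cycle; rewrite /= !inE !negb_or !andbT.
  by apply/and3P; split; [apply/and3P|apply/andP|]; try split; apply/eqP=> E;
    rewrite E in ykl yjk yij xjl xli xik; clear -ykl yjk yij xjl xli xik; lra.
have sm m : m \notin [:: i; j; k; l] -> s m = m.
  by move=> mN; apply: sm'; move: mN; rewrite !inE [(m == l) || _]orbC.
have ij : i != j by apply: contraTneq yij => ->; rewrite ltxx.
have [q qs] : exists q : I -> R, forall m, q (s m) = y m.
  by exists (fun m => y ((s^-1)%g m)) => m; rewrite permK.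
have qi : q i = y k by rewrite -sk qs.
have qj : q j = y i by rewrite -si qs.
have qk : q k = y l by rewrite -sl qs.
have ql : q l = y j by rewrite -sj qs.
have qm m : m \notin [:: i; j; k; l] -> q m = y m.
  by move=> mN; rewrite -{1}(sm m mN) qs.
have main a b : a \in S -> b \in S -> y b < y a ->
    (x b < x a -> y (s b) < y (s a)) /\ (x a < x b -> q b < q a).
  have cases m : m \in S -> [\/ m = i, m = j, m = k | m = l] \/
      [/\ m \notin [:: i; j; k; l], [&& y k < y m, y m < y j, x l < x m & x m < x i],
          s m = m & q m = y m].
    move=> mS; have [|mN] := boolP (m \in [:: i; j; k; l]).
      rewrite !inE => /or4P[] /eqP ->; left.
      - exact: Or41.
      - exact: Or42.
      - exact: Or43.
      - exact: Or44.
    by right; split; auto.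
  move=> /cases[]; last first.
    move=> [_ /and4P[? ? ? ?] -> ->] /cases[]; last first.
      by move=> [_ /and4P[? ? ? ?] -> ->]; split.
    by case=> ->; rewrite ?si ?sj ?sk ?sl ?qi ?qj ?qk ?ql; split; lra.
  move=> aE /cases[]; last first.
    move=> [_ /and4P[? ? ? ?] -> ->].
    by case: aE => ->; rewrite ?si ?sj ?sk ?sl ?qi ?qj ?qk ?ql; split; lra.
  by case: aE => ->; case=> ->; rewrite ?si ?sj ?sk ?sl ?qi ?qj ?qk ?ql; split; lra.
have actp f m : sperm_act s (fun=> 1) f m = f (s m) by rewrite /sperm_act mul1r.
have actq m : sperm_act s (fun=> 1) q m = y m by rewrite actp qs.
exists s, (fun=> 1), y, q; split.
  split; first by left.
  - move=> m mS; split=> //; apply: sm; apply: contra mS.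
    by rewrite !inE => /or4P[] /eqP->.
  - by exists i; left; rewrite si; apply/eqP; rewrite eq_sym.
move=> g [a b aS bS _|//|//]; rewrite !actq !actp.
case: (ltgtP (y a) (y b)) => [yab|yba|->]; last by split; rewrite subrr mul0r ltxx.
  have [h1 h2] := main b a bS aS yab.
  have y0 : y a - y b < 0 by rewrite subr_lt0.
  split; rewrite !(nmulr_rgt0 _ y0) ?(nmulr_rlt0 _ y0) ?subr_gt0 !subr_lt0.
    by move/h1.
  by move/h2.
have [h1 h2] := main a b aS bS yba.
have y0 : 0 < y a - y b by rewrite subr_gt0.
split; rewrite !(pmulr_rgt0 _ y0) ?(pmulr_rlt0 _ y0) !subr_gt0 ?subr_lt0.
  by move/h1.
by move/h2.
Qed.

Lemma set_argmin S y k0 : {in S &, injective y} -> k0 \in S ->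
  exists2 f, f \in S & {in S, forall k, k != f -> y f < y k}.
Proof.
move=> yinj k0S; have yinj' : {in S &, injective (fun k => - y k)}.
  by move=> k l kS lS /oppr_inj; apply: yinj.
have [f fS H] := set_argmax yinj' k0S; exists f => // k kS kf.
by have := H k kS kf; rewrite ltrN2.
Qed.

(** As in type B, an extreme entry of y or of x is removable if some pattern avoids it. In a minimal
    set every pattern consists of the four extreme entries, and this forces all other entries to be
    central. *)
Lemma conflict_pattern3142 S y x i j k l :
  {in S &, injective y} -> {in S &, injective x} ->
  i \in S -> j \in S -> k \in S -> l \in S -> pattern3142 y x i j k l ->
  conflict false S y x.
Proof.
have [n] := ubnP #|S|; elim: n => // n IH in S i j k l *.
move=> cardS yinj xinj iS jS kS lS pat.
have sub m m' : m' \in S :\ m -> m' \in S by case/setD1P.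
have IHm m i' j' k' l' : m \in S -> i' \in S -> j' \in S -> k' \in S -> l' \in S ->
    pattern3142 y x i' j' k' l' -> m \notin [:: i'; j'; k'; l'] ->
    conflict false (S :\ m) y x.
  move=> mS i'S j'S k'S l'S pat'; rewrite !inE !negb_or => /and4P[mi mj mk ml].
  apply: (IH _ i' j' k' l'); rewrite ?inE ?i'S ?j'S ?k'S ?l'S ?andbT 1?eq_sym //.
  - by move: cardS; rewrite (cardsD1 m) mS add1n ltnS.
  - by move=> a b /sub aS /sub; apply: yinj.
  - by move=> a b /sub aS /sub; apply: xinj.
have [fy fyS fyP] := set_argmax yinj iS; have [gy gyS gyP] := set_argmin yinj iS.
have [fx fxS fxP] := set_argmax xinj iS; have [gx gxS gxP] := set_argmin xinj iS.
have ext (z z' : I -> R) m c : c = 1 \/ c = -1 -> m \in S ->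
    (forall m', m' \in S -> m' != m -> 0 < c * (z m - z m')) ->
    conflict false (S :\ m) z z' -> conflict false S z z'.
  by move=> c1 mS zm; apply: (conflict_extend mS c1).
have extreme m : m \in [:: fy; gy; fx; gx] ->
    conflict false (S :\ m) y x -> conflict false S y x.
  rewrite !inE => /or4P[] /eqP ->.
  - apply: (ext _ _ _ 1); auto=> a aS ay; rewrite mul1r subr_gt0; exact: fyP.
  - apply: (ext _ _ _ (-1)); auto=> a aS ay; rewrite mulN1r opprB subr_gt0.
    exact: gyP.
  - move=> /conflict_swap H; apply: conflict_swap; move: H.
    apply: (ext _ _ _ 1); auto=> a aS ay; rewrite mul1r subr_gt0; exact: fxP.
  - move=> /conflict_swap H; apply: conflict_swap; move: H.
    apply: (ext _ _ _ (-1)); auto=> a aS ay; rewrite mulN1r opprB subr_gt0.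
    exact: gxP.
have mS' m : m \in [:: fy; gy; fx; gx] -> m \in S.
  by rewrite !inE => /or4P[] /eqP ->.
pose patS t := let: (i', j', k', l') := t in
  [&& i' \in S, j' \in S, k' \in S, l' \in S & pattern3142 y x i' j' k' l'].
have [/existsP[[[[i' j'] k'] l'] /andP[/and5P[i'S j'S k'S l'S pat'] H]]|/existsPn lone] :=
  boolP [exists t, patS t && ~~ all (mem (let: (i', j', k', l') := t in
    [:: i'; j'; k'; l'])) [:: fy; gy; fx; gx]].
  move: H => /allPn[m mE mN]; apply: (extreme m) => //.
  by apply: (IHm m i' j' k' l') => //; apply: mS'.
have {}lone i' j' k' l' : i' \in S -> j' \in S -> k' \in S -> l' \in S ->
    pattern3142 y x i' j' k' l' -> [/\ i' = fy, l' = gy, k' = fx & j' = gx].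
  move=> i'S j'S k'S l'S pat'; have := lone (i', j', k', l').
  rewrite /patS i'S j'S k'S l'S pat' /= negbK => /and5P[+ + + + _].
  have /and5P[h1 h2 h3 h4 /andP[h5 h6]] := pat'.
  have ymax m : m \in S -> y m <= y fy.
    by move=> mS; have [->//|h] := eqVneq m fy; apply/ltW/fyP.
  have ymin m : m \in S -> y gy <= y m.
    by move=> mS; have [->//|h] := eqVneq m gy; apply/ltW/gyP.
  have xmax m : m \in S -> x m <= x fx.
    by move=> mS; have [->//|h] := eqVneq m fx; apply/ltW/fxP.
  have xmin m : m \in S -> x gx <= x m.
    by move=> mS; have [->//|h] := eqVneq m gx; apply/ltW/gxP.
  rewrite !inE => E1 E2 E3 E4; split.
  - by case/or4P: E1 => /eqP E //; have := ymax i' i'S; rewrite E => h;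
      exfalso; clear -h h1 h2 h3 h4 h5 h6; lra.
  - by case/or4P: E2 => /eqP E //; have := ymin l' l'S; rewrite E => h;
      exfalso; clear -h h1 h2 h3 h4 h5 h6; lra.
  - by case/or4P: E3 => /eqP E //; have := xmax k' k'S; rewrite E => h;
      exfalso; clear -h h1 h2 h3 h4 h5 h6; lra.
  - by case/or4P: E4 => /eqP E //; have := xmin j' j'S; rewrite E => h;
      exfalso; clear -h h1 h2 h3 h4 h5 h6; lra.
have [iE lE kE jE] := lone i j k l iS jS kS lS pat.
have /and5P[ykl yjk yij xjl /andP[xli xik]] := pat.
apply: (conflict_central_pattern iS jS kS lS pat) => m mS.
rewrite !inE !negb_or => /and4P[mi mj mk ml].
have ymi : y m < y i by rewrite iE; apply: fyP; rewrite -?iE.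
have ylm : y l < y m by rewrite lE; apply: gyP; rewrite -?lE.
have xmk : x m < x k by rewrite kE; apply: fxP; rewrite -?kE.
have xjm : x j < x m by rewrite jE; apply: gxP; rewrite -?jE.
have yN a : a \in S -> m != a -> y m != y a by move=> aS; apply: contra => /eqP/yinj->.
have xN a : a \in S -> m != a -> x m != x a by move=> aS; apply: contra => /eqP/xinj->.
(* In every consistent position other than the central one, [m] could replace one of the four
   entries and give another pattern. *)
have noti : ~~ pattern3142 y x m j k l.
  by apply: contra mi => /lone-/(_ mS jS kS lS)[-> _ _ _]; rewrite iE.
have notj : ~~ pattern3142 y x i m k l.
  by apply: contra mj => /lone-/(_ iS mS kS lS)[_ _ _ ->]; rewrite jE.
have notk : ~~ pattern3142 y x i j m l.
  by apply: contra mk => /lone-/(_ iS jS mS lS)[_ _ -> _]; rewrite kE.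
have notl : ~~ pattern3142 y x i j k m.
  by apply: contra ml => /lone-/(_ iS jS kS mS)[_ -> _ _]; rewrite lE.
move: noti notj notk notl; rewrite /pattern3142 ykl yjk yij xjl xli xik ymi ylm xmk xjm /=.
rewrite !andbT.
case: (ltgtP (y m) (y j)) (yN j jS mj) => // ymj _;
case: (ltgtP (y m) (y k)) (yN k kS mk) => // ymk _;
case: (ltgtP (x m) (x l)) (xN l lS ml) => // xml _;
case: (ltgtP (x m) (x i)) (xN i iS mi) => // xmi _; rewrite ?andbF ?andbT //=.
by move=> *; exfalso; clear -xmi xml xli; lra.
Qed.

(** Permutations avoiding 3142 and 2413 are direct or skew sums, and [T] is the first summand. The
    induction removes the first entry [f] and adapts the splitting of the rest to it. *)
Lemma pivot_typeA S y x : {in S &, injective y} -> {in S &, injective x} ->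
  (1 < #|S|)%N ->
  (forall i j k l, i \in S -> j \in S -> k \in S -> l \in S ->
    ~~ pattern3142 y x i j k l /\ ~~ pattern3142 y (\- x) i j k l) ->
  exists T : {set I}, [/\ T \subset S, T != finset.set0, S :\: T != finset.set0 &
    exists2 c : R, c = 1 \/ c = -1 & forall a b, a \in T -> b \in S :\: T ->
      y b < y a /\ 0 < c * (x a - x b)].
Proof.
have [n] := ubnP #|S|; elim: n => // n IH in S *.
move=> cardS yinj xinj S1 nopat.
have /card_gt0P[k0 k0S] : (0 < #|S|)%N by apply: ltnW.
have [f fS yf] := set_argmax yinj k0S.
have sub m : m \in S :\ f -> m \in S by case/setD1P.
have cardf : #|S :\ f|.+1 = #|S| by rewrite [#|S|](cardsD1 f) fS.
have S'0 : S :\ f != finset.set0 by rewrite -card_gt0 -ltnS cardf.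
pose goal z := exists T : {set I}, [/\ T \subset S, T != finset.set0, S :\: T != finset.set0 &
    exists2 c : R, c = 1 \/ c = -1 & forall a b, a \in T -> b \in S :\: T ->
      y b < y a /\ 0 < c * (z a - z b)].
rewrite -/(goal x).
have lone z (c : R) : c = 1 \/ c = -1 ->
    (forall b, b \in S :\ f -> 0 < c * (z f - z b)) -> goal z.
  move=> c1 zf; exists [set f]; split; rewrite ?finset.sub1set //.
    by apply/finset.set0Pn; exists f; rewrite inE.
  exists c => // a b /set1P-> bS; split; last exact: zf.
  by case/setD1P: bS => bf bS; apply: yf.
case: (ltnP 1 #|S :\ f|) => [S'1|]; last first.
  rewrite -ltnS cardf => S2.
  have /cards1P[g gE] : #|S :\ f| == 1%N.
    by rewrite eqn_leq -ltnS cardf S2 card_gt0.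
  have gS : g \in S :\ f by rewrite gE inE.
  have [gf gS'] := setD1P gS.
  have /orP[xfg|xfg] : (x f < x g) || (x g < x f).
    by rewrite -neq_lt; apply: contra gf => /eqP/xinj->.
    apply: (lone _ (-1)); first by right.
    by move=> b; rewrite gE => /set1P->; rewrite mulN1r opprB subr_gt0.
  apply: (lone _ 1); first by left.
  by move=> b; rewrite gE => /set1P->; rewrite mul1r subr_gt0.
have [||||T [TS T0 T'0 [c c1 Tc]]] := IH (S :\ f) _ _ _ S'1.
- by rewrite -ltnS cardf.
- by move=> a b /sub aS /sub; apply: yinj.
- by move=> a b /sub aS /sub; apply: xinj.
- by move=> i j k l /sub iS /sub jS /sub kS /sub lS; apply: nopat.
(* Up to negating x, the entries of [T] are larger than the remaining ones behind [f]. *)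
have core z : {in S &, injective z} ->
    (forall i j k l, i \in S -> j \in S -> k \in S -> l \in S ->
      ~~ pattern3142 y (\- z) i j k l) ->
    (forall a b, a \in T -> b \in S :\ f :\: T -> y b < y a /\ 0 < z a - z b) ->
    goal z.
  move=> zinj nop Tz; have [t tT] := finset.set0Pn _ T0.
  have [tf tS] := setD1P (fintype.subsetP TS t tT).
  have TS' a : a \in T -> a \in S by move/(fintype.subsetP TS)/sub.
  have QS b : b \in S :\ f :\: T -> b \in S by case/setDP=> /sub.
  have [/existsP[b2 /andP[b2Q b2f]]|/existsPn Q2] :=
      boolP [exists b, (b \in S :\ f :\: T) && (z b < z f)]; last first.
    apply: (lone _ (-1)); first by right.
    have Qf b : b \in S :\ f :\: T -> z f < z b.
      move=> bQ; have := Q2 b; rewrite bQ /= -leNgt le_eqVlt => /orP[/eqP E|//].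
      have /setDP[/setD1P[bf _] _] := bQ.
      by rewrite (zinj _ _ fS (QS b bQ) E) eqxx in bf.
    move=> b bS; rewrite mulN1r opprB subr_gt0.
    have [bT|bT] := boolP (b \in T); last by apply: Qf; rewrite inE bT.
    have [b' b'Q] := finset.set0Pn _ T'0; have := Tz b b' bT b'Q; have := Qf b' b'Q.
    by rewrite subr_gt0 => h1 [_ h2]; apply: lt_trans h2.
  (* Some entry behind [T] is below that of [f], so [f] goes with [T], together with all entries
     that are not below its own. *)
  pose U := [set a in S | (a \in T) || (z f <= z a)].
  exists U; split; first by apply/fintype.subsetP=> a; rewrite inE => /andP[].
  - by apply/finset.set0Pn; exists f; rewrite inE fS lexx orbT.
  - apply/finset.set0Pn; exists b2; have /setDP[_ b2T] := b2Q.
    by rewrite !inE QS // (negPf b2T) /= leNgt b2f.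
  exists 1; first by left.
  move=> a b; rewrite !inE negb_and negb_or -ltNge.
  move=> /andP[aS aU] /andP[+ bS]; rewrite bS /= => /andP[bT bf]; rewrite mul1r.
  have bQ : b \in S :\ f :\: T.
    by rewrite !inE bT bS andbT; apply: contraTneq bf => ->; rewrite ltxx.
  have zab : z b < z a.
    case/orP: aU => [aT|]; last exact: lt_le_trans.
    by have [_] := Tz a b aT bQ; rewrite subr_gt0.
  rewrite subr_gt0 zab; split=> //.
  have [->|af] := eqVneq a f; first by apply: yf => //; case/setDP: bQ => /setD1P[].
  have [aT|aT] := boolP (a \in T); first by case: (Tz a b aT bQ).
  rewrite (negPf aT) /= in aU.
  have aQ : a \in S :\ f :\: T by rewrite !inE aT af aS.
  rewrite ltNge le_eqVlt; apply/negP => /orP[/eqP/yinj E|yab].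
    by rewrite E ?ltxx // in zab.
  (* If the new first part were not a prefix, [f], [t], [b], [a] would form the pattern 2413. *)
  have /negP[] := nop f t b a fS tS bS aS; rewrite /pattern3142 yab.
  have [_ zta] := Tz t a tT aQ; have [-> _] := Tz t b tT bQ.
  rewrite (yf t tS tf) /= !ltrN2 -subr_gt0 zta bf lt_neqAle aU !andbT /=.
  by apply: contra af => /eqP/zinj->.
case: c1 => cE; rewrite cE in Tc.
  apply: core => //; first by move=> i j k l *; case: (nopat i j k l).
  by move=> a b aT bQ; have [? ] := Tc a b aT bQ; rewrite mul1r.
have [|||U [US U0 U'0 [d d1 Ud]]] := core (\- x).
- by move=> a b aS bS /oppr_inj; apply: xinj.
- move=> i j k l iS jS kS lS; have [+ _] := nopat i j k l iS jS kS lS.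
  by rewrite /pattern3142 /= !opprK.
- by move=> a b aT bQ; have [? ] := Tc a b aT bQ; rewrite mulN1r /= opprB opprK addrC.
exists U; split=> //; exists (- d); first by case: d1 => ->; rewrite ?opprK; auto.
move=> a b aU bU; have [? ] := Ud a b aU bU.
by rewrite mulNr -mulrN /= opprB opprK addrC.
Qed.

End TypeA.

(** * Coordinates in type B *)

Section OrthogonalParts.
Variables (R : realFieldType) (d : nat) (Phi Delta J1 J2 : {fset 'cV[R]_d}).
Hypotheses (rs : root_system Phi) (ss : simple_system Phi Delta).

(** Reflections in [J1] preserve the span of [J1] and fix that of [J2] pointwise, and conversely; so
    every root stays in one of the two spans. *)
Lemma irreducible_simple_connected : Delta = J1 `|` J2 -> orthogonal_sets J1 J2 ->
  irreducible_roots Phi -> J1 = fset0 \/ J2 = fset0.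
Proof.
move=> DE J12 [_ irr]; pose V1 := <<enum_fset J1>>%VS; pose V2 := <<enum_fset J2>>%VS.
have V12 a b : a \in V1 -> b \in V2 -> dot a b = 0.
  move=> aV bV; rewrite dotC; apply: (dot_span (A := J1)) aV => c cJ.
  by rewrite dotC; apply: (dot_span (A := J2)) bV => c' c'J; apply: J12.
have PhiE : Phi = cut Phi V1 `|` cut Phi V2.
  apply/fsetP=> b; rewrite in_fsetU !cutE -andb_orr; apply/esym/andb_idr => bP.
  apply/orP; move: b bP; apply: (root_invariant_ind rs ss) => [a|a b].
    by rewrite DE in_fsetU => /orP[] aJ; [left|right]; apply: mem_fset_span.
  rewrite DE in_fsetU => /orP[] aJ _; have aV := mem_fset_span aJ => -[] bV.
  - by left; rewrite refl_span.
  - by right; rewrite refl_fix // dotC V12.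
  - by left; rewrite refl_fix // V12.
  - by right; rewrite refl_span.
have [a b|E|E] := irr _ _ PhiE.
- by rewrite !cutE => /andP[_ aV] /andP[_ bV]; apply: V12.
- left; apply/fsetP=> a; rewrite in_fset0; apply/negP=> aJ.
  have aD : a \in Delta by rewrite DE in_fsetU aJ.
  have /fsetP/(_ a) := E.
  by rewrite cutE in_fset0 mem_fset_span // (simple_root ss).
- right; apply/fsetP=> a; rewrite in_fset0; apply/negP=> aJ.
  have aD : a \in Delta by rewrite DE in_fsetU aJ orbT.
  have /fsetP/(_ a) := E.
  by rewrite cutE in_fset0 mem_fset_span // (simple_root ss).
Qed.

End OrthogonalParts.

Section Coordinates.
Variables (R : realFieldType) (d m : nat) (Phi Delta : {fset 'cV[R]_d}).
Local Notation n := m.+2.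
Hypotheses (rs : root_system Phi) (ss : simple_system Phi Delta).
Variable alpha : 'I_n -> 'cV[R]_d.
Hypothesis alphaD : forall a, a \in Delta <-> exists i, a = alpha i.
Hypothesis alpha_cartan : forall i j, cartan (alpha i) (alpha j) = (cartan_B n i j)%:~R.
Implicit Types (i j k l : 'I_n) (p v : 'cV[R]_d).

Let c := dot (alpha ord_max) (alpha ord_max).

Lemma alpha_simple i : alpha i \in Delta.
Proof. by apply/alphaD; exists i. Qed.

Lemma alpha_root i : alpha i \in Phi.
Proof. exact/(simple_root ss)/alpha_simple. Qed.

Lemma alpha_gt0 i : 0 < dot (alpha i) (alpha i).
Proof. exact/dot_gt0/(root_neq0 rs)/alpha_root. Qed.

Lemma short_gt0 : 0 < c.
Proof. exact: alpha_gt0. Qed.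

Lemma alpha_dotE i j :
  2 * dot (alpha i) (alpha j) = (cartan_B n i j)%:~R * dot (alpha j) (alpha j).
Proof.
by rewrite -alpha_cartan /cartan divfK // gt_eqF // alpha_gt0.
Qed.

(** Cartan numbers give only ratios of lengths. Descending induction carries the squared length [c]
    from the short end along the diagram. *)
Lemma alpha_adjacent i j : (j : nat) = i.+1 ->
  dot (alpha i) (alpha j) = - c /\ dot (alpha i) (alpha i) = c + c.
Proof.
have [h] := ubnP (n - i); elim: h i j => // h IH i j; rewrite ltnS => ih ji.
have Dij := alpha_dotE i j; have := alpha_dotE j i.
rewrite dotC /cartan_B (_ : (j == i :> nat) = false); last by apply/eqP; lia.
rewrite ji (_ : (i == i.+2 :> nat) = false) ?eqxx; last by apply/eqP; lia.
move=> Dji; move: Dij; rewrite /cartan_B (_ : (i == j :> nat) = false); last by apply/eqP; lia.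
rewrite ji eqxx /=; case: eqVneq => [last|notlast] Dij.
  have jE : j = ord_max by apply/val_inj; rewrite /= ji last.
  by move: Dij Dji; rewrite jE /c !intrN; split; lra.
have jn : (j.+1 < n)%N by have := ltn_ord j; move/eqP: notlast => /=; lia.
have jh : (n - j < h)%N by lia.
have [_ jj] := IH j (Ordinal jn) jh erefl.
by move: Dij Dji; rewrite jj; split; lra.
Qed.

Lemma alpha_far i j : (j : nat) != i.+1 -> (i : nat) != j.+1 -> i != j ->
  dot (alpha i) (alpha j) = 0.
Proof.
move=> ji ij ne; have := alpha_dotE i j.
by rewrite /cartan_B (negPf (ne : (i : nat) != j)) (negPf ji) (negPf ij) mul0r; lra.
Qed.

(** The orthogonal coordinate vectors of B_n, which are also its short positive roots. The index is
    a natural number so that [eps n] is 0 and a simple root is a difference of two of them at the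
    short end too. *)
Definition eps (k : nat) : 'cV[R]_d := \sum_(i < n | (k <= i)%N) alpha i.

Lemma eps_out : eps n = 0.
Proof. by rewrite /eps big_pred0 // => i; rewrite leqNgt ltn_ord. Qed.

Lemma epsS k : eps k = alpha k + eps k.+1.
Proof.
rewrite /eps (bigD1 k) //=; congr (_ + _); apply: eq_bigl => i.
by rewrite ltn_neqAle andbC eq_sym.
Qed.

Lemma alphaE k : alpha k = eps k - eps k.+1.
Proof. by rewrite epsS addrK. Qed.

Lemma dot_eps_alpha (k : nat) j : (k < n)%N ->
  dot (eps k) (alpha j) = c * ((k == j)%:R - (k == j.+1)%:R).
Proof.
have H : (k <= n)%N ->
    dot (eps k) (alpha j) = c * ((k == j)%:R - ((k == j.+1) && (k < n)%N)%:R).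
  have [h] := ubnP (n - k); elim: h k => // h IH k; rewrite ltnS => kh.
  rewrite leq_eqVlt => /orP[/eqP ->|kn].
    by rewrite eps_out dotC dot0r ltnn andbF gtn_eqF ?ltn_ord // subrr mulr0.
  have -> : eps k = alpha (Ordinal kn) + eps k.+1 by rewrite -epsS.
  rewrite dotDl IH //; last by lia.
  rewrite kn andbT eqSS.
  have [kj|kj] := eqVneq k j.
    have -> : Ordinal kn = j by apply/val_inj.
    rewrite -kj (_ : (k.+1 == k) = false); last by apply/eqP; lia.
    rewrite (_ : (k == k.+1) = false); last by apply/eqP; lia.
    have [kn1|kn1] := ltnP k.+1 n => /=.
      have [_ ->] := @alpha_adjacent j (Ordinal kn1) (congr1 S kj).
      by ring.
    have -> : j = ord_max by apply/val_inj; rewrite /= -kj; lia.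
    by rewrite -/c; ring.
  have [kSj|kSj] := eqVneq k j.+1.
    have [+ _] := @alpha_adjacent j (Ordinal kn) kSj; rewrite dotC => ->.
    by rewrite (_ : (k.+1 == j) = false) /=; [ring|apply/eqP; lia].
  have [kjS|kjS] := eqVneq k.+1 j.
    have [-> _] := @alpha_adjacent (Ordinal kn) j (esym kjS).
    by rewrite /=; ring.
  have kj' : Ordinal kn != j by apply: contra kj => /eqP <-.
  by rewrite (alpha_far (i := Ordinal kn) _ _ kj') //=; [ring|rewrite eq_sym].
by move=> kn; rewrite (H (ltnW kn)) kn andbT.
Qed.

Lemma dot_eps k l : dot (eps k) (eps l) = c * (k == l)%:R.
Proof.
suff H (j : nat) : (j <= n)%N -> dot (eps k) (eps j) = c * (val k == j)%:R.
  by rewrite (H l (ltnW (ltn_ord l))).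
have [h] := ubnP (n - j); elim: h j => // h IH j; rewrite ltnS => jh.
rewrite leq_eqVlt => /orP[/eqP ->|jn].
  by rewrite eps_out dot0r ltn_eqF ?ltn_ord // mulr0n mulr0.
have -> : eps j = alpha (Ordinal jn) + eps j.+1 by rewrite -epsS.
rewrite dotDr IH //; last by lia.
by rewrite dot_eps_alpha ?ltn_ord //=; ring.
Qed.

Lemma eps_vector (f : 'I_n -> R) : exists p, forall k, dot p (eps k) = f k.
Proof.
exists (\sum_k (f k / c) *: eps k) => k.
rewrite dotC dot_sumr (bigD1 k) //= big1 ?addr0 => [|j jk].
  by rewrite dotZr dot_eps eqxx mulr1 divfK // gt_eqF // short_gt0.
by rewrite dotZr dot_eps eq_sym (negPf jk) !mulr0.
Qed.

Lemma refl_eps_sub k l j : k != l ->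
  refl (eps k - eps l) *m eps j = eps (tperm k l j).
Proof.
move=> kl; have c20 : c + c != 0 by rewrite gt_eqF // addr_gt0 // short_gt0.
have nrm : dot (eps k - eps l) (eps k - eps l) = c + c.
  rewrite dotBr !dotDl !dotNl !dot_eps !eqxx [l == k]eq_sym (negPf kl) /=; ring.
rewrite reflE /cartan nrm dotBr !dot_eps; case: tpermP => [->|->|/eqP jk /eqP jl].
- rewrite eqxx (negPf kl) (_ : _ / _ = 1) ?scale1r ?subKr //=.
  by field.
- rewrite eqxx [l == k]eq_sym (negPf kl) (_ : _ / _ = -1) /=; last by field.
  by rewrite scaleN1r opprK addrC subrK.
- by rewrite (negPf jk) (negPf jl) subrr mulr0 mul0r scale0r subr0.
Qed.

Lemma refl_eps k j : refl (eps k) *m eps j = (if j == k then -1 else 1) *: eps j.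
Proof.
have cN : c != 0 by rewrite gt_eqF // short_gt0.
rewrite reflE /cartan !dot_eps eqxx; case: eqVneq => [->|jk].
  by rewrite mulr1 mulfK // scaleN1r scaler_nat mulr2n opprD addrA subrr sub0r.
by rewrite mulr0 mulr0 mul0r scale0r subr0 scale1r.
Qed.

(** Reflecting in a simple root exchanges two consecutive vectors, which permits induction on
    [l - k]. The value [l = n] is included because it yields the short roots. *)
Lemma eps_sub_root (k l : nat) : (k < l)%N -> (l <= n)%N -> eps k - eps l \in Phi.
Proof.
have [h] := ubnP (l - k); elim: h k => // h IH k; rewrite ltnS => kh kl ln.
have kn : (k < n)%N by lia.
have [E|ne] := eqVneq l k.+1.
  by rewrite E -(alphaE (Ordinal kn)) alpha_root.
have kn1 : (k.+1 < n)%N by lia.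
have := root_refl rs (alpha_root (Ordinal kn)) (IH k.+1 _ _ ln).
move=> /(_ _ _); rewrite alphaE mulmxBr.
pose K := Ordinal kn; pose K1 := Ordinal kn1.
have KK1 : K != K1 by apply/eqP => /(congr1 val) /=; lia.
rewrite -[eps k.+1]/(eps K1) -[eps k]/(eps K) (refl_eps_sub _ KK1) tpermR.
have [ln'|lE] := ltnP l n.
  rewrite -[eps l]/(eps (Ordinal ln')) (refl_eps_sub _ KK1) tpermD; first by apply; lia.
    by apply/eqP => /(congr1 val) /=; lia.
  by apply/eqP => /(congr1 val) /=; lia.
have -> : l = n by lia.
by rewrite eps_out mulmx0; apply; lia.
Qed.

Lemma eps_root k : eps k \in Phi.
Proof. by have := eps_sub_root (ltn_ord k) (leqnn n); rewrite eps_out subr0. Qed.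

Lemma eps_add_root k l : k != l -> eps k + eps l \in Phi.
Proof.
wlog kl : k l / (k < l)%N => [H|] ne.
  case: (ltngtP k l) => [kl|lk|/val_inj E]; first exact: H.
    by rewrite addrC; apply: H; rewrite // eq_sym.
  by rewrite E eqxx in ne.
have := root_refl rs (eps_root l) (eps_sub_root kl (ltnW (ltn_ord l))).
by rewrite mulmxBr !refl_eps eqxx (negPf ne) scale1r scaleN1r opprK.
Qed.

End Coordinates.

(** * Parabolic subsystems as blocks of consecutive coordinates *)

Section Block.
Variables (R : realFieldType) (d m : nat) (Phi Delta J : {fset 'cV[R]_d}).
Local Notation n := m.+2.
Hypotheses (rs : root_system Phi) (ss : simple_system Phi Delta).
Variable alpha : 'I_n -> 'cV[R]_d.
Hypothesis alphaD : forall a, a \in Delta <-> exists i, a = alpha i.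
Hypothesis alpha_cartan : forall i j, cartan (alpha i) (alpha j) = (cartan_B n i j)%:~R.
Hypothesis JD : J `<=` Delta.
Hypothesis J_interval : forall i j k : 'I_n, (i < j)%N -> (j < k)%N ->
  alpha i \in J -> alpha k \in J -> alpha j \in J.
Implicit Types (i j k l : 'I_n) (p v : 'cV[R]_d) (u w : 'M[R]_d) (s : {perm 'I_n}).

Local Notation eps := (eps alpha).
Local Notation V := <<enum_fset J>>%VS.
Local Notation Phi' := (cut Phi V).
Local Notation b := (alpha ord_max \in J).
Local Notation coords p := (fun k : 'I_n => dot p (eps k)).

Let rs' : root_system Phi' := cut_root_system rs V.
Let ss' : simple_system Phi' J := cut_simple_system ss JD.

(* The indices of the coordinates moved by the reflections in J. *)
Definition block : {set 'I_n} :=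
  [set k | (alpha k \in J) || [exists j : 'I_n, (j.+1 == k) && (alpha j \in J)]].
Local Notation S := block.

Lemma simple_index a : a \in J -> exists2 k, a = alpha k & alpha k \in J.
Proof.
by move=> aJ; have /alphaD[k E] := fsubsetP JD _ aJ; exists k => //; rewrite -E.
Qed.

Lemma block_lo k : k \in S -> exists2 j : 'I_n, (j <= k <= j.+1)%N & alpha j \in J.
Proof.
rewrite inE => /orP[kJ|/existsP[j /andP[/eqP jk jJ]]]; [exists k|exists j] => //.
  by rewrite leqnn leqnSn.
by rewrite -jk leqnn leqnSn.
Qed.

Lemma eps_sub_span (k l : nat) : (k <= l)%N -> (l <= n)%N ->
  (forall i, (k <= i)%N -> (i < l)%N -> alpha i \in J) -> eps k - eps l \in V.
Proof.
have [h] := ubnP (l - k); elim: h k => // h IH k; rewrite ltnS => kh.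
rewrite leq_eqVlt => /orP[/eqP->|kl] ln H; first by rewrite subrr rpred0.
have kn : (k < n)%N by lia.
have -> : eps k - eps l = alpha (Ordinal kn) + (eps k.+1 - eps l).
  by rewrite addrA -(epsS alpha (Ordinal kn)).
rewrite rpredD ?IH ?mem_fset_span ?H //; first by lia.
by move=> i ki il; apply: H; lia.
Qed.

Lemma interval_mem i j k : (i <= j)%N -> (j <= k)%N ->
  alpha i \in J -> alpha k \in J -> alpha j \in J.
Proof.
rewrite leq_eqVlt => /orP[/eqP/val_inj->//|ij].
by rewrite leq_eqVlt => /orP[/eqP/val_inj->//|jk]; apply: J_interval.
Qed.

Lemma block_hi k i : k \in S -> (i < k)%N -> exists2 j : 'I_n, (i <= j)%N & alpha j \in J.
Proof.
move=> /block_lo[j jk jJ] ik; exists j => //; lia.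
Qed.

Lemma block_sub_root k l : k \in S -> l \in S -> k != l -> eps k - eps l \in Phi'.
Proof.
wlog kl : k l / (k < l)%N => [H|] kS lS ne.
  case: (ltngtP k l) => [kl|lk|/val_inj E]; first exact: H.
    by rewrite -(root_oppE rs') opprB; apply: H; rewrite // eq_sym.
  by rewrite E eqxx in ne.
rewrite cutE (eps_sub_root rs ss alphaD alpha_cartan kl (ltnW (ltn_ord l))) /=.
apply: eps_sub_span => [||i ki il]; [exact: ltnW|exact/ltnW/ltn_ord|].
have [j /andP[jk _] jJ] := block_lo kS; have [j' ij' j'J] := block_hi lS il.
exact: (interval_mem (leq_trans jk ki) ij').
Qed.

Lemma block_short_root k : b -> k \in S -> eps k \in Phi'.
Proof.
move=> bJ kS; rewrite cutE (eps_root rs ss alphaD alpha_cartan) /=.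
have -> : eps k = eps k - eps n by rewrite eps_out subr0.
apply: eps_sub_span => [||i ki _]; [exact/ltnW/ltn_ord|exact: leqnn|].
have [j /andP[jk _] jJ] := block_lo kS.
by apply: (interval_mem (leq_trans jk ki) _ jJ bJ); rewrite -ltnS ltn_ord.
Qed.

Lemma block_refl a : a \in Phi' -> refl_group J (refl a).
Proof. exact: (root_refl_weyl rs' ss'). Qed.

(** Composing with the transposition of [k] and its preimage [l] fixes [k] and keeps all fixed
    points. So [s] is a product of transpositions within the block, each realized by a
    reflection. *)
Lemma perm_matrix s : (forall k, k \notin S -> s k = k) ->
  exists2 M, refl_group J M & forall k, M *m eps k = eps (s k).
Proof.
have [h] := ubnP #|[set k | s k != k]|; elim: h => // h IH in s *.
rewrite ltnS => sh sS; have [->|/eqP s1] := eqVneq s 1%g.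
  by exists 1%:M => [|k]; [apply: refl_group1|rewrite mul1mx perm1].
have [k sk] : exists k, s k != k.
  apply/existsP; apply: contra_notT s1 => /existsPn H; apply/perm.permP=> k.
  by rewrite perm1; apply/eqP; move: (H k); rewrite negbK.
pose l := (s^-1)%g k; have sl : s l = k by rewrite permKV.
have lk : l != k by apply: contra sk => /eqP E; rewrite -{1}E sl.
have kS : k \in S by apply: contraT => /sS E; rewrite E eqxx in sk.
have lS : l \in S by apply: contraT => /sS; rewrite sl => E; rewrite E eqxx in lk.
have [|j jS|M WM ME] := IH (tperm k l * s)%g.
- apply: leq_trans sh; apply: proper_card; apply/properP; split.
    apply/fintype.subsetP => j; rewrite !inE permM; apply: contra => /eqP sj.
    have jk : k != j by apply: contraNneq sk => ->; rewrite sj.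
    have jl : l != j by apply: contraNneq lk => E; rewrite -sl E sj.
    by rewrite tpermD // sj.
  by exists k; rewrite !inE ?sk // permM tpermL sl eqxx.
- by rewrite permM tpermD ?sS //; apply: contraNneq jS => <-.
exists (M *m refl (eps k - eps l)) => [|j].
  apply: refl_groupM => //; apply: block_refl; apply: block_sub_root => //.
  by rewrite eq_sym.
rewrite -mulmxA (refl_eps_sub rs ss alphaD alpha_cartan) 1?eq_sym // ME permM.
by rewrite tpermK.
Qed.

Lemma sign_matrix (e : 'I_n -> R) :
  (forall k, e k = 1 \/ b /\ e k = -1) -> (forall k, k \notin S -> e k = 1) ->
  exists2 M, refl_group J M & forall k, M *m eps k = e k *: eps k.
Proof.
have [h] := ubnP #|[set k | e k != 1]|; elim: h => // h IH in e *.
rewrite ltnS => eh e1 eS.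
have [/existsP[k ek]|/existsPn H] := boolP [exists k, e k != 1]; last first.
  exists 1%:M => [|k]; first exact: refl_group1.
  by move: (H k); rewrite negbK mul1mx => /eqP->; rewrite scale1r.
have [bJ ek'] : b /\ e k = -1 by case: (e1 k) => // E; rewrite E eqxx in ek.
have kS : k \in S by apply: contraT => /eS E; rewrite E eqxx in ek.
have [|j|j jS|M WM ME] := IH (fun j => if j == k then 1 else e j).
- apply: leq_trans eh; apply: proper_card; apply/properP; split.
    by apply/fintype.subsetP => j; rewrite !inE; case: ifP => //; rewrite eqxx.
  by exists k; rewrite !inE ?ek // eqxx /= eqxx.
- by case: ifP; auto.
- by case: ifP => // _; apply: eS.
exists (M *m refl (eps k)) => [|j].
  by apply: refl_groupM => //; apply/block_refl/block_short_root.
rewrite -mulmxA (refl_eps rs ss alphaD alpha_cartan) -scalemxAr ME.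
by case: eqVneq => [->|_]; rewrite ?scale1r // ek'.
Qed.

Lemma sperm_matrix s (e : 'I_n -> R) : sperm b S s e ->
  exists2 M, refl_group J M & forall k, M *m eps k = e k *: eps (s k).
Proof.
move=> [e1 se _]; have [M WM ME] := perm_matrix (fun k kS => (se k kS).1).
have [N WN NE] := sign_matrix e1 (fun k kS => (se k kS).2).
exists (M *m N) => [|k]; first exact: refl_groupM.
by rewrite -mulmxA NE -scalemxAr ME.
Qed.

Lemma simple_sperm a : a \in J -> exists s (e : 'I_n -> R),
  [/\ forall k, e k = 1 \/ b /\ e k = -1, {in S, forall k, s k \in S} &
    forall p k, dot (refl a *m p) (eps k) = e k * dot p (eps (s k))].
Proof.
move=> /simple_index[k -> kJ].
have kS : k \in S by rewrite inE kJ.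
have [kmax|kn] := eqVneq k ord_max.
  exists 1%g, (fun j => if j == k then -1 else 1); split.
  - by move=> j; case: ifP => _; auto; right; rewrite -kmax.
  - by move=> j; rewrite perm1.
  - move=> p j; rewrite dot_mulmxl refl_tr perm1.
    have -> : alpha k = eps k by rewrite alphaE kmax eps_out subr0.
    by rewrite (refl_eps rs ss alphaD alpha_cartan) dotZr.
have k1 : (k.+1 < n)%N.
  by rewrite ltn_neqAle ltn_ord andbT; apply: contra kn => /eqP[E]; apply/eqP/val_inj.
pose k' := Ordinal k1; have k'S : k' \in S.
  by rewrite inE; apply/orP; right; apply/existsP; exists k; rewrite eqxx.
have kk' : k != k' by apply/eqP => /(congr1 val) /=; lia.
exists (tperm k k'), (fun=> 1); split; first by auto.
  by move=> j jS; case: tpermP => // ->.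
move=> p j; rewrite dot_mulmxl refl_tr mul1r alphaE -[eps k.+1]/(eps k').
by rewrite (refl_eps_sub rs ss alphaD alpha_cartan).
Qed.

(** The roots are not enumerated: their forms come from those of the simple roots, on which simple
    reflections act by signed permutations. The sign [a] appears because [coord_root] lists short
    roots and sums with one sign only. *)
Lemma block_coord_root g0 : g0 \in Phi' ->
  exists2 g, coord_root b S g & exists2 a : R, a = 1 \/ a = -1 &
    forall p, dot p g0 = a * g (coords p).
Proof.
move: g0; apply: (root_invariant_ind rs' ss') => [a aJ|a g0 aJ _ [g rg [c c1 gE]]].
  have [k -> kJ] := simple_index aJ; have kS : k \in S by rewrite inE kJ.
  have [kmax|kn] := eqVneq k ord_max.
    exists (fun f => f k); first by apply: coord_root_short; rewrite // -kmax.
    exists 1 => [|p]; first by left.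
    by rewrite mul1r alphaE [in eps k.+1]kmax eps_out subr0.
  have k1 : (k.+1 < n)%N.
    by rewrite ltn_neqAle ltn_ord andbT; apply: contra kn => /eqP[E]; apply/eqP/val_inj.
  pose k' := Ordinal k1; have k'S : k' \in S.
    by rewrite inE; apply/orP; right; apply/existsP; exists k; rewrite eqxx.
  have kk' : k != k' by apply/eqP => /(congr1 val) /=; lia.
  exists (fun f => f k - f k'); first exact: coord_root_sub.
  by exists 1 => [|p]; [left|rewrite mul1r alphaE dotBr].
have [s [e [e1 sS sE]]] := simple_sperm aJ.
have [g' rg' [c' c'1 gE']] := coord_root_act e1 sS rg.
exists g' => //; exists (c * c').
  by case: c1 => ->; case: c'1 => ->; rewrite ?mulrNN ?mulr1 ?mul1r; auto.
move=> p; have -> : dot p (refl a *m g0) = dot (refl a *m p) g0.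
  by rewrite dot_mulmxl refl_tr.
rewrite gE -mulrA -gE'; congr (_ * _); apply: (coord_root_ext rg) => k.
by rewrite sE.
Qed.


(** * From the absence of conflicts to a pivot *)

Section Pivot.
Variables (rho : 'cV[R]_d) (u : 'M[R]_d).
Hypothesis rho1 : forall a, a \in Delta -> dot rho a = 1.
Hypothesis Wu : refl_group J u.
Local Notation y := (fun k : 'I_n => dot rho (eps k)).
Local Notation x := (fun k : 'I_n => dot rho (u *m eps k)).
Local Notation P' := (pos_roots Phi' J).

Let Wu' := parabolic_weyl JD Wu.

Lemma rho_pos g : g \in P' -> 0 < dot rho g.
Proof.
apply: (pos_dot_gt0 rs') => a aJ; rewrite rho1 //; exact: (fsubsetP JD).
Qed.

Lemma rho_root_neq0 g : g \in Phi -> dot rho g != 0.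
Proof.
have r0 a : a \in Delta -> 0 < dot rho a by move/rho1->.
case/(pos_or_neg rs ss) => /(pos_dot_gt0 rs r0); first by rewrite lt0r => /andP[].
by rewrite dotNr oppr_gt0 => h; rewrite lt_eqF.
Qed.

Lemma rho_eps (k : nat) : (k <= n)%N -> dot rho (eps k) = (n - k)%:R.
Proof.
have [h] := ubnP (n - k); elim: h k => // h IH k; rewrite ltnS => kh.
rewrite leq_eqVlt => /orP[/eqP->|kn]; first by rewrite eps_out dot0r subnn.
have -> : eps k = alpha (Ordinal kn) + eps k.+1 by rewrite -(epsS alpha (Ordinal kn)).
rewrite dotDr IH; [|by lia|by []].
by rewrite rho1 -?mulrS; [congr (_%:R); lia|exact: (alpha_simple alphaD)].
Qed.

Lemma y_coord_lt k l : (dot rho (eps l) < dot rho (eps k)) = (k < l)%N.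
Proof.
rewrite !rho_eps ?(ltnW (ltn_ord _)) // ltr_nat.
by have := ltn_ord k; have := ltn_ord l; lia.
Qed.

Lemma y_coord_gt0 k : 0 < dot rho (eps k).
Proof. by rewrite rho_eps ?(ltnW (ltn_ord _)) // ltr0n subn_gt0. Qed.

Lemma y_coord_inj : injective y.
Proof.
by move=> k l E; case: (ltngtP k l) => [kl|kl|/val_inj //]; rewrite -y_coord_lt /= E ltxx in kl.
Qed.

Lemma x_coord_neq0 k : x k != 0.
Proof.
apply/rho_root_neq0/(weyl_root rs ss Wu').
exact: (eps_root rs ss alphaD alpha_cartan).
Qed.

(** For [k != l], equal absolute values would make [rho] vanish on the image under [u] of a sum or
    difference of coordinate vectors. These are roots of [Phi] even when the block is of type A. *)
Lemma x_coord_norm_inj : injective (fun k => `|x k|).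
Proof.
move=> k l /eqP; apply: contraTeq => kl; rewrite eqr_norm2 negb_or.
rewrite -subr_eq0 -addr_eq0 -dotBr -dotDr -mulmxBr -mulmxDr.
apply/andP; split; apply/rho_root_neq0/(weyl_root rs ss Wu').
  case: (ltngtP k l) kl => [kl|lk|/val_inj->] kl'; last by rewrite eqxx in kl'.
    exact: (eps_sub_root rs ss alphaD alpha_cartan kl (ltnW (ltn_ord l))).
  rewrite -(root_oppE rs) opprB.
  exact: (eps_sub_root rs ss alphaD alpha_cartan lk (ltnW (ltn_ord k))).
exact: (eps_add_root rs ss alphaD alpha_cartan).
Qed.

Lemma x_coord_inj : injective x.
Proof. by move=> k l E; apply: x_coord_norm_inj; rewrite /= E. Qed.

(** The signed permutation is realized by [M] in the parabolic group, and packing is applied to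
    [M^T]. Positivity of a root is read from y and its membership in the inversion set from x, as
    [split_sign] requires; [sperm_neq1] contradicts [M] = 1. *)
Lemma packing_no_conflict : packing Phi' J (inversions P' u) -> ~ conflict b S y x.
Proof.
move=> pack [s [e [p [q [se H]]]]]; have [M WM ME] := sperm_matrix se.
have [p0 p0E] := eps_vector rs ss alphaD alpha_cartan p.
have [q0 q0E] := eps_vector rs ss alphaD alpha_cartan q.
have actE f v k : (forall k, dot v (eps k) = f k) ->
    dot (M^T *m v) (eps k) = sperm_act s e f k.
  by move=> vE; rewrite dot_mulmxl trmxK ME dotZr vE.
have M1 : M^T = 1%:M.
  apply: (pack _ p0 q0 (refl_group_tr WM)) => g gP.
  have [h rh [c c1 hE]] := block_coord_root (pos_root gP).
  have hp f v : (forall k, dot v (eps k) = f k) ->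
      dot v g = c * h f /\ dot (M^T *m v) g = c * h (sperm_act s e f).
    move=> vE; rewrite !hE; split; congr (_ * _); apply: (coord_root_ext rh) => k //.
    exact: actE.
  have gy : 0 < h y * c by rewrite mulrC -hE; apply: rho_pos.
  have xE : dot rho (u *m g) = c * h x.
    have -> : dot rho (u *m g) = dot (u^T *m rho) g by rewrite dot_mulmxl trmxK.
    rewrite hE; congr (_ * _); apply: (coord_root_ext rh) => k.
    by rewrite dot_mulmxl trmxK.
  have [hpos hneg] := H h rh.
  have [[p1 p2] [q1 q2]] := (hp p p0 p0E, hp q q0 q0E).
  have cy : 0 < c * h y by rewrite mulrC.
  rewrite /chosen; case: ifP => gA.
    move: gA; rewrite inversionsE => /andP[_ /rho_pos]; rewrite dotNr xE -mulrN => xneg.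
    have := same_sign_trans cy xneg; rewrite mulrN oppr_gt0 => /hneg[h1 h2].
    by rewrite q1 q2; split; apply: (same_sign_trans gy).
  have ug : u *m g \in P'.
    by have := inversionsNE rs' ss' Wu gP; rewrite gA => /esym/negbFE.
  have := rho_pos ug; rewrite xE => xpos.
  have /hpos[h1 h2] := same_sign_trans cy xpos.
  by rewrite p1 p2; split; apply: (same_sign_trans gy).
have {}M1 : M = 1%:M by rewrite -[M]trmxK M1 trmx1.
have [_ _ [k kN]] := se; have := ME k; rewrite M1 mul1mx => /(congr1 (dot (eps k))).
have c0 := short_gt0 rs ss alphaD.
rewrite dotZr !(dot_eps rs ss alphaD alpha_cartan) eqxx mulr1.
have [E|ne] := eqVneq k (s k); last by rewrite !mulr0; lra.
rewrite mulr1 => E1; case: kN => [|h]; first by rewrite -E.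
by case: h; apply/eqP; rewrite -(inj_eq (mulIf (lt0r_neq0 c0))) mul1r -E1.
Qed.

(** The indicator of the initial segment [T] pairs to 1 with [alpha i] and to 0 with the rest of
    [J]: it is the fundamental coweight, positive on all roots above [alpha i]. For [c = 1] none of
    these roots is inverted by [u], for [c = -1] all are. *)
Lemma above_pivot (T : {set 'I_n}) i (c : R) :
  T \subset S -> i \in T -> (forall k, k \in T -> (k <= i)%N) -> alpha i \in J ->
  (forall k l, k \in T -> l \in S :\: T -> dot rho (eps l) < dot rho (eps k)) ->
  c = 1 \/ c = -1 ->
  (forall h a, coord_root b S h -> a = 1 \/ a = -1 ->
    0 < a * h (fun k => (k \in T)%:R) -> 0 < c * (a * h x)) ->
  above Phi' J (alpha i) `<=` inversions P' u \/
  above Phi' J (alpha i) `&` inversions P' u = fset0.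
Proof.
move=> TS iT imax iJ Tup c1 Tx; pose f k : R := (k \in T)%:R.
have [v vE] := eps_vector rs ss alphaD alpha_cartan f.
have below k : k \in S -> (k <= i)%N -> k \in T.
  move=> kS ki; apply: contraT => kT; have := Tup i k iT.
  by rewrite inE kT kS y_coord_lt ltnNge ki => /(_ isT).
have above_i k : (i < k)%N -> f k = 0.
  by move=> ik; rewrite /f; case: (boolP (k \in T)) => // /imax; lia.
have vJ j : alpha j \in J -> dot v (alpha j) = (j == i)%:R.
  move=> jJ; have jS : j \in S by rewrite inE jJ.
  rewrite alphaE dotBr vE.
  case: (ltngtP j i) => [ji|ij|/val_inj ->].
  - have j1 : (j.+1 < n)%N by have := ltn_ord i; lia.
    have j1S : Ordinal j1 \in S.
      by rewrite inE; apply/orP; right; apply/existsP; exists j; rewrite eqxx.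
    rewrite -[eps j.+1]/(eps (Ordinal j1)) vE /f below ?(ltnW ji) // below //.
    by rewrite subrr (_ : (j == i) = false) //; apply/eqP => E; rewrite E ltnn in ji.
  - rewrite above_i // (_ : (j == i) = false); last first.
      by apply/eqP => E; rewrite E ltnn in ij.
    have [j1|j1] := ltnP j.+1 n.
      by rewrite -[eps j.+1]/(eps (Ordinal j1)) vE above_i ?subrr //= ltnW.
    by rewrite (_ : j.+1 = n) ?eps_out ?dot0r ?subrr //; have := ltn_ord j; lia.
  - rewrite eqxx {1}/f iT; have [i1|i1] := ltnP i.+1 n.
      by rewrite -[eps i.+1]/(eps (Ordinal i1)) vE above_i ?subr0.
    by rewrite (_ : i.+1 = n) ?eps_out ?dot0r ?subr0 //; have := ltn_ord i; lia.
have key g : g \in above Phi' J (alpha i) -> g \in P' /\ 0 < c * dot rho (u *m g).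
  move=> /(above_not_fsetD1 ss' iJ)[gP gv]; split=> //.
  have v1 : dot v (alpha i) = 1 by rewrite vJ // eqxx.
  have v0 a : a \in J -> a != alpha i -> dot v a = 0.
    move=> aJ ai; have [j E jJ] := simple_index aJ; rewrite E vJ //.
    by have [ji|//] := eqVneq j i; rewrite E ji eqxx in ai.
  have := gv v v1 v0.
  have [h rh [a a1 hE]] := block_coord_root (pos_root gP).
  have -> : dot rho (u *m g) = a * h x.
    have -> : dot rho (u *m g) = dot (u^T *m rho) g by rewrite dot_mulmxl trmxK.
    by rewrite hE; congr (_ * _); apply: (coord_root_ext rh) => k; rewrite dot_mulmxl trmxK.
  rewrite hE (coord_root_ext rh vE); exact: Tx.
case: c1 => cE; [right|left].
  apply/fsetP=> g; rewrite in_fsetI in_fset0; apply/negP=> /andP[/key[gP]].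
  rewrite cE mul1r inversionsE => gu /andP[_ /rho_pos]; rewrite dotNr; lra.
apply/fsubsetP=> g /key[gP]; rewrite cE mulN1r inversionsE gP => gu /=.
have [gu'|//] := weyl_pos_or_neg rs' ss' Wu gP.
by have := rho_pos gu'; lra.
Qed.

Lemma block_pivot : J != fset0 -> packing Phi' J (inversions P' u) ->
  exists2 a, a \in J & above Phi' J a `<=` inversions P' u \/
    above Phi' J a `&` inversions P' u = fset0.
Proof.
move=> J0 /packing_no_conflict noconf; have [a0 a0J] := fset0Pn _ J0.
have [k0 _ k0J] := simple_index a0J; have k0S : k0 \in S by rewrite inE k0J.
have yinj : {in S &, injective y} by move=> k l _ _; apply: y_coord_inj.
have max_in (T : {set 'I_n}) : T != finset.set0 ->
    exists2 i, i \in T & forall k, k \in T -> (k <= i)%N.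
  move=> /set0Pn[t tT]; case: (@arg_maxnP _ t (mem T) (@nat_of_ord n) tT) => i iT imax.
  by exists i.
have [bJ|bJ] := boolP b; [rewrite bJ in noconf | rewrite (negbTE bJ) in noconf].
- have [||||||T [TS T0 Tup [c c1 Tc]]] := @pivot_typeB _ _ S y x k0.
  + by move=> k _; apply: y_coord_gt0.
  + exact: yinj.
  + by move=> k _; apply: x_coord_neq0.
  + by move=> k l _ _; apply: x_coord_norm_inj.
  + exact: k0S.
  + move=> i j iS jS; apply/negP => bad; apply: noconf.
    apply: (conflict_bad_pair _ _ _ _ iS jS bad).
    * by move=> k _; rewrite gt_eqF // y_coord_gt0.
    * move=> k l _ _ /=; rewrite !gtr0_norm ?y_coord_gt0 //; exact: y_coord_inj.
    * by move=> k _; apply: x_coord_neq0.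
    * by move=> k l _ _; apply: x_coord_norm_inj.
  have [i iT imax] := max_in T T0; have iS := fintype.subsetP TS i iT.
  (* In type B the block reaches the short end, so [i] lies between two indices of [J], even if [T]
     is the whole block. *)
  have iJ : alpha i \in J.
    have [j /andP[ji _] jJ] := block_lo iS.
    by apply: (interval_mem ji _ jJ bJ); rewrite -ltnS ltn_ord.
  exists (alpha i) => //; apply: (above_pivot TS iT imax iJ Tup c1).
  have dom k l : k \in T -> l \in S -> l \notin T -> `|x l| < c * x k.
    move=> kT lS lT; have [ck dk] := Tc k kT.
    have : `|x k| = c * x k.
      case: c1 ck => -> ck; first by rewrite mul1r in ck *; rewrite gtr0_norm.
      by rewrite mulN1r oppr_gt0 in ck *; rewrite ltr0_norm.
    by move=> <-; apply: dk; rewrite inE lT.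
  have pos k : k \in T -> 0 < c * x k by case/Tc.
  move=> h a [k l kS lS kl|k _ kS|k l _ kS lS kl] a1.
  + have [kT|kT] := boolP (k \in T); have [lT|lT] := boolP (l \in T) => /=.
    * by rewrite subrr mulr0 ltxx.
    * have := dom k l kT lS lT; rewrite ltr_norml => /andP[].
      by case: a1 => ->; case: c1 => ->; rewrite /=; lra.
    * have := dom l k lT kS kT; rewrite ltr_norml => /andP[].
      by case: a1 => ->; case: c1 => ->; rewrite /=; lra.
    * by rewrite subrr mulr0 ltxx.
  + have [kT|kT] := boolP (k \in T) => /=; last by rewrite mulr0 ltxx.
    by have := pos k kT; case: a1 => ->; lra.
  + have [kT|kT] := boolP (k \in T); have [lT|lT] := boolP (l \in T) => /=.
    * by have := pos k kT; have := pos l lT; case: a1 => ->; lra.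
    * have := dom k l kT lS lT; rewrite ltr_norml => /andP[].
      by case: a1 => ->; case: c1 => ->; rewrite /=; lra.
    * have := dom l k lT kS kT; rewrite ltr_norml => /andP[].
      by case: a1 => ->; case: c1 => ->; rewrite /=; lra.
    * by rewrite addr0 mulr0 ltxx.
have xinj : {in S &, injective x} by move=> k l _ _; apply: x_coord_inj.
have k0n : (k0.+1 < n)%N.
  rewrite ltn_neqAle ltn_ord andbT; apply: contra bJ => /eqP[E].
  by rewrite (_ : ord_max = k0) //; apply: val_inj.
have S1 : (1 < #|S|)%N.
  rewrite (cardsD1 k0) k0S ltnS card_gt0; apply/set0Pn; exists (Ordinal k0n).
  rewrite !inE; apply/andP; split; first by apply/eqP => /(congr1 val) /=; lia.
  by apply/orP; right; apply/existsP; exists k0; rewrite eqxx.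
have [|T [TS T0 T'0 [c c1 Tc]]] := pivot_typeA yinj xinj S1.
  move=> i j k l iS jS kS lS; split; apply/negP => pat; apply: noconf.
    exact: conflict_pattern3142 pat.
  apply: conflict_compl; apply: conflict_pattern3142 pat => //.
  by move=> ? ? ? ? /oppr_inj; apply: x_coord_inj.
have [i iT imax] := max_in T T0; have iS := fintype.subsetP TS i iT.
(* In type A the last index of the block carries no simple root of [J]; the nonempty complement of
   [T] excludes it. *)
have iJ : alpha i \in J.
  have [l lST] := set0Pn _ T'0; have [lS _] := setDP lST.
  have [j /andP[ji _] jJ] := block_lo iS.
  have il : (i < l)%N by rewrite -y_coord_lt; case: (Tc i l iT lST).
  have [j' ij' j'J] := block_hi lS il.
  exact: (interval_mem ji ij' jJ j'J).
exists (alpha i) => //; apply: (above_pivot TS iT imax iJ _ c1).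
  by move=> k l kT /(Tc k l kT)[].
move=> h a [k l kS lS kl|k bT|k l bT] a1; last 2 first.
- by rewrite (negbTE bJ) in bT.
- by rewrite (negbTE bJ) in bT.
have [kT|kT] := boolP (k \in T); have [lT|lT] := boolP (l \in T) => /=.
- by rewrite subrr mulr0 ltxx.
- have [|_] := Tc k l kT; first by rewrite inE lT.
  by case: a1 => ->; rewrite /=; lra.
- have [|_] := Tc l k lT; first by rewrite inE kT.
  by case: a1 => ->; rewrite /=; lra.
- by rewrite subrr mulr0 ltxx.
Qed.

End Pivot.

End Block.

Theorem theorem1p2 (R : realFieldType) (d n : nat)
    (Phi Delta : {fset 'cV[R]_d}) (u : 'M[R]_d) :
  (2 <= n)%N ->
  root_system Phi -> simple_system Phi Delta -> type_B n Delta ->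
  refl_group Delta u ->
  let U := lower_interval Delta u in
  splitting Delta (gen_quotient Delta U) U <-> separable Phi Delta u.
Proof.
case: n => [|[|m]] // _ rs ss [alpha [alphaD alpha_cartan]].
apply: (splitting_separable_iff rs ss) => J w JD irr Wj Phi' A pack.
have rs' : root_system Phi' := cut_root_system rs _.
have ss' : simple_system Phi' J := cut_simple_system ss JD.
have J0 : J != fset0.
  apply/eqP => J0; have [] := irr => Phi'0 _; apply: Phi'0; rewrite -/Phi'.
  apply/fsetP=> b; rewrite in_fset0; apply/negP => /(pos_or_neg rs' ss')[].
    by rewrite J0 pos_roots_fset0 // in_fset0.
  by rewrite J0 pos_roots_fset0 // in_fset0.
have [rho rho1] := exists_rho ss.
apply: (block_pivot rs ss alphaD alpha_cartan JD _ rho1 Wj J0 pack).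
move=> i j k ij jk iJ kJ; apply: contraT => jJ.
have idx a : a \in J -> exists2 l, a = alpha l & l != j.
  move=> aJ; have /alphaD[l E] := fsubsetP JD _ aJ; exists l => //.
  by apply: contraNneq jJ => <-; rewrite -E.
(* A gap at [j] would cut [J] into two nonempty orthogonal parts, since simple roots that are not
   neighbours in the diagram are orthogonal. *)
pose J1 := [fset a in J | `[< exists2 l : 'I_m.+2, a = alpha l & (l < j)%N >]].
pose J2 := [fset a in J | `[< exists2 l : 'I_m.+2, a = alpha l & (j < l)%N >]].
have J1P a : reflect (a \in J /\ exists2 l : 'I_m.+2, a = alpha l & (l < j)%N) (a \in J1).
  by rewrite !inE /=; apply: (iffP andP) => -[aJ /asboolP].
have J2P a : reflect (a \in J /\ exists2 l : 'I_m.+2, a = alpha l & (j < l)%N) (a \in J2).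
  by rewrite !inE /=; apply: (iffP andP) => -[aJ /asboolP].
have [|a b|E|E] := irreducible_simple_connected (J1 := J1) (J2 := J2) rs' ss' _ _ irr.
- apply/fsetP=> a; rewrite in_fsetU; apply/idP/orP => [aJ|[/J1P[]|/J2P[]] //].
  have [l E lj] := idx a aJ; case: (ltngtP l j) => [lt|lt|/val_inj E'].
  + by left; apply/J1P; split=> //; exists l.
  + by right; apply/J2P; split=> //; exists l.
  + by rewrite E' eqxx in lj.
- move=> /J1P[_ [l1 -> l1j]] /J2P[_ [l2 -> jl2]].
  apply: (alpha_far rs ss alphaD alpha_cartan); [apply/eqP; lia|apply/eqP; lia|].
  by apply/eqP => E; rewrite E in l1j; lia.
- have /fsetP/(_ (alpha i)) := E; rewrite in_fset0 => /negP[].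
  by apply/J1P; split=> //; exists i.
- have /fsetP/(_ (alpha k)) := E; rewrite in_fset0 => /negP[].
  by apply/J2P; split=> //; exists k.
Qed.
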